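(* Let $V(a)=ca^\gamma$ for $a\ge0$, with $c,\gamma>0$. (i) Assume $d_{\mathrm{av}}>0$ and that $\psi$ is a probability density on $\mathbb{R}$ with compact support which is strictly positive in a (possibly one-sided) neighborhood of zero. If $\gamma>10$, then for any fixed $\lambda>0$ the functional $H$ is unbounded from below on $\{f\in H^1(\mathbb{R}):\|f\|^2=\lambda\}$. If $\gamma=10$, then for any fixed $\lambda>0$ the functional $H$ is unbounded from below on $\{f\in H^1(\mathbb{R}):\|f\|^2=\lambda\}$ as long as $c$ is large enough. (ii) If $d_{\mathrm{av}}=0$, $\gamma>6$, and $\psi$ is a probability density on $\mathbb{R}$ with compact support which is strictly positive in a (possibly one-sided) neighborhood of zero, then for any fixed $\lambda>0$ the functional $H$ is unbounded from below on $\{f\in L^2(\mathbb{R}):\|f\|^2=\lambda\}$. If $d_{\mathrm{av}}=0$, $\gamma=6$, and $\psi=\mathbf{1}_{[0,1]}$, then for no $\lambda>0$ does there exist a minimizer of $H$ on $\{f\in L^2(\mathbb{R}):\|f\|^2=\lambda\}$.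
   Context: $\|\cdot\|$ is the $L^2(\mathbb{R})$ norm. $T_r=e^{ir\partial_x^2}$ is the unitary free Schrödinger group on $L^2(\mathbb{R})$, i.e. multiplication by $e^{-ir\eta^2}$ in Fourier space. For $d_{\mathrm{av}}\ge0$, $$H(f)=\frac{d_{\mathrm{av}}}{2}\|f'\|^2-N(f),\qquad N(f)=\iint_{\mathbb{R}^2}V(|T_rf(x)|)\,dx\,\psi(r)\,dr,$$ where for $d_{\mathrm{av}}=0$ the kinetic term is absent, so $H=-N$ on $L^2(\mathbb{R})$. In the case $\gamma=10$, ''$c$ large enough'' means larger than a constant that may depend on $\lambda$, $d_{\mathrm{av}}$ and $\psi$. A possibly one-sided neighborhood of zero is a set containing $[0,r_0]$ or $[-r_0,0]$ for some $r_0>0$. *)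

(* Defs.v *)
From HB Require Import structures.
From mathcomp Require Import all_boot all_order all_algebra.
From mathcomp Require Import complex.
From mathcomp Require Import all_classical all_reals all_analysis.

Set Implicit Arguments.
Unset Strict Implicit.
Unset Printing Implicit Defensive.

Import Order.TTheory GRing.Theory Num.Theory.
Import numFieldNormedType.Exports.

Local Open Scope classical_set_scope.
Local Open Scope ring_scope.
Local Open Scope complex_scope.

Section Schrodinger.
Variable R : realType.
Implicit Types (f g : R -> R[i]) (psi phi : R -> R).

Local Notation mu := (@lebesgue_measure R).
Local Notation re := (@complex.Re R).
Local Notation im := (@complex.Im R).
(* R-valued, whereas the norm `|z| of R[i] takes its values in R[i]. *)
Local Notation normc := (@ComplexField.Normc.normc R).

Definition cexpi (t : R) : R[i] := cos t +i* sin t.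

Definition cintegral (D : set R) f : R[i] :=
  (\int[mu]_(x in D) re (f x)) +i* (\int[mu]_(x in D) im (f x)).

(* Elements of L^2(R) are represented by functions; everything below depends
   on them only up to almost everywhere equality. *)
Definition L2 : set (R -> R[i]) :=
  [set f : R -> R[i] | (re \o f \in Lfun mu 2%:E) /\
                       (im \o f \in Lfun mu 2%:E)].

Definition L2norm f : \bar R := ('N[mu]_2%:E [EFin \o normc \o f])%E.

(* The limit in L^2(R) of a sequence; a default value is returned if the
   sequence does not converge. *)
Definition L2lim (u : nat -> R -> R[i]) : R -> R[i] :=
  xget (fun=> 0)
    [set g : R -> R[i] |
      L2 g /\ L2norm (fun x => u n x - g x) @[n --> \oo] --> 0%E].

(* Unitary Fourier transform on L^2(R) as the limit in L^2 of the truncated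
   integrals (2 pi)^(-1/2) \int_(-n)^n e^(- i s x y) f(x) dx; s = 1 gives the
   transform and s = -1 its inverse. *)
Definition fourier_trunc (s : R) f (n : nat) (y : R) : R[i] :=
  (Num.sqrt (2 * pi))^-1%:C *
  cintegral `[- n%:R, n%:R] (fun x => cexpi (- (s * x * y)) * f x).

Definition fourier f : R -> R[i] := L2lim (fourier_trunc 1 f).
Definition inv_fourier f : R -> R[i] := L2lim (fourier_trunc (- 1) f).

(* T_r = e^(i r d^2/dx^2) *)
Definition free_schrodinger (r : R) f : R -> R[i] :=
  inv_fourier (fun y => cexpi (- (r * y ^+ 2)) * fourier f y).

Definition test_function phi : Prop :=
  (forall n x, derivable (derive1n n phi) x 1) /\
  compact (closure [set x | phi x != 0]).

Definition weak_derivative f g : Prop :=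
  forall phi, test_function phi ->
    cintegral setT (fun x => (derive1 phi x)%:C * f x) =
    - cintegral setT (fun x => (phi x)%:C * g x).

Definition H1 : set (R -> R[i]) :=
  [set f : R -> R[i] | L2 f /\ exists2 g, L2 g & weak_derivative f g].

(* For f in H1 this is f', which is unique almost everywhere. *)
Definition wderiv f : R -> R[i] :=
  xget (fun=> 0) [set g : R -> R[i] | L2 g /\ weak_derivative f g].

Definition power_nonlinearity (c gamma a : R) : R := c * a `^ gamma.

Definition nonlocal_energy (V : R -> R) psi f : \bar R :=
  (\int[mu]_r
     ((\int[mu]_x (V (normc (free_schrodinger r f x)))%:E) * (psi r)%:E))%E.

Definition hamiltonian (dav : R) (V : R -> R) psi f : \bar R :=
  if dav == 0 then (- nonlocal_energy V psi f)%E
  else ((dav / 2)%:E * L2norm (wderiv f) ^+ 2 - nonlocal_energy V psi f)%E.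

Definition probability_density psi : Prop :=
  [/\ measurable_fun setT psi, (forall r, 0 <= psi r) &
      (\int[mu]_r (psi r)%:E = 1)%E].

Definition compactly_supported psi : Prop :=
  compact (closure [set r | psi r != 0]).

Definition positive_near_zero psi : Prop :=
  exists2 r0 : R, 0 < r0 &
    (forall r, 0 <= r <= r0 -> 0 < psi r) \/
    (forall r, - r0 <= r <= 0 -> 0 < psi r).

(* {f in X : ||f||^2 = lambda} *)
Definition mass_sphere (X : set (R -> R[i])) (lambda : R) : set (R -> R[i]) :=
  [set f : R -> R[i] | X f /\ (L2norm f ^+ 2 = lambda%:E)%E].

(* The functional may take the value -oo (where the nonlinear term diverges);
   unboundedness is required of its real values. *)
Definition unbounded_below (H : (R -> R[i]) -> \bar R)
    (S : set (R -> R[i])) : Prop :=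
  forall M : R, exists2 f, S f & (-oo < H f < M%:E)%E.

Definition minimizer (H : (R -> R[i]) -> \bar R)
    (S : set (R -> R[i])) f : Prop :=
  S f /\ forall g, S g -> (H f <= H g)%E.

End Schrodinger.

(* Main.v *)
(* Part (i) and the first half of (ii): the free evolution of a chirped Gaussian
   is explicit. Such a beam can be made to focus to width sqrt a at any prescribed
   time, where it stays for a time of order a; the nonlocal term is then at least
   of order c a^(1/2 - gamma/4) times the mass of psi near the focusing time, while
   the kinetic term is at most of order 1/a. Cutting the support of psi into pieces
   of length 2a, some piece carries a mass of order a, so that the focusing time can
   be chosen with N(f) >= c C a^(3/2 - gamma/4); let a tend to 0.

   Second half of (ii): dilating f by 2 in L^2 turns N(f), the integral of
   F(r) = c ||T_r f||_6^6 over [0, 1], into the integral of F over [0, 4]. The local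
   Strichartz estimate makes N(f) finite, so for a minimizer F vanishes at some r in
   ]1, 4]; then T_r f = 0 and f = 0 by injectivity of the Fourier transform. The
   Strichartz estimate is obtained by TT*, applied to (T_r f)^3 as an oscillatory
   integral over R^3: after integration in time and space against Gaussian weights
   the kernel of TT* is positive, and its integral is that of an approximate delta
   function supported on a circle. *)

Require Import Defs.
From HB Require Import structures.
From mathcomp Require Import all_boot all_order all_algebra.
From mathcomp Require Import complex ring lra.
From mathcomp Require Import all_classical all_reals all_analysis.
From mathcomp Require Import measurable_realfun.

Set Implicit Arguments.
Unset Strict Implicit.
Unset Printing Implicit Defensive.

Import Order.TTheory GRing.Theory Num.Theory.
Import numFieldNormedType.Exports.

Local Open Scope classical_set_scope.
Local Open Scope ring_scope.

(** * Affine changes of variable in Lebesgue integrals *)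

Section AffineChange.
Variable R : realType.
Local Notation mu := (@lebesgue_measure R).

(** Scaling fixes the exponents. With t = a^(-1/2), a focused beam of mass lambda has nonlocal
    energy at least a constant times c t^(gamma/2 - 3), against a kinetic term of order t^2: they
    balance at gamma = 10, and without the kinetic term growth starts at gamma = 6. At gamma = 6 the
    factor 4 that the dilation by 2 gives to the sextic integral is the Jacobian of r -> 4r, so only
    the time interval changes. The weights in the Strichartz estimate are Gaussian because their
    Fourier transforms are positive, which is what Schur's test wants. The bound is uniform in the
    radius of the circle because the area of a planar annulus depends only on the increment of the
    squared radius. The obstacle is that T_r f is a limit in L^2 chosen for each r separately, so
    that no joint measurability in (r, x) is at hand. Truncated Fourier integrals are explicit and
    jointly measurable; they give measurability in r of the energies, and bounds pass to T_r f by
    Fatou's lemma. The Fourier transform enters through an L^2 upper bound, from the same TT*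
    inequality, and through its injectivity. *)

Lemma measurable_affine (k t : R) :
  measurable_fun [set: R] (fun x : R => k * x + t).
Proof. by apply: measurable_funD => //; apply: measurable_funM. Qed.

Let affT (k t : R) : measurableTypeR R -> measurableTypeR R :=
  fun x => k * x + t.

Let maffT (k t : R) : measurable_fun setT (affT k t).
Proof. exact: measurable_affine. Qed.

#[local] Hint Extern 0 (measurable_fun _ (affT _ _)) => exact: maffT : core.

Let kpos (k : R) (k0 : 0 < k) : {nonneg R} := NngNum (ltW k0).

(** The left side is a measure in [A] that agrees with Lebesgue measure on half-open intervals, and
    these determine it. *)
Let lebesgue_affine (k t : R) (A : set R) : 0 < k -> measurable A ->
  (k%:E * mu (affT k t @^-1` A))%E = mu A.
Proof.
move=> k0 mA; have [m mE] : exists m : {measure set (measurableTypeR R) -> \bar R},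
    forall A, m A = mu (affT k t @^-1` A).
  by unshelve refine (ex_intro _ (pushforward mu (affT k t) : {measure set _ -> \bar R}) _).
transitivity (mscale (kpos k0) m A); first by rewrite /mscale/= mE.
apply/esym/lebesgue_measure_unique => //= _ [[x y]] _ <-.
move: x y => a b; rewrite /mscale/= mE.
rewrite (_ : affT k t @^-1` `]a, b] = `](a - t) / k, (b - t) / k]%classic).
  rewrite !lebesgue_measure_itv/= !lte_fin ltr_pM2r ?invr_gt0// ltrD2r.
  case: ifP => _; last by rewrite mule0.
  by rewrite -!EFinB -EFinM; congr EFin; field; rewrite gt_eqF.
apply/seteqP; split => x /=; rewrite /affT !in_itv/= ltr_pdivrMr// ler_pdivlMr//;
  by rewrite ltrBlDr lerBrDr (mulrC x).
Qed.

Lemma ge0_integral_affine_pos (k t : R) (f : R -> \bar R) : 0 < k ->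
  measurable_fun setT f -> (forall x, 0 <= f x)%E ->
  (\int[mu]_x f (k * x + t)%R = (k^-1)%:E * \int[mu]_x f x)%E.
Proof.
move=> k0 mf f0; have k1 : 0 < k^-1 by rewrite invr_gt0.
transitivity (\int[pushforward mu (affT k t)]_x f x)%E.
  by rewrite ge0_integral_pushforward.
have := ge0_integral_mscale mu measurableT (kpos k1) mf; move=> /= <-//.
apply: eq_measure_integral => A mA _.
transitivity (k^-1%:E * mu A)%E => //.
by rewrite -(lebesgue_affine t k0 mA) muleA -EFinM mulVf ?gt_eqF// mul1e.
Qed.

Lemma ge0_integral_opp (f : R -> \bar R) :
  measurable_fun setT f -> (forall x, 0 <= f x)%E ->
  (\int[mu]_x f (- x)%R = \int[mu]_x f x)%E.
Proof.
move=> mf f0.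
have -> : (\int[mu]_x f x = \int[pushforward mu (-%R : _ -> measurableTypeR R)]_x f x)%E.
  by apply: eq_measure_integral => A mA _; exact/esym/lebesgue_measureN.
by rewrite ge0_integral_pushforward.
Qed.

Lemma ge0_integral_affine (k t : R) (f : R -> \bar R) : k != 0 ->
  measurable_fun setT f -> (forall x, 0 <= f x)%E ->
  (\int[mu]_x f (k * x + t)%R = (`|k|^-1)%:E * \int[mu]_x f x)%E.
Proof.
move=> k0 mf f0; have [k_gt0|k_lt0|k00] := ltgtP k 0; last by rewrite k00 eqxx in k0.
  rewrite -(@ge0_integral_opp (fun x => f (k * x + t)%R))//; last first.
    by apply: measurableT_comp => //; exact: measurable_affine.
  rewrite ltr0_norm// -(ge0_integral_affine_pos t)// ?oppr_gt0//.
  by apply: eq_integral => x _; rewrite mulrN mulNr.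
by rewrite gtr0_norm// ge0_integral_affine_pos.
Qed.

Lemma integrable_affine (k t : R) (f : R -> \bar R) : k != 0 ->
  mu.-integrable setT f -> mu.-integrable setT (fun x => f (k * x + t)).
Proof.
move=> k0 /integrableP[mf fi]; apply/integrableP; split.
  by apply: measurableT_comp => //; exact: measurable_affine.
rewrite (@ge0_integral_affine k t (fun x => `|f x|%E))//; last exact: measurableT_comp.
by rewrite lte_mul_pinfty// lee_fin.
Qed.

Lemma integral_affine (k t : R) (f : R -> \bar R) : k != 0 ->
  mu.-integrable setT f ->
  (\int[mu]_x f (k * x + t)%R = (`|k|^-1)%:E * \int[mu]_x f x)%E.
Proof.
move=> k0 fi; have /integrableP[mf _] := fi.
rewrite integralE [in RHS]integralE muleBr//; last first.
  exact: integrable_add_def.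
rewrite -!(ge0_integral_affine t)//.
- by congr (_ - _)%E; apply: eq_integral => x _; rewrite ?funeposE ?funenegE.
- exact: measurable_funeneg.
- exact: measurable_funepos.
Qed.

Lemma Rintegral_affine (k t : R) (f : R -> R) : k != 0 ->
  mu.-integrable setT (EFin \o f) ->
  \int[mu]_x f (k * x + t) = `|k|^-1 * \int[mu]_x f x.
Proof.
move=> k0 fi; rewrite /Rintegral (@integral_affine k t (EFin \o f))//.
by rewrite fineM// integrable_fin_num.
Qed.

End AffineChange.

Local Open Scope complex_scope.

(** * Complex-valued integrals *)

Section ComplexBasics.
Variable R : realType.
Local Notation re := (@complex.Re R).
Local Notation im := (@complex.Im R).
Local Notation normc := (@ComplexField.Normc.normc R).

(** The squared modulus, real-valued and polynomial in the two parts, so that identities between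
    moduli become ring identities. *)
Definition sqn (z : R[i]) : R := re z ^+ 2 + im z ^+ 2.

Lemma sqn_ge0 z : 0 <= sqn z.
Proof. by rewrite addr_ge0// sqr_ge0. Qed.

Lemma normcE2 z : normc z = Num.sqrt (sqn z).
Proof. by case: z. Qed.

Lemma normc_sqr z : normc z ^+ 2 = sqn z.
Proof. by rewrite normcE2 sqr_sqrtr// sqn_ge0. Qed.

Lemma normc_ge0 z : 0 <= normc z.
Proof. by rewrite normcE2 sqrtr_ge0. Qed.

Lemma sqnM z w : sqn (z * w) = sqn z * sqn w.
Proof. by case: z => a b; case: w => c d; rewrite /sqn/=; ring. Qed.

Lemma sqnN z : sqn (- z) = sqn z.
Proof. by case: z => a b; rewrite /sqn/= !sqrrN. Qed.

Lemma sqn0 : sqn 0 = 0. Proof. by rewrite /sqn/=; ring. Qed.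

Lemma sqn_real (x : R) : sqn x%:C = x ^+ 2.
Proof. by rewrite /sqn/= expr0n/= addr0. Qed.

Lemma sqn_cexpi (t : R) : sqn (cexpi t) = 1.
Proof. by rewrite /sqn/= cos2Dsin2. Qed.

Lemma sqn_eq0 z : sqn z = 0 -> z = 0.
Proof.
by move=> h; apply: ComplexField.Normc.eq0_normc; rewrite normcE2 h sqrtr0.
Qed.

Lemma sqnD_le z w : sqn (z + w) <= 2 * (sqn z + sqn w).
Proof.
case: z => a b; case: w => c d; rewrite /sqn/=.
by rewrite -subr_ge0 (_ : _ - _ = (a - c) ^+ 2 + (b - d) ^+ 2);
  [rewrite addr_ge0// sqr_ge0|ring].
Qed.

Lemma normr_re_le z : `|re z| <= normc z.
Proof. by rewrite normcE2 -sqrtr_sqr ler_wsqrtr// lerDl sqr_ge0. Qed.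

Lemma normr_im_le z : `|im z| <= normc z.
Proof. by rewrite normcE2 -sqrtr_sqr ler_wsqrtr// lerDr sqr_ge0. Qed.

Lemma cexpiD (s t : R) : cexpi (s + t) = cexpi s * cexpi t.
Proof.
rewrite /cexpi cosD sinD; apply/eqP; rewrite eq_complex/=; apply/andP; split => //.
by rewrite addrC.
Qed.

Lemma cexpi0 : cexpi (0 : R) = 1 :> R[i].
Proof. by rewrite /cexpi cos0 sin0. Qed.

Lemma reM z w : re (z * w) = re z * re w - im z * im w.
Proof. by case: z; case: w. Qed.

Lemma imM z w : im (z * w) = re z * im w + im z * re w.
Proof. by case: z; case: w. Qed.

Lemma reD z w : re (z + w) = re z + re w.
Proof. by case: z; case: w. Qed.

Lemma imD z w : im (z + w) = im z + im w.
Proof. by case: z; case: w. Qed.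

Lemma reN z : re (- z) = - re z. Proof. by case: z. Qed.

Lemma imN z : im (- z) = - im z. Proof. by case: z. Qed.

Lemma eq_c z w : re z = re w -> im z = im w -> z = w.
Proof. by case: z => a b; case: w => c d /= -> ->. Qed.

End ComplexBasics.

Section ComplexMeasurable.
Variable R : realType.
Context d (T : measurableType d).
Local Notation re := (@complex.Re R).
Local Notation im := (@complex.Im R).
Local Notation normc := (@ComplexField.Normc.normc R).
Implicit Types f g : T -> R[i].

(** Measurability part by part, in line with the way [L2] and [cintegral] are stated. *)
Definition cmeas f :=
  measurable_fun setT (re \o f) /\ measurable_fun setT (im \o f).

Lemma cmeasM f g : cmeas f -> cmeas g -> cmeas (fun x => f x * g x).
Proof.
move=> [f1 f2] [g1 g2]; split.
  rewrite (_ : _ \o _ = (fun x => re (f x) * re (g x) - im (f x) * im (g x))).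
    by apply: measurable_funB; apply: measurable_funM.
  by apply/funext => x /=; rewrite reM.
rewrite (_ : _ \o _ = (fun x => re (f x) * im (g x) + im (f x) * re (g x))).
  by apply: measurable_funD; apply: measurable_funM.
by apply/funext => x /=; rewrite imM.
Qed.

Lemma cmeasD f g : cmeas f -> cmeas g -> cmeas (fun x => f x + g x).
Proof.
move=> [f1 f2] [g1 g2]; split.
  rewrite (_ : _ \o _ = (fun x => re (f x) + re (g x))).
    exact: measurable_funD.
  by apply/funext => x /=; rewrite reD.
rewrite (_ : _ \o _ = (fun x => im (f x) + im (g x))).
  exact: measurable_funD.
by apply/funext => x /=; rewrite imD.
Qed.

Lemma cmeas_cst (c : R[i]) : cmeas (fun=> c).
Proof. by split; exact: measurable_cst. Qed.

Lemma cmeasN f : cmeas f -> cmeas (fun x => - f x).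
Proof.
move=> mf; rewrite (_ : (fun x => _) = (fun x => (-1) * f x)).
  by apply: cmeasM => //; exact: cmeas_cst.
by apply/funext => x; rewrite mulN1r.
Qed.

Lemma cmeasB f g : cmeas f -> cmeas g -> cmeas (fun x => f x - g x).
Proof. by move=> mf mg; apply: cmeasD => //; exact: cmeasN. Qed.

Lemma cmeas_real (h : T -> R) : measurable_fun setT h -> cmeas (fun x => (h x)%:C).
Proof. by move=> mh; split => //; exact: measurable_cst. Qed.

Lemma cmeas_cexpi (h : T -> R) : measurable_fun setT h ->
  cmeas (fun x => cexpi (h x)).
Proof.
move=> mh; split; apply: measurableT_comp => //.
  by apply: continuous_measurable_fun; exact: continuous_cos.
by apply: continuous_measurable_fun; exact: continuous_sin.
Qed.

Lemma cmeas_sqn f : cmeas f -> measurable_fun setT (fun x => sqn (f x)).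
Proof.
by move=> [f1 f2]; apply: measurable_funD; apply: measurable_funX.
Qed.

Lemma cmeas_normc f : cmeas f -> measurable_fun setT (fun x => normc (f x)).
Proof.
move=> mf; rewrite (_ : (fun x => _) = Num.sqrt \o (fun x => sqn (f x))); last first.
  by apply/funext => x; rewrite normcE2.
apply: measurableT_comp (cmeas_sqn mf).
by apply: continuous_measurable_fun; exact: sqrt_continuous.
Qed.

Lemma cmeas_comp d' (S : measurableType d') (phi : S -> T) f :
  measurable_fun setT phi -> cmeas f ->
  measurable_fun setT (re \o (f \o phi)) /\ measurable_fun setT (im \o (f \o phi)).
Proof.
by move=> mphi [f1 f2]; split;
  [exact: (measurableT_comp f1 mphi)|exact: (measurableT_comp f2 mphi)].
Qed.

Variable m : {measure set T -> \bar R}.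

Definition cintegrable f :=
  m.-integrable setT (EFin \o (re \o f)) /\ m.-integrable setT (EFin \o (im \o f)).

Definition cint f : R[i] := (\int[m]_x re (f x)) +i* (\int[m]_x im (f x)).

Lemma cintegrable_cmeas f : cintegrable f -> cmeas f.
Proof.
by move=> [/(measurable_int m)/measurable_EFinP ? /(measurable_int m)/measurable_EFinP ?].
Qed.

Lemma cintegrable_le f (g : T -> R) : cmeas f -> m.-integrable setT (EFin \o g) ->
  (forall x, normc (f x) <= g x) -> cintegrable f.
Proof.
move=> [f1 f2] ig fg; split; apply: le_integrable ig => //;
  try exact/measurable_EFinP; move=> x _ /=; rewrite lee_fin (le_trans _ (ler_norm _))//;
  rewrite (le_trans _ (fg x))//.
  exact: normr_re_le.
exact: normr_im_le.
Qed.

Lemma cintegrable_normc f : cintegrable f -> m.-integrable setT (EFin \o (normc \o f)).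
Proof.
move=> [f1 f2].
have i12 : m.-integrable setT (fun x => `|(re (f x))%:E| + `|(im (f x))%:E|)%E.
  by apply: integrableD => //; exact: integrable_abse.
apply: le_integrable i12 => //.
  by apply/measurable_EFinP; exact/cmeas_normc/cintegrable_cmeas.
move=> x _; rewrite /= lee_fin ger0_norm ?normc_ge0//.
rewrite (ger0_norm (addr_ge0 _ _))//.
rewrite normcE2 -(ler_pXn2r (n := 2)) ?nnegrE ?addr_ge0 ?sqrtr_ge0//.
rewrite sqr_sqrtr ?sqn_ge0// sqrrD !real_normK ?num_real// /sqn lerD2r lerDl.
by rewrite mulrn_wge0// mulr_ge0.
Qed.

Lemma cintegrableM_bounded (h : T -> R[i]) f (C : R) : cmeas h ->
  (forall x, normc (h x) <= C) -> cintegrable f -> cintegrable (fun x => h x * f x).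
Proof.
move=> mh hC fi; have mf := cintegrable_cmeas fi.
apply: (@cintegrable_le _ (fun x => C * normc (f x))).
- exact: cmeasM.
- by have := integrableZl measurableT C (cintegrable_normc fi).
- by move=> x; rewrite ComplexField.Normc.normcM ler_wpM2r// normc_ge0.
Qed.

Lemma cintegrableM_cexpi (h : T -> R) f : measurable_fun setT h ->
  cintegrable f -> cintegrable (fun x => cexpi (h x) * f x).
Proof.
move=> mh fi; apply: (@cintegrableM_bounded _ _ 1) => //; first exact: cmeas_cexpi.
by move=> x; rewrite normcE2 sqn_cexpi sqrtr1.
Qed.

Lemma cintegrableZ (c : R[i]) f : cintegrable f -> cintegrable (fun x => c * f x).
Proof.
by move=> fi; apply: (@cintegrableM_bounded _ _ (normc c)) => //; exact: cmeas_cst.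
Qed.

Lemma cintegrableD f g : cintegrable f -> cintegrable g ->
  cintegrable (fun x => f x + g x).
Proof.
move=> [f1 f2] [g1 g2]; split.
  have := integrableD measurableT f1 g1; apply: eq_integrable => // x _ /=.
  by rewrite reD.
have := integrableD measurableT f2 g2; apply: eq_integrable => // x _ /=.
by rewrite imD.
Qed.

Lemma cintD f g : cintegrable f -> cintegrable g ->
  cint (fun x => f x + g x) = cint f + cint g.
Proof.
move=> [f1 f2] [g1 g2]; apply: eq_c => /=.
  by under eq_Rintegral do rewrite reD; rewrite RintegralD.
by under eq_Rintegral do rewrite imD; rewrite RintegralD.
Qed.

Lemma cintZ c f : cintegrable f -> cint (fun x => c * f x) = c * cint f.
Proof.
move=> [f1 f2]; have rf k : m.-integrable setT (EFin \o (fun x => k * re (f x))).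
  exact: (integrableZl measurableT k f1).
have jf k : m.-integrable setT (EFin \o (fun x => k * im (f x))).
  exact: (integrableZl measurableT k f2).
apply: eq_c; rewrite ?reM ?imM/=.
  under eq_Rintegral do rewrite reM.
  by rewrite RintegralB// !RintegralZl.
under eq_Rintegral do rewrite imM.
by rewrite RintegralD// !RintegralZl.
Qed.

Lemma cintB f g : cintegrable f -> cintegrable g ->
  cint (fun x => f x - g x) = cint f - cint g.
Proof.
move=> fi gi; have gi' := cintegrableZ (-1) gi.
rewrite -mulN1r -cintZ// -cintD//; congr cint; apply/funext => x.
by rewrite mulN1r.
Qed.

Lemma eq_cint f g : (forall x, f x = g x) -> cint f = cint g.
Proof. by move=> fg; congr cint; apply/funext. Qed.

End ComplexMeasurable.

(* The product of two sigma-finite measures under a name of its own: the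
   canonical sigma-finite structure that the library attaches to [m1 \x m2] is
   the one of a product of probabilities, which blocks iterated products. *)
Section SigmaFiniteProduct.
Context d1 d2 (T1 : measurableType d1) (T2 : measurableType d2) (R : realType).
Variables (m1 : {sigma_finite_measure set T1 -> \bar R})
          (m2 : {sigma_finite_measure set T2 -> \bar R}).

Definition sprod : set (T1 * T2) -> \bar R := (m1 \x m2)%E.

HB.instance Definition _ := Measure.copy sprod (m1 \x m2)%E.

Lemma sprod_sigma_finite : sigma_finite setT sprod.
Proof.
have /sigma_finiteP[F [TF ndF Foo]] := sigma_finiteT m1.
have /sigma_finiteP[G [TG ndG Goo]] := sigma_finiteT m2.
exists (fun n => F n `*` G n) => [|n].
  apply/seteqP; split => // -[x y] _.
  have [i _ Fx] : (\bigcup_i F i) x by rewrite -TF.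
  have [j _ Gy] : (\bigcup_i G i) y by rewrite -TG.
  exists (maxn i j) => //; split => /=.
    exact: (subsetPset _ _ (ndF _ _ (leq_maxl i j))).
  exact: (subsetPset _ _ (ndG _ _ (leq_maxr i j))).
have [mF Fn] := Foo n; have [mG Gn] := Goo n.
split; first exact: measurableX.
by rewrite [X in (X < _)%E]product_measure1E// lte_mul_pinfty// ge0_fin_numE.
Qed.

HB.instance Definition _ := Measure_isSigmaFinite.Build _ _ _ sprod sprod_sigma_finite.

End SigmaFiniteProduct.

Section ProductIntegrals.
Variable R : realType.
Context d1 d2 (T1 : measurableType d1) (T2 : measurableType d2).
Variables (m1 : {sigma_finite_measure set T1 -> \bar R})
          (m2 : {sigma_finite_measure set T2 -> \bar R}).
Local Notation normc := (@ComplexField.Normc.normc R).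

Lemma integrable_tensor (f : T1 -> R) (g : T2 -> R) :
  m1.-integrable setT (EFin \o f) -> m2.-integrable setT (EFin \o g) ->
  (m1 \x m2)%E.-integrable setT (EFin \o (fun p => f p.1 * g p.2)).
Proof.
move=> fi gi.
have /integrableP[/measurable_EFinP mf fi'] := fi.
have /integrableP[/measurable_EFinP mg gi'] := gi.
apply/integrable12ltyP.
  apply/measurable_EFinP; apply: measurable_funM.
    exact: measurableT_comp mf measurable_fst.
  exact: measurableT_comp mg measurable_snd.
have -> : (\int[m1]_x \int[m2]_y `|(EFin \o (fun p : T1 * T2 => (f p.1 * g p.2)%R)) (x, y)|
   = \int[m1]_x (`|(f x)%:E| * \int[m2]_y `|(g y)%:E|))%E.
  apply: eq_integral => x _; rewrite -ge0_integralZl//; last first.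
    by apply/measurableT_comp => //; exact/measurable_EFinP.
  by apply: eq_integral => y _ /=; rewrite normrM EFinM.
rewrite ge0_integralZr//; last first.
- by apply: integral_ge0.
- by apply/measurableT_comp => //; exact/measurable_EFinP.
by rewrite lte_mul_pinfty//; [apply: integral_ge0|rewrite ge0_fin_numE//; apply: integral_ge0].
Qed.

Lemma Rintegral_fubini1 (f : T1 * T2 -> R) :
  (m1 \x m2)%E.-integrable setT (EFin \o f) ->
  (\int[m1]_x (\int[m2]_y (f (x, y))%:E) = (\int[m1 \x m2]_z f z)%:E)%E.
Proof.
move=> fi; rewrite fineK ?integrable_fin_num//.
by rewrite -(integral12_prod_meas1 fi).
Qed.

Lemma Rintegral_tensor (f : T1 -> R) (g : T2 -> R) :
  m1.-integrable setT (EFin \o f) -> m2.-integrable setT (EFin \o g) ->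
  \int[(m1 \x m2)%E]_p (f p.1 * g p.2) = \int[m1]_x f x * \int[m2]_y g y.
Proof.
move=> fi gi; apply: EFin_inj; rewrite -Rintegral_fubini1; last exact: integrable_tensor.
have -> : (\int[m1]_x \int[m2]_y (f x * g y)%:E =
  \int[m1]_x ((f x)%:E * (\int[m2]_y g y)%:E))%E.
  apply: eq_integral => x _; rewrite fineK ?integrable_fin_num// -integralZl//.
rewrite integralZr// EFinM; congr (_ * _)%E; rewrite fineK//; exact: integrable_fin_num.
Qed.

Lemma cintegrable_tensor (f : T1 -> R[i]) (g : T2 -> R[i]) :
  cintegrable m1 f -> cintegrable m2 g ->
  cintegrable (m1 \x m2)%E (fun p => f p.1 * g p.2).
Proof.
move=> fi gi; apply: (@cintegrable_le _ _ _ _ _ (fun p => normc (f p.1) * normc (g p.2))).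
- have [u1 u2] := cintegrable_cmeas fi; have [v1 v2] := cintegrable_cmeas gi.
  apply: cmeasM; split; [exact: (measurableT_comp u1 measurable_fst)|
    exact: (measurableT_comp u2 measurable_fst)|exact: (measurableT_comp v1 measurable_snd)|
    exact: (measurableT_comp v2 measurable_snd)].
- exact: (integrable_tensor (cintegrable_normc fi) (cintegrable_normc gi)).
- by move=> p; rewrite ComplexField.Normc.normcM.
Qed.

Lemma cint_tensor (f : T1 -> R[i]) (g : T2 -> R[i]) :
  cintegrable m1 f -> cintegrable m2 g ->
  cint (m1 \x m2)%E (fun p => f p.1 * g p.2) = cint m1 f * cint m2 g.
Proof.
move=> [f1 f2] [g1 g2]; apply: eq_c; rewrite ?reM ?imM/=.
  rewrite -(Rintegral_tensor f1 g1) -(Rintegral_tensor f2 g2) -RintegralB//.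
  - by apply: eq_Rintegral => p _; rewrite reM.
  - exact: (integrable_tensor f1 g1).
  - exact: (integrable_tensor f2 g2).
rewrite -(Rintegral_tensor f1 g2) -(Rintegral_tensor f2 g1) -RintegralD//.
- by apply: eq_Rintegral => p _; rewrite imM.
- exact: (integrable_tensor f1 g2).
- exact: (integrable_tensor f2 g1).
Qed.

End ProductIntegrals.

(** * The TT* inequality *)

Section TTstar.
Variable R : realType.
Context d1 d2 (Y : measurableType d1) (O : measurableType d2).
Variables (nu : {sigma_finite_measure set Y -> \bar R})
          (m : {sigma_finite_measure set O -> \bar R}).
Local Notation re := (@complex.Re R).
Local Notation im := (@complex.Im R).
Local Notation normc := (@ComplexField.Normc.normc R).
Variables (theta : Y * O -> R) (w : Y -> R) (h : O -> R[i]) (k : O * O -> R) (C : R).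
Hypothesis mtheta : measurable_fun setT theta.
Hypothesis w0 : forall y, 0 <= w y.
Hypothesis wi : nu.-integrable setT (EFin \o w).
Hypothesis hi : cintegrable m h.
Hypothesis mk : measurable_fun setT k.
Hypothesis k0 : forall p, 0 <= k p.
Hypothesis kcos : forall a b,
  \int[nu]_y (w y * cos (theta (y, a) - theta (y, b))) = k (a, b).
Hypothesis ksin : forall a b,
  \int[nu]_y (w y * sin (theta (y, a) - theta (y, b))) = 0.
Hypothesis ksym : forall a b, k (a, b) = k (b, a).
Hypothesis kC : forall a, (\int[m]_b (k (a, b))%:E <= C%:E)%E.

(** [P + i Q] is h(a) times the conjugate of h(b), and [q y] is the real part of this number
    multiplied by the phase e^(i (theta(y, a) - theta(y, b))). The imaginary part integrates to zero
    by antisymmetry, so that [q y] alone represents the squared modulus of [U y]. *)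
Let P (p : O * O) := re (h p.1) * re (h p.2) + im (h p.1) * im (h p.2).
Let Q (p : O * O) := im (h p.1) * re (h p.2) - re (h p.1) * im (h p.2).
Let q (y : Y) (p : O * O) :=
  cos (theta (y, p.1) - theta (y, p.2)) * P p - sin (theta (y, p.1) - theta (y, p.2)) * Q p.

Let U (y : Y) := cint m (fun a => cexpi (theta (y, a)) * h a).

Let mth y : measurable_fun setT (fun a => theta (y, a)).
Proof. exact: measurableT_comp mtheta (measurable_pair1 y). Qed.

Let mth2 a : measurable_fun setT (fun y => theta (y, a)).
Proof. exact: measurableT_comp mtheta (measurable_pair2 a). Qed.

Let Fi y : cintegrable m (fun a => cexpi (theta (y, a)) * h a).
Proof. exact: cintegrableM_cexpi. Qed.

Let UE y : sqn (U y) = \int[(sprod m m)]_p q y p.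
Proof.
have [f1 f2] := Fi y.
rewrite /sqn/= !expr2 -(Rintegral_tensor f1 f1) -(Rintegral_tensor f2 f2) -RintegralD//.
- apply: eq_Rintegral => -[a b] _ /=; rewrite !reM !imM /q /P /Q /= cosB sinB; ring.
- exact: (integrable_tensor f1 f1).
- exact: (integrable_tensor f2 f2).
Qed.

Let mh1 : measurable_fun setT (fun p : O * O => re (h p.1)).
Proof. by have [u v] := cintegrable_cmeas hi; exact: (measurableT_comp u measurable_fst). Qed.
Let mh2 : measurable_fun setT (fun p : O * O => im (h p.1)).
Proof. by have [u v] := cintegrable_cmeas hi; exact: (measurableT_comp v measurable_fst). Qed.
Let mh3 : measurable_fun setT (fun p : O * O => re (h p.2)).
Proof. by have [u v] := cintegrable_cmeas hi; exact: (measurableT_comp u measurable_snd). Qed.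
Let mh4 : measurable_fun setT (fun p : O * O => im (h p.2)).
Proof. by have [u v] := cintegrable_cmeas hi; exact: (measurableT_comp v measurable_snd). Qed.

Let mP : measurable_fun setT P.
Proof. by apply: measurable_funD; apply: measurable_funM. Qed.

Let mQ : measurable_fun setT Q.
Proof. by apply: measurable_funB; apply: measurable_funM. Qed.

Let nn p := normc (h p.1) * normc (h p.2).

Let PQ p : P p ^+ 2 + Q p ^+ 2 = nn p ^+ 2.
Proof. by rewrite /nn exprMn !normc_sqr /sqn /P /Q; ring. Qed.

Let nn0 p : 0 <= nn p.
Proof. by rewrite mulr_ge0// normc_ge0. Qed.

Let Pnn p : `|P p| <= nn p.
Proof.
rewrite -(ler_pXn2r (n := 2)) ?nnegrE ?nn0// real_normK ?num_real//.
by rewrite -PQ lerDl sqr_ge0.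
Qed.

Let qnn y p : `|q y p| <= nn p.
Proof.
rewrite -(ler_pXn2r (n := 2)) ?nnegrE ?nn0// real_normK ?num_real// -PQ /q.
set c := cos _; set s := sin _.
have cs : c ^+ 2 + s ^+ 2 = 1 by rewrite cos2Dsin2.
(* The squared modulus minus the squared real part is the square of the imaginary part. *)
rewrite -subr_ge0 (_ : _ - _ = (c * Q p + s * P p) ^+ 2); first by rewrite sqr_ge0.
by rewrite -[X in X - _]mul1r -[in X in X - _]cs; ring.
Qed.

Let G (z : Y * (O * O)) := w z.1 * q z.1 z.2.

Let mdiff : measurable_fun setT
  (fun z : Y * (O * O) => theta (z.1, z.2.1) - theta (z.1, z.2.2)).
Proof.
apply: measurable_funB; apply: (measurableT_comp mtheta); apply/measurable_fun_pair => //.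
  exact: measurableT_comp measurable_fst measurable_snd.
exact: measurableT_comp measurable_snd measurable_snd.
Qed.

Let mG : measurable_fun setT G.
Proof.
have /integrableP[/measurable_EFinP mw _] := wi.
apply: measurable_funM; first exact: (measurableT_comp mw measurable_fst).
apply: measurable_funB; apply: measurable_funM.
- apply: (measurableT_comp _ mdiff).
  by apply: continuous_measurable_fun; exact: continuous_cos.
- exact: (measurableT_comp mP measurable_snd).
- apply: (measurableT_comp _ mdiff).
  by apply: continuous_measurable_fun; exact: continuous_sin.
- exact: (measurableT_comp mQ measurable_snd).
Qed.

Let Gi : (nu \x (sprod m m))%E.-integrable setT (EFin \o G).
Proof.
have hn := cintegrable_normc hi.
have J := @integrable_tensor _ _ _ Y (O * O)%type nu (sprod m m) w nn wi (integrable_tensor hn hn).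
apply: (le_integrable _ _ _ J) => //.
  exact/measurable_EFinP.
move=> [y p] _ /=; rewrite lee_fin /G /= !normrM (ger0_norm (w0 y)).
rewrite ler_wpM2l//= (le_trans (qnn y p))// /nn.
by rewrite !ger0_norm ?normc_ge0.
Qed.

Let qi y : (sprod m m).-integrable setT (EFin \o q y).
Proof.
have hn := cintegrable_normc hi.
apply: le_integrable (integrable_tensor hn hn) => //.
  apply/measurable_EFinP; have md : measurable_fun setT (fun p : O * O => theta (y, p.1) - theta (y, p.2)).
    by apply: measurable_funB; [exact: (measurableT_comp (mth y) measurable_fst)|
      exact: (measurableT_comp (mth y) measurable_snd)].
  apply: measurable_funB; apply: measurable_funM => //.
    by apply: (measurableT_comp _ md); apply: continuous_measurable_fun; exact: continuous_cos.
  by apply: (measurableT_comp _ md); apply: continuous_measurable_fun; exact: continuous_sin.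
move=> p _ /=; rewrite lee_fin (le_trans (qnn y p))// /nn.
by rewrite !ger0_norm ?normc_ge0// mulr_ge0 ?normc_ge0.
Qed.

Let wtrig (f : R -> R) : continuous f -> (forall x, `|f x| <= 1) -> forall p : O * O,
  nu.-integrable setT (EFin \o (fun y => w y * f (theta (y, p.1) - theta (y, p.2)))).
Proof.
move=> cf f1 p; have /integrableP[/measurable_EFinP mw _] := wi.
apply: le_integrable wi => //.
  apply/measurable_EFinP; apply: measurable_funM => //.
  apply: measurableT_comp; first exact: continuous_measurable_fun.
  exact: measurable_funB.
by move=> y _ /=; rewrite lee_fin normrM ler_piMr.
Qed.

(** Integrating in [y] first turns the cosine into [k], and [ksin] removes the term in [Q]. *)
Let intG p : (\int[nu]_y (G (y, p))%:E = (P p * k p)%:E)%E.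
Proof.
have i1 := wtrig (@continuous_cos R) (fun x => ltac:(by rewrite ler_norml cos_geN1 cos_le1)) p.
have i2 := wtrig (@continuous_sin R) (fun x => ltac:(by rewrite ler_norml sin_geN1 sin_le1)) p.
rewrite -[LHS]fineK; last first.
  have Gp : nu.-integrable setT (EFin \o (fun y => P p * (w y * cos (theta (y, p.1) - theta (y, p.2))) -
     Q p * (w y * sin (theta (y, p.1) - theta (y, p.2))))).
    have := integrableB measurableT (integrableZl measurableT (P p) i1) (integrableZl measurableT (Q p) i2).
    by apply: eq_integrable.
  rewrite (_ : (fun y => (G (y, p))%:E) = (EFin \o (fun y => P p * (w y * cos (theta (y, p.1) - theta (y, p.2))) -
     Q p * (w y * sin (theta (y, p.1) - theta (y, p.2)))))); first exact: integrable_fin_num.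
  by apply/funext => y /=; congr EFin; rewrite /G/= /q; ring.
congr EFin; transitivity (\int[nu]_y (P p * (w y * cos (theta (y, p.1) - theta (y, p.2))) -
     Q p * (w y * sin (theta (y, p.1) - theta (y, p.2))))).
  by congr fine; apply: eq_integral => y _; congr EFin; rewrite /G/= /q; ring.
rewrite RintegralB//; last 2 first.
  exact: (integrableZl measurableT (P p) i1).
  exact: (integrableZl measurableT (Q p) i2).
by rewrite !RintegralZl// kcos ksin mulr0 subr0 -surjective_pairing.
Qed.

(* [U] is the image of [h] under an oscillatory integral operator [T]; [k] is the
   kernel of [T^* w T], and Schur's test applies to it. *)
Lemma TTstar : (\int[nu]_y (w y * sqn (U y))%:E <= C%:E * \int[m]_a (sqn (h a))%:E)%E.
Proof.
have mh := cintegrable_cmeas hi.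
have ms := cmeas_sqn mh.
have -> : (\int[nu]_y (w y * sqn (U y))%:E = \int[nu]_y \int[sprod m m]_p (G (y, p))%:E)%E.
  apply: eq_integral => y _; rewrite UE EFinM fineK; last exact: (integrable_fin_num measurableT (qi y)).
  by rewrite -integralZl//; exact: qi.
rewrite (@Fubini _ _ Y (O * O)%type _ nu (sprod m m) _ Gi).
under eq_integral do rewrite intG.
(* Since [k] is nonnegative and |P| is at most |h(a)| |h(b)|, the arithmetic-geometric inequality
   separates the two variables. Each half is controlled by [kC], the second one after exchanging the
   variables by [ksym]. *)
pose S (p : O * O) := k p * sqn (h p.1) / 2 + k p * sqn (h p.2) / 2.
have mS1 : measurable_fun setT (fun p : O * O => k p * sqn (h p.1) / 2).
  by do 2 (apply: measurable_funM => //); exact: (measurableT_comp ms measurable_fst).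
have mS2 : measurable_fun setT (fun p : O * O => k p * sqn (h p.2) / 2).
  by do 2 (apply: measurable_funM => //); exact: (measurableT_comp ms measurable_snd).
apply: (@le_trans _ _ (\int[sprod m m]_p (S p)%:E)%E).
  apply: le_trans (lee_abs _) _; apply: le_trans (le_abse_integral _ _ _) _ => //.
    by apply/measurable_EFinP; apply: measurable_funM.
  apply: ge0_le_integral => //.
  - by apply: measurableT_comp => //; apply/measurable_EFinP; apply: measurable_funM.
  - by apply/measurable_EFinP; exact: measurable_funD.
  move=> p _ /=; rewrite lee_fin normrM (ger0_norm (k0 p)) mulrC.
  have -> : S p = k p * ((sqn (h p.1) + sqn (h p.2)) / 2) by rewrite /S; ring.
  rewrite ler_wpM2l// (le_trans (Pnn p))// /nn -!normc_sqr ler_pdivlMr//.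
  rewrite -subr_ge0 (_ : _ - _ = (normc (h p.1) - normc (h p.2)) ^+ 2) ?sqr_ge0//.
  ring.
have hf : (\int[m]_a \int[m]_b (k (a, b) * sqn (h a) / 2)%:E <= (C / 2)%:E * \int[m]_a (sqn (h a))%:E)%E.
  rewrite -ge0_integralZl//; first last.
  - by rewrite lee_fin divr_ge0// -lee_fin; apply: le_trans (kC point); apply: integral_ge0 => x _; rewrite lee_fin.
  - by move=> x _; rewrite lee_fin sqn_ge0.
  - exact/measurable_EFinP.
  apply: ge0_le_integral => //.
  - move=> x _; apply: integral_ge0 => y _.
    by rewrite lee_fin !mulr_ge0 ?sqn_ge0 ?invr_ge0.
  - apply: (measurable_fun_fubini_tonelli_F (fun p : O * O => (k p * sqn (h p.1) / 2)%:E)).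
      exact/measurable_EFinP.
    by move=> p; rewrite lee_fin !mulr_ge0 ?sqn_ge0 ?invr_ge0.
  - by apply: emeasurable_funM => //; exact/measurable_EFinP.
  move=> a _; have -> : (\int[m]_b (k (a, b) * sqn (h a) / 2)%:E = (sqn (h a) / 2)%:E * \int[m]_b (k (a, b))%:E)%E.
    rewrite -ge0_integralZl//; last 2 first.
    - by move=> b _; rewrite lee_fin.
    - by rewrite lee_fin divr_ge0// sqn_ge0.
      by apply: eq_integral => b _; rewrite -EFinM; congr EFin; ring.
    by apply/measurable_EFinP; exact: (measurableT_comp mk (measurable_pair1 a)).
  apply: le_trans (lee_wpmul2l _ (kC a)) _; first by rewrite lee_fin divr_ge0// sqn_ge0.
  by rewrite -!EFinM lee_fin le_eqVlt; apply/orP; left; apply/eqP; ring.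
rewrite (_ : (fun p => (S p)%:E) = (fun p => (k p * sqn (h p.1) / 2)%:E + (k p * sqn (h p.2) / 2)%:E)%E)//.
rewrite ge0_integralD//; first last.
- exact/measurable_EFinP.
- by move=> p _; rewrite lee_fin !mulr_ge0 ?sqn_ge0 ?invr_ge0.
- exact/measurable_EFinP.
- by move=> p _; rewrite lee_fin !mulr_ge0 ?sqn_ge0 ?invr_ge0.
have -> : (C%:E * \int[m]_a (sqn (h a))%:E = (C / 2)%:E * \int[m]_a (sqn (h a))%:E + (C / 2)%:E * \int[m]_a (sqn (h a))%:E)%E.
  rewrite -ge0_muleDl ?lee_fin//; first by rewrite -EFinD -splitr.
    by rewrite divr_ge0// -lee_fin; apply: le_trans (kC point); apply: integral_ge0 => x _; rewrite lee_fin.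
  by rewrite divr_ge0// -lee_fin; apply: le_trans (kC point); apply: integral_ge0 => x _; rewrite lee_fin.
apply: leeD.
  rewrite fubini_tonelli1//.
  - exact/measurable_EFinP.
  - by move=> p; rewrite lee_fin !mulr_ge0 ?sqn_ge0 ?invr_ge0.
rewrite fubini_tonelli2//.
- apply: le_trans hf; apply: ge0_le_integral => //.
  + move=> x _; apply: integral_ge0 => y _.
    by rewrite lee_fin !mulr_ge0 ?sqn_ge0 ?invr_ge0.
  + apply: (measurable_fun_fubini_tonelli_G (fun p : O * O => (k p * sqn (h p.2) / 2)%:E)).
      exact/measurable_EFinP.
    by move=> p; rewrite lee_fin !mulr_ge0 ?sqn_ge0 ?invr_ge0.
  + apply: (measurable_fun_fubini_tonelli_F (fun p : O * O => (k p * sqn (h p.1) / 2)%:E)).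
      exact/measurable_EFinP.
    by move=> p; rewrite lee_fin !mulr_ge0 ?sqn_ge0 ?invr_ge0.
  by move=> b _ /=; under eq_integral do rewrite ksym.
- exact/measurable_EFinP.
- by move=> p; rewrite lee_fin !mulr_ge0 ?sqn_ge0 ?invr_ge0.
Qed.

End TTstar.

(** * Gaussian integrals *)

Section RealGaussian.
Variable R : realType.
Local Notation mu := (@lebesgue_measure R).
Implicit Types (a b x y : R) (f F : R -> R).

Definition gauss a x : R := expR (- (a * x ^+ 2)).

Lemma gauss_ge0 a x : 0 <= gauss a x. Proof. exact: expR_ge0. Qed.

Lemma gauss_le1 a x : 0 <= a -> gauss a x <= 1.
Proof. by move=> a0; rewrite -expR0 ler_expR oppr_le0 mulr_ge0// sqr_ge0. Qed.

Lemma gaussD a x y : gauss a x * gauss a y = expR (- (a * (x ^+ 2 + y ^+ 2))).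
Proof. by rewrite /gauss -expRD; congr expR; ring. Qed.

Lemma is_derive_gauss a x : is_derive x 1 (gauss a) (- (2 * a * x) * gauss a x).
Proof.
rewrite /gauss; apply: is_derive_eq; rewrite /= /GRing.scale/=; ring.
Qed.

Lemma continuous_derive f df : (forall x, is_derive x 1 f (df x)) -> continuous f.
Proof.
move=> h x; apply: differentiable_continuous; apply/derivable1_diffP.
by have [] := h x.
Qed.

Lemma continuous_gauss a : continuous (gauss a).
Proof. exact: (continuous_derive (is_derive_gauss a)). Qed.

Lemma measurable_gauss a : measurable_fun setT (gauss a).
Proof. by apply: continuous_measurable_fun; exact: continuous_gauss. Qed.

Lemma integral_gauss a : 0 < a ->
  (\int[mu]_x (gauss a x)%:E = (Num.sqrt (pi / a))%:E)%E.
Proof.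
move=> a0; have sa0 : 0 < Num.sqrt a by rewrite sqrtr_gt0.
transitivity (\int[mu]_x (gauss_fun (Num.sqrt a * x + 0))%:E)%E.
  apply: eq_integral => x _; congr EFin; congr expR.
  by rewrite addr0 exprMn sqr_sqrtr// ltW.
rewrite (@ge0_integral_affine R (Num.sqrt a) 0 (EFin \o (@gauss_fun R))) ?gt_eqF//.
- rewrite integralT_gauss -EFinM ger0_norm ?ltW// mulrC sqrtrM ?pi_ge0//.
  by rewrite sqrtrV// ltW.
- by apply/measurable_EFinP; exact: measurable_gauss_fun.
- by move=> x; rewrite lee_fin gauss_fun_ge0.
Qed.

Lemma integrable_gauss a : 0 < a -> mu.-integrable setT (EFin \o gauss a).
Proof.
move=> a0; apply/integrableP; split; first by apply/measurable_EFinP; exact: measurable_gauss.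
under eq_integral do rewrite /= ger0_norm ?gauss_ge0//.
by rewrite integral_gauss// ltry.
Qed.

Lemma Rintegral_gauss a : 0 < a -> \int[mu]_x gauss a x = Num.sqrt (pi / a).
Proof. by move=> a0; rewrite /Rintegral integral_gauss. Qed.

(** Half of the Gaussian absorbs the polynomial factor: s <= e^s at s = a x^2 / 2. *)
Lemma sqr_gauss_le a x : 0 < a -> x ^+ 2 * gauss a x <= 2 / a * gauss (a / 2) x.
Proof.
move=> a0.
have -> : gauss a x = gauss (a / 2) x * gauss (a / 2) x.
  by rewrite gaussD; congr expR; field.
rewrite mulrA ler_wpM2r ?gauss_ge0//.
have : a / 2 * x ^+ 2 <= expR (a / 2 * x ^+ 2).
  by rewrite (le_trans _ (expR_ge1Dx _))// lerDr.
move=> h; have {}h : a / 2 * (x ^+ 2 * gauss (a / 2) x) <= 1.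
  by rewrite mulrA /gauss expRN ler_pdivrMr ?expR_gt0// mul1r.
rewrite -(ler_pM2l (x := a / 2)) ?divr_gt0//.
by rewrite (_ : a / 2 * (2 / a) = 1)//; field; rewrite gt_eqF.
Qed.

Lemma norm_gauss_le a x : 0 < a -> `|x| * gauss a x <= (1 + 2 / a) * gauss (a / 2) x.
Proof.
move=> a0; apply: (@le_trans _ _ ((1 + x ^+ 2) * gauss a x)).
  rewrite ler_wpM2r ?gauss_ge0//; rewrite -[x ^+ 2]real_normK ?num_real//.
  by have := sqr_ge0 (`|x| - 1); rewrite sqrrB; have := normr_ge0 x; nra.
rewrite [leLHS]mulrDl [leRHS]mulrDl !mul1r; apply: lerD; last exact: sqr_gauss_le.
rewrite ler_expR.
by have := sqr_ge0 x; nra.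
Qed.

Lemma cvg_integral_trunc (f : R -> R) : mu.-integrable setT (EFin \o f) ->
  (\int[mu]_(x in `[- n%:R, n%:R]) f x) @[n --> \oo] --> \int[mu]_x f x.
Proof.
move=> fi; have /integrableP[mf _] := fi.
pose fn (n : nat) : R -> \bar R := (EFin \o f) \_ `[- n%:R, n%:R].
have [] := @dominated_convergence _ _ _ mu setT measurableT fn (EFin \o f) (abse \o (EFin \o f)).
- move=> n; apply/measurable_restrict => //; exact: measurable_funTS.
- by [].
- apply: aeW => x _; apply: cvg_near_cst; near=> n.
  rewrite /fn patchE mem_set//= in_itv/= -ler_norml.
  by near: n; exact: nbhs_infty_ger.
- exact: integrable_abse.
- apply: aeW => x n _; rewrite /fn patchE; case: ifPn => //= _.
  by rewrite normr0 lee_fin.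
move=> _ _ h; apply: fine_cvg; rewrite fineK; last exact: integrable_fin_num.
apply: cvg_trans h; apply: near_eq_cvg; apply: nearW => n /=.
by rewrite /fn -integral_mkcond.
Unshelve. all: end_near. Qed.

(** The fundamental theorem of calculus on [-n, n]. Limits along the integers suffice, because the
    integral of an integrable function is the limit of these truncated integrals. *)
Lemma Rintegral_derive (f F : R -> R) : (forall x, is_derive x 1 F (f x)) ->
  continuous f -> mu.-integrable setT (EFin \o f) ->
  F n%:R @[n --> \oo] --> (0 : R) -> F (- n%:R) @[n --> \oo] --> (0 : R) ->
  \int[mu]_x f x = 0.
Proof.
move=> dF cf fi F0 F1; have cF := continuous_derive dF.
have h := cvg_integral_trunc fi.
have h' : (F n%:R - F (- n%:R)) @[n --> \oo] --> \int[mu]_x f x.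
  apply: cvg_trans h; apply: near_eq_cvg; near=> n.
  have n0 : (0 : R) < n%:R by rewrite ltr0n; near: n; exact: nbhs_infty_gt.
  rewrite /Rintegral (@continuous_FTC2 _ f F) //.
  - by rewrite (lt_trans _ n0)// oppr_lt0.
  - by apply: continuous_subspaceT.
  - split; [by move=> x _; have [] := dF x|exact: cvg_at_right_filter (cF _)|exact: cvg_at_left_filter (cF _)].
  - by move=> x _; rewrite derive1E; have [_ ->] := dF x.
have h2 : (F n%:R - F (- n%:R)) @[n --> \oo] --> (0 : R).
  by rewrite -[X in _ --> X](subr0 0); apply: cvgB.
by have := cvg_unique _ h' h2; exact.
Unshelve. all: end_near. Qed.

(** Comparison with a multiple of 1/(n+1): the factor 1 + 1/a is such that n + 1 <= (1 + 1/a) (1 + a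
    n^2), and 1 + a n^2 <= e^(a n^2). *)
Lemma cvg_gauss_nat a : 0 < a -> gauss a n%:R @[n --> \oo] --> (0 : R).
Proof.
move=> a0; apply: (@squeeze_cvgr _ _ _ _ (fun=> 0) (fun n => (1 + a^-1) * harmonic n)).
- apply: nearW => n; rewrite gauss_ge0/= /harmonic ler_pdivlMr ?ltr0n// mulrC.
  rewrite /gauss expRN ler_pdivrMr ?expR_gt0//.
  apply: (@le_trans _ _ ((1 + a^-1) * (1 + a * n%:R ^+ 2))); last first.
    by rewrite ler_wpM2l ?expR_ge1Dx// addr_ge0// invr_ge0 ltW.
  have -> : (1 + a^-1) * (1 + a * n%:R ^+ 2) = 1 + n%:R ^+ 2 + (a^-1 + a * n%:R ^+ 2).
    by field; rewrite gt_eqF.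
  rewrite -natr1 (addrC n%:R) -[leLHS]addr0 lerD//.
    by rewrite lerD2l -natrX ler_nat; case: n => // n; rewrite leq_pmulr.
  by apply: addr_ge0; [rewrite invr_ge0 ltW|rewrite mulr_ge0 ?sqr_ge0// ltW].
- exact: cvg_cst.
- rewrite -[X in _ --> X](mulr0 (1 + a^-1)).
  by apply: cvgM; [exact: cvg_cst|exact: cvg_harmonic].
Qed.

Definition gcos a y : R := \int[mu]_x (gauss a x * cos (x * y)).

Lemma continuous_trig (g : R -> R) y : continuous g -> continuous (fun x => g (x * y)).
Proof.
move=> cg x; apply: (@continuous_comp _ _ _ (fun x => x * y) g); last exact: cg.
by apply: cvgM; [exact: cvg_id|exact: cvg_cst].
Qed.

Lemma measurable_trig (g : R -> R) y : continuous g -> measurable_fun setT (fun x => g (x * y)).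
Proof. by move=> cg; apply: continuous_measurable_fun; exact: continuous_trig. Qed.

Lemma norm_cos_le1 x : `|cos x| <= 1.
Proof. by rewrite ler_norml cos_geN1 cos_le1. Qed.

Lemma norm_sin_le1 x : `|sin x| <= 1.
Proof. by rewrite ler_norml sin_geN1 sin_le1. Qed.

Lemma integrable_gauss_trig a (g : R -> R) y : 0 < a -> continuous g ->
  (forall x, `|g x| <= 1) ->
  mu.-integrable setT (EFin \o (fun x => gauss a x * g (x * y))).
Proof.
move=> a0 cg g1; apply: le_integrable (integrable_gauss a0) => //.
  apply/measurable_EFinP; apply: measurable_funM; first exact: measurable_gauss.
  exact: measurable_trig.
by move=> x _ /=; rewrite lee_fin normrM ler_piMr.
Qed.

Lemma integrable_xgauss_trig a (g : R -> R) y : 0 < a -> continuous g ->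
  (forall x, `|g x| <= 1) ->
  mu.-integrable setT (EFin \o (fun x => x * gauss a x * g (x * y))).
Proof.
move=> a0 cg g1.
have a2 : 0 < a / 2 by rewrite divr_gt0.
have := integrableZl measurableT (1 + 2 / a) (integrable_gauss a2); apply: le_integrable => //.
  apply/measurable_EFinP; apply: measurable_funM; last exact: measurable_trig.
  by apply: measurable_funM => //; exact: measurable_gauss.
move=> x _ /=; rewrite lee_fin normrM (le_trans (ler_piMr _ (g1 _)))//.
rewrite normrM (ger0_norm (gauss_ge0 _ _)) (le_trans (norm_gauss_le _ a0))//.
exact: ler_norm.
Qed.

Lemma sin_gauss0 a y : 0 < a -> \int[mu]_x (gauss a x * sin (x * y)) = 0.
Proof.
move=> a0; have i := integrable_gauss_trig y a0 (@continuous_sin R) norm_sin_le1.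
have := Rintegral_affine (k := -1) 0 _ i; rewrite /= normrN1 invr1 mul1r.
rewrite (_ : Rintegral _ _ _ = - \int[mu]_x (gauss a x * sin (x * y))).
  have n1 : -1 != 0 :> R by rewrite oppr_eq0 oner_eq0.
  by move=> /(_ n1)/eqP; rewrite eq_sym -addr_eq0 -mulr2n mulrn_eq0/= => /eqP.
rewrite -[RHS]mulN1r -RintegralZl//; apply: eq_Rintegral => x _.
by rewrite addr0 mulN1r /gauss sqrrN mulNr sinN; ring.
Qed.

(** Integration by parts: the derivative of e^(-a x^2) sin(x y) integrates to zero. *)
Lemma xsin_gauss a y : 0 < a ->
  \int[mu]_x (x * gauss a x * sin (x * y)) = y / (2 * a) * gcos a y.
Proof.
move=> a0; have i := integrable_gauss_trig y a0 (@continuous_cos R) norm_cos_le1.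
have j := integrable_xgauss_trig y a0 (@continuous_sin R) norm_sin_le1.
have d x : is_derive x 1 (fun x => gauss a x * sin (x * y))
   (y * (gauss a x * cos (x * y)) - (2 * a) * (x * gauss a x * sin (x * y))).
  have dg := is_derive_gauss a x.
  have ds : is_derive x 1 (fun x => sin (x * y)) (y * cos (x * y)).
    have dm : is_derive x 1 (fun x => x * y) y.
      by apply: is_derive_eq; rewrite /GRing.scale/=; ring.
    by rewrite [y * cos _]mulrC; exact: (@is_derive1_comp R sin (fun x => x * y) x _ _ (is_derive_sin _) dm).
  by apply: is_derive_eq; rewrite /GRing.scale/=; ring.
have yi := integrableZl measurableT y i.
have ai := integrableZl measurableT (2 * a) j.
have h := Rintegral_derive d _ _ _ _.
have : \int[mu]_x (y * (gauss a x * cos (x * y)) - (2 * a) * (x * gauss a x * sin (x * y))) = 0.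
  apply: h.
  - move=> x; apply: cvgB; apply: cvgM; try exact: cvg_cst.
      apply: cvgM; [exact: continuous_gauss|exact: (continuous_trig (@continuous_cos R))].
    apply: cvgM; last exact: (continuous_trig (@continuous_sin R)).
    by apply: cvgM; [exact: cvg_id|exact: continuous_gauss].
  - by have := integrableB measurableT yi ai; apply: eq_integrable.
  - apply: (@norm_cvg0 _ R^o).
    apply: (@squeeze_cvgr _ _ _ _ (fun=> 0) (fun n => gauss a n%:R)); [|exact: cvg_cst|exact: cvg_gauss_nat].
    by apply: nearW => n; rewrite normr_ge0/= normrM (ger0_norm (gauss_ge0 _ _)) ler_piMr ?gauss_ge0// norm_sin_le1.
  - apply: (@norm_cvg0 _ R^o).
    apply: (@squeeze_cvgr _ _ _ _ (fun=> 0) (fun n => gauss a n%:R)); [|exact: cvg_cst|exact: cvg_gauss_nat].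
    by apply: nearW => n; rewrite normr_ge0/= normrM (ger0_norm (gauss_ge0 _ _)) /gauss sqrrN ler_piMr ?gauss_ge0// norm_sin_le1.
rewrite RintegralB// !RintegralZl// -/(gcos a y) => /eqP; rewrite subr_eq0 => /eqP e.
apply: (mulfI (x := 2 * a)); first by rewrite mulf_neq0// gt_eqF.
by rewrite -e; field; rewrite gt_eqF.
Qed.

(** Differentiation under the integral sign; the derivative in [y] is dominated by |x| e^(-a x^2),
    hence by an integrable Gaussian. The outcome is a linear differential equation for [gcos a]. *)
Lemma is_derive_gcos a y : 0 < a -> is_derive y 1 (gcos a) (- (y / (2 * a) * gcos a y)).
Proof.
move=> a0.
pose f y x := gauss a x * cos (x * y).
have fd y' x : is_derive y' 1 (f^~ x) (- (x * gauss a x * sin (x * y'))).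
  have ds : is_derive y' 1 (fun y => cos (x * y)) (- (x * sin (x * y'))).
    have dm : is_derive y' 1 (fun y => x * y) x.
      by apply: is_derive_eq; rewrite /GRing.scale/=; ring.
    by rewrite -mulrN mulrC; exact: (is_derive1_comp (is_derive_cos (x * y')) dm).
  by rewrite /f; apply: is_derive_eq; rewrite /GRing.scale/=; ring.
have a2 : 0 < a / 2 by rewrite divr_gt0.
have Iy : `]y - 1, y + 1[%classic y by rewrite /= in_itv/=; lra.
have p1 y' x : partial1of2 f y' x = - (x * gauss a x * sin (x * y')).
  by rewrite partial1of2E; have [_ ->] := fd y' x.
have H := @derivable_under_integral _ _ _ mu f setT measurableT y (y - 1) (y + 1) Iy
  _ _ (fun x => (1 + 2 / a) * gauss (a / 2) x).
have H' := @differentiation_under_integral _ _ _ mu f setT measurableT y (y - 1) (y + 1) Iy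
  _ _ (fun x => (1 + 2 / a) * gauss (a / 2) x).
have c1 y' : `]y - 1, y + 1[%classic y' -> mu.-integrable setT (EFin \o f y').
  by move=> _; exact: (integrable_gauss_trig y' a0 (@continuous_cos R) norm_cos_le1).
have c2 y' x : `]y - 1, y + 1[%classic y' -> setT x -> derivable (f^~ x) y' 1.
  by move=> _ _; have [] := fd y' x.
have c3 x : 0 <= (1 + 2 / a) * gauss (a / 2) x.
  by rewrite mulr_ge0 ?gauss_ge0// addr_ge0// divr_ge0// ltW.
have c4 : mu.-integrable setT (EFin \o (fun x => (1 + 2 / a) * gauss (a / 2) x)).
  exact: (integrableZl measurableT (1 + 2 / a) (integrable_gauss a2)).
have c5 y' x : `]y - 1, y + 1[%classic y' -> setT x -> `|partial1of2 f y' x| <= (1 + 2 / a) * gauss (a / 2) x.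
  move=> _ _; rewrite p1 normrN normrM (le_trans (ler_piMr _ (norm_sin_le1 _)))//.
  by rewrite normrM (ger0_norm (gauss_ge0 _ _)) norm_gauss_le.
split; first exact: (H c1 c2 c3 c4 c5).
rewrite -derive1E (H' c1 c2 c3 c4 c5) -xsin_gauss//.
have j := integrable_xgauss_trig y a0 (@continuous_sin R) norm_sin_le1.
rewrite -[RHS]mulN1r -RintegralZl//.
by apply: eq_Rintegral => x _; rewrite p1 mulN1r.
Qed.

(** The equation g' = - y g / (2 a) has the integrating factor e^(y^2 / (4 a)), written here as
    [gauss] with a negative parameter. The product is constant, and its value at 0 is the Gaussian
    integral. *)
Lemma gcosE a y : 0 < a -> gcos a y = Num.sqrt (pi / a) * gauss (4 * a)^-1 y.
Proof.
move=> a0; have a4 : 4 * a != 0 by rewrite mulf_neq0// gt_eqF.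
have h : gcos a y * gauss (- (4 * a)^-1) y = gcos a 0 * gauss (- (4 * a)^-1) 0.
  apply: (@is_derive_0_is_cst _ (fun y => gcos a y * gauss (- (4 * a)^-1) y)) => z.
  have dg := is_derive_gauss (- (4 * a)^-1) z.
  have dc := is_derive_gcos z a0.
  by apply: is_derive_eq; rewrite /GRing.scale/=; field; rewrite gt_eqF.
have e0 : gcos a 0 * gauss (- (4 * a)^-1) 0 = Num.sqrt (pi / a).
  rewrite /gauss expr0n/= mulr0 oppr0 expR0 mulr1 -Rintegral_gauss//.
  by apply: eq_Rintegral => x _; rewrite mulr0 cos0 mulr1.
rewrite -e0 -h -mulrA (_ : gauss _ y * gauss _ y = 1) ?mulr1//.
by rewrite /gauss -expRD mulNr opprK addrN expR0.
Qed.

Lemma cint_gauss a y : 0 < a ->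
  cint mu (fun x => (gauss a x)%:C * cexpi (x * y)) =
  (Num.sqrt (pi / a) * gauss (4 * a)^-1 y)%:C.
Proof.
move=> a0; apply: eq_c => /=.
  rewrite -gcosE//; apply: eq_Rintegral => x _; rewrite mul0r subr0//.
transitivity (\int[mu]_x (gauss a x * sin (x * y))); last exact: sin_gauss0.
by apply: eq_Rintegral => x _; rewrite mul0r addr0.
Qed.

Lemma cintegrable_gauss a (h : R -> R) : 0 < a -> measurable_fun setT h ->
  cintegrable mu (fun x => (gauss a x)%:C * cexpi (h x)).
Proof.
move=> a0 mh; apply: cintegrable_le (integrable_gauss a0) _.
  by apply: cmeasM; [apply: cmeas_real; exact: measurable_gauss|exact: cmeas_cexpi].
move=> x; rewrite normcE2 sqnM sqn_cexpi mulr1 sqn_real sqrtr_sqr ger0_norm//.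
exact: gauss_ge0.
Qed.

End RealGaussian.

Section ComplexFubini.
Variable R : realType.
Context d1 d2 (T1 : measurableType d1) (T2 : measurableType d2).
Variables (m1 : {sigma_finite_measure set T1 -> \bar R})
          (m2 : {sigma_finite_measure set T2 -> \bar R}).

Lemma Rint_fubini (f : T1 * T2 -> R) :
  (m1 \x m2)%E.-integrable setT (EFin \o f) ->
  (forall x, m2.-integrable setT (EFin \o (fun y => f (x, y)))) ->
  (forall y, m1.-integrable setT (EFin \o (fun x => f (x, y)))) ->
  \int[m1]_x (\int[m2]_y f (x, y)) = \int[(m1 \x m2)%E]_p f p /\
  \int[m2]_y (\int[m1]_x f (x, y)) = \int[(m1 \x m2)%E]_p f p.
Proof.
move=> fi i2 i1; split; apply: EFin_inj.
- rewrite -[RHS]Rintegral_fubini1// /Rintegral fineK; last first.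
    apply: (integrable_fin_num measurableT).
    apply: eq_integrable (integrable_fubini_F fi) => // x _ /=.
    by rewrite /fubini_F /Rintegral fineK// (integrable_fin_num _ (i2 x)).
  by apply: eq_integral => x _; rewrite fineK// (integrable_fin_num _ (i2 x)).
- rewrite /Rintegral -(integral21_prod_meas1 fi) /fubini_G.
  have e y : (fine (\int[m1]_x (f (x, y))%:E))%:E = (\int[m1]_x (f (x, y))%:E)%E.
    by rewrite fineK// (integrable_fin_num _ (i1 y)).
  by under [X in (fine X)%:E = _]eq_integral do rewrite e.
Qed.

Lemma cint_fubini (f : T1 * T2 -> R[i]) :
  cintegrable (m1 \x m2)%E f ->
  (forall x, cintegrable m2 (fun y => f (x, y))) ->
  (forall y, cintegrable m1 (fun x => f (x, y))) ->
  cint m1 (fun x => cint m2 (fun y => f (x, y))) = cint (m1 \x m2)%E f /\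
  cint m2 (fun y => cint m1 (fun x => f (x, y))) = cint (m1 \x m2)%E f.
Proof.
move=> [f1 f2] i2 i1.
have [r1 r2] := Rint_fubini f1 (fun x => (i2 x).1) (fun y => (i1 y).1).
have [s1 s2] := Rint_fubini f2 (fun x => (i2 x).2) (fun y => (i1 y).2).
by split; apply: eq_c.
Qed.

End ComplexFubini.

(** * Fourier integrals of Gaussians with complex parameter *)

Section ComplexGaussian.
Variable R : realType.
Local Notation mu := (@lebesgue_measure R).
Local Notation normc := (@ComplexField.Normc.normc R).
Local Notation cj := (@conjc R).
Implicit Types (a b x y : R).

Lemma cint_affine (k t : R) (f : R -> R[i]) : k != 0 -> cintegrable mu f ->
  cint mu (fun x => f (k * x + t)) = (`|k|^-1)%:C * cint mu f.
Proof.
move=> k0 [f1 f2]; apply: eq_c; rewrite ?reM ?imM/= mul0r ?subr0 ?addr0.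
  exact: (Rintegral_affine t k0 f1).
exact: (Rintegral_affine t k0 f2).
Qed.

Lemma cint_conj (f : R -> R[i]) : cintegrable mu f ->
  cint mu (fun x => cj (f x)) = cj (cint mu f).
Proof.
move=> [f1 f2]; apply: eq_c => /=.
  by apply: eq_Rintegral => x _; case: (f x).
by rewrite -[RHS]mulN1r -RintegralZl//; apply: eq_Rintegral => x _; case: (f x) => u v /=; rewrite mulN1r.
Qed.

(** This is exp (- (a + i b) x^2). *)
Definition cgauss a b x : R[i] := (gauss a x)%:C * cexpi (- (b * x ^+ 2)).

Lemma normc_cexpi (t : R) : normc (cexpi t) = 1.
Proof. by rewrite normcE2 sqn_cexpi sqrtr1. Qed.

Lemma normc_real (x : R) : 0 <= x -> normc x%:C = x.
Proof. by move=> x0; rewrite normcE2 sqn_real sqrtr_sqr ger0_norm. Qed.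

Lemma conjc_cexpi (t : R) : cj (cexpi t) = cexpi (- t).
Proof. by apply: eq_c; rewrite /= ?cosN ?sinN. Qed.

Lemma conjcM (z w : R[i]) : cj (z * w) = cj z * cj w.
Proof. by case: z => ? ?; case: w => ? ?; apply: eq_c => /=; ring. Qed.

Lemma cj_real (x : R) : cj x%:C = x%:C :> R[i].
Proof. by apply: eq_c; rewrite //= oppr0. Qed.

Lemma realcM (x y : R) : (x * y)%:C = x%:C * y%:C :> R[i].
Proof. by apply: eq_c => /=; ring. Qed.

Lemma normc_cgauss a b x : normc (cgauss a b x) = gauss a x.
Proof.
by rewrite ComplexField.Normc.normcM normc_cexpi mulr1 normc_real// gauss_ge0.
Qed.

Lemma cmeas_cgauss a b : cmeas (cgauss a b).
Proof.
apply: cmeasM; first by apply: cmeas_real; exact: measurable_gauss.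
by apply: cmeas_cexpi; apply: measurable_funN; apply: measurable_funM.
Qed.

Lemma cintegrable_cgauss a b : 0 < a -> cintegrable mu (cgauss a b).
Proof.
move=> a0; apply: cintegrable_le (integrable_gauss a0) _.
  exact: cmeas_cgauss.
by move=> x; rewrite normc_cgauss.
Qed.

Definition cgaussint a b y : R[i] := cint mu (fun x => cexpi (y * x) * cgauss a b x).

Lemma cintegrable_cgaussint a b y : 0 < a ->
  cintegrable mu (fun x => cexpi (y * x) * cgauss a b x).
Proof.
move=> a0; apply: cintegrableM_cexpi; last exact: cintegrable_cgauss.
exact: measurable_funM.
Qed.

(* With [a + ib = z], the product is a double integral; writing [x = x' + u]
   turns it into real Gaussian Fourier integrals in [x'] and then in [u]. *)
Lemma cgaussintM_conj a b y : 0 < a ->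
  cgaussint a b y * cj (cgaussint a b 0) =
  (pi / Num.sqrt (a ^+ 2 + b ^+ 2))%:C *
  cgauss (a / (4 * (a ^+ 2 + b ^+ 2))) (- b / (4 * (a ^+ 2 + b ^+ 2))) y.
Proof.
move=> a0.
set rho2 := a ^+ 2 + b ^+ 2.
have rho0 : 0 < rho2 by rewrite /rho2 ltr_wpDr ?sqr_ge0// exprn_gt0.
have a2n : a != 0 by rewrite gt_eqF.
have mmul (c : R) : measurable_fun setT (fun x : R => x * c) by apply: measurable_funM.
have rn : rho2 != 0 by rewrite gt_eqF.
have i1 := cintegrable_cgaussint b y a0.
have i0 := cintegrable_cgaussint b 0 a0.
pose g x' := cj (cexpi (0 * x') * cgauss a b x').
have gE x' : g x' = cgauss a (- b) x'.
  by rewrite /g mul0r cexpi0 mul1r /cgauss conjcM cj_real conjc_cexpi mulNr.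
have ig : cintegrable mu g.
  by rewrite (_ : g = cgauss a (- b)); [exact: cintegrable_cgauss|exact/funext].
(* The shift cancels the quadratic terms in x' of the two conjugate phases: what remains is linear
   in x', so that the inner integral is a real Gaussian against a character. *)
have phi2 x' u : cexpi (y * (x' + u)) * cgauss a b (x' + u) * g x' =
    (gauss a (x' + u) * gauss a x')%:C * cexpi (y * (x' + u) - b * u * (2 * x' + u)).
  rewrite gE /cgauss mulNr opprK realcM.
  transitivity ((gauss a (x' + u))%:C * (gauss a x')%:C *
     (cexpi (y * (x' + u)) * cexpi (- (b * (x' + u) ^+ 2)) * cexpi (b * x' ^+ 2))); first by ring.
  by congr (_ * _); rewrite -!cexpiD; congr cexpi; ring.
transitivity (cint mu (fun x' => cint mu (fun x => cexpi (y * x) * cgauss a b x * g x'))).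
  rewrite -cint_conj// -/g.
  transitivity (cint mu (fun x' => cgaussint a b y * g x')).
    by rewrite cintZ.
  apply: eq_cint => x'; rewrite mulrC /cgaussint -cintZ//.
  by apply: eq_cint => x; ring.
pose H (p : R * R) := (gauss a (p.1 + p.2) * gauss a p.1)%:C *
   cexpi (y * (p.1 + p.2) - b * p.2 * (2 * p.1 + p.2)).
transitivity (cint mu (fun x' => cint mu (fun u => H (x', u)))).
  apply: eq_cint => x'.
  have i := cintegrableZ (g x') i1.
  have := @cint_affine 1 x' _ (oner_neq0 _) i.
  rewrite normr1 invr1 mul1r.
  under eq_cint do rewrite mulrC.
  move=> e; transitivity (cint mu (fun x => g x' * (cexpi (y * x) * cgauss a b x))).
    by apply: eq_cint => x; rewrite mulrC.
  by rewrite -e; apply: eq_cint => u; rewrite mul1r [u + x']addrC phi2.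
have mH : cmeas H.
  apply: cmeasM.
    apply: cmeas_real; apply: measurable_funM.
      by apply: measurableT_comp; [exact: measurable_gauss|exact: measurable_funD].
    by apply: measurableT_comp; [exact: measurable_gauss|exact: measurable_fst].
  apply: cmeas_cexpi; apply: measurable_funB.
    by apply: measurable_funM => //; exact: measurable_funD.
  apply: measurable_funM; first by apply: measurable_funM => //; exact: measurable_snd.
  by apply: measurable_funD => //; apply: measurable_funM.
have a4 : 0 < a / 4 by rewrite divr_gt0.
(* Completing the square: 4 ((x + u)^2 + x^2) - (x^2 + u^2) = 7 (x + 4 u / 7)^2 + (5/7) u^2. *)
have Hle p : normc (H p) <= gauss (a / 4) p.1 * gauss (a / 4) p.2.
  rewrite ComplexField.Normc.normcM normc_cexpi mulr1 normc_real; last by rewrite mulr_ge0 ?gauss_ge0.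
  rewrite !gaussD ler_expR lerN2 -mulrA ler_pM2l// mulrC ler_pdivrMr//.
  have := sqr_ge0 (p.1 + p.2 * (4 / 7)); have := sqr_ge0 p.2; lra.
have ga := integrable_gauss a4.
have iH : cintegrable (mu \x mu)%E H.
  by apply: cintegrable_le (integrable_tensor ga ga) _.
have iH1 x : cintegrable mu (fun u => H (x, u)).
  apply: cintegrable_le (integrableZl measurableT (gauss (a / 4) x) ga) _ => //.
    have [h1 h2] := mH; split.
      exact: (measurableT_comp h1 (measurable_pair1 x)).
    exact: (measurableT_comp h2 (measurable_pair1 x)).
have iH2 u : cintegrable mu (fun x => H (x, u)).
  apply: cintegrable_le (integrableZl measurableT (gauss (a / 4) u) ga) _ => //.
    have [h1 h2] := mH; split.
      exact: (measurableT_comp h1 (measurable_pair2 u)).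
    exact: (measurableT_comp h2 (measurable_pair2 u)).
  by move=> x; rewrite mulrC; exact: Hle.
have [-> <-] := cint_fubini iH iH1 iH2.
have aa : 0 < 2 * a by rewrite mulr_gt0.
(* [A] and [u0] come from completing the square in u in a u^2 / 2 + (y - 2 b u)^2 / (8 a), the
   exponent left by the integration in x'. [K] collects the factors that do not contain u. *)
pose A := rho2 / (2 * a).
have A0 : 0 < A by rewrite divr_gt0.
pose u0 := y * b / (2 * rho2).
pose K := (Num.sqrt (pi / (2 * a)) * gauss (a / (8 * rho2)) y)%:C * cexpi (y ^+ 2 * b / (4 * rho2)).
transitivity (cint mu (fun u => K * ((gauss A (1 * u + - u0))%:C * cexpi ((1 * u + - u0) * (y / 2))))).
  apply: eq_cint => u.
  have := @cint_affine 1 (u / 2) _ (oner_neq0 _) (cintegrable_gauss aa (mmul (y - 2 * b * u))).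
  rewrite cint_gauss// normr1 invr1 mul1r => e.
  transitivity ((gauss (a / 2) u)%:C * cexpi (y * u / 2) * cint mu
    (fun x => (gauss (2 * a) (1 * x + u / 2))%:C * cexpi ((1 * x + u / 2) * (y - 2 * b * u)))).
    rewrite -cintZ.
      apply: eq_cint => x; rewrite /H/=.
      transitivity ((gauss (a / 2) u)%:C * (gauss (2 * a) (1 * x + u / 2))%:C *
         (cexpi (y * u / 2) * cexpi ((1 * x + u / 2) * (y - 2 * b * u)))); last by ring.
      rewrite -realcM -cexpiD; congr ((_)%:C * cexpi _); last by field.
      by rewrite /gauss -!expRD; congr expR; field.
    have := cintegrable_gauss aa (mmul (y - 2 * b * u)).
    move=> -[j1 j2]; split.
      exact: (integrable_affine (u / 2) (oner_neq0 R) j1).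
    exact: (integrable_affine (u / 2) (oner_neq0 R) j2).
  rewrite e /K.
  transitivity ((Num.sqrt (pi / (2 * a)))%:C * ((gauss (a / 2) u) * gauss (4 * (2 * a))^-1 (y - 2 * b * u))%:C * cexpi (y * u / 2)).
    by rewrite !realcM; ring.
  transitivity ((Num.sqrt (pi / (2 * a)))%:C * (gauss (a / (8 * rho2)) y * gauss A (u - u0))%:C *
     (cexpi (y ^+ 2 * b / (4 * rho2)) * cexpi ((u - u0) * (y / 2)))); last by rewrite !realcM; ring.
  rewrite -cexpiD; congr (_ * _%:C * cexpi _); last by rewrite /u0; field.
  rewrite /gauss -!expRD; congr expR; rewrite /A /u0 /rho2; field.
  by rewrite a2n -/rho2 rn.
have iA := cintegrable_gauss A0 (mmul (y / 2)).
rewrite cintZ; last first.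
  by move: iA => -[j1 j2]; split; [exact: (integrable_affine (- u0) (oner_neq0 R) j1)|exact: (integrable_affine (- u0) (oner_neq0 R) j2)].
have -> := @cint_affine 1 (- u0) _ (oner_neq0 _) iA.
rewrite normr1 invr1 mul1r cint_gauss// /K /cgauss.
transitivity ((Num.sqrt (pi / (2 * a)) * Num.sqrt (pi / A) * (gauss (a / (8 * rho2)) y * gauss (4 * A)^-1 (y / 2)))%:C * cexpi (y ^+ 2 * b / (4 * rho2))).
  by rewrite !realcM; ring.
rewrite mulrA -realcM; congr ((_ * _)%:C * cexpi _).
- rewrite -sqrtrM; last by rewrite divr_ge0 ?pi_ge0// ltW.
  rewrite (_ : pi / (2 * a) * (pi / A) = pi ^+ 2 * rho2^-1); last first.
    by rewrite /A; field; rewrite a2n rn.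
  rewrite sqrtrM ?sqr_ge0// sqrtr_sqr ger0_norm ?pi_ge0// sqrtrV//; exact: ltW.
- rewrite /gauss -expRD; congr expR; rewrite /A; field.
  by rewrite a2n rn.
- by field.
Qed.

Lemma sqn_cgaussint0 a b : 0 < a ->
  sqn (cgaussint a b 0) = pi / Num.sqrt (a ^+ 2 + b ^+ 2).
Proof.
move=> a0; have := congr1 (@complex.Re R) (cgaussintM_conj b 0 a0).
rewrite /cgauss /gauss expr0n mulr0 mulr0 oppr0 expR0 cexpi0 mulr1 [RHS]/= mulr1.
by rewrite mul0r subr0; case: (cgaussint a b 0) => u v /= <-; rewrite /sqn/= mulrN opprK -!expr2.
Qed.

(** Divide the product formula by the conjugate of the value at 0, which is nonzero since its
    modulus is known. The value at 0 itself stays implicit, which sidesteps the branch of the square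
    root of a + i b; later only its modulus matters. *)
Lemma cgaussintE a b y : 0 < a ->
  cgaussint a b y = cgaussint a b 0 *
  cgauss (a / (4 * (a ^+ 2 + b ^+ 2))) (- b / (4 * (a ^+ 2 + b ^+ 2))) y.
Proof.
move=> a0; have rho0 : 0 < a ^+ 2 + b ^+ 2 by rewrite ltr_wpDr ?sqr_ge0// exprn_gt0.
have h := cgaussintM_conj b y a0; have h0 := sqn_cgaussint0 b a0.
have zz : cgaussint a b 0 * cj (cgaussint a b 0) = (pi / Num.sqrt (a ^+ 2 + b ^+ 2))%:C.
  rewrite -h0; case: (cgaussint a b 0) => u v; apply: eq_c; rewrite /sqn/=; ring.
have nz : cj (cgaussint a b 0) != 0.
  apply/eqP => z0; move: zz; rewrite z0 mulr0 => /(congr1 (@complex.Re R))/= /eqP.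
  by rewrite eq_sym gt_eqF// divr_gt0 ?pi_gt0// sqrtr_gt0.
by apply: (mulIf nz); rewrite h -zz; ring.
Qed.

End ComplexGaussian.

Section ParametricMeasurability.
Variable R : realType.
Context d1 d2 (Y : measurableType d1) (O : measurableType d2).
Variables (nu : {sigma_finite_measure set Y -> \bar R})
          (m : {sigma_finite_measure set O -> \bar R}).

Lemma measurable_Rintegral_param (f : Y * O -> R) :
  (nu \x m)%E.-integrable setT (EFin \o f) ->
  measurable_fun setT (fun y => \int[m]_a f (y, a)).
Proof.
move=> fi; have := measurable_fubini_F fi.
by move=> h; apply: measurableT_comp h; exact: fine_measurable.
Qed.

Lemma cmeas_cint_param (theta : Y * O -> R) (w : Y -> R) (h : O -> R[i]) :
  measurable_fun setT theta -> (forall y, 0 < w y) ->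
  nu.-integrable setT (EFin \o w) -> cintegrable m h ->
  cmeas (fun y => cint m (fun a => cexpi (theta (y, a)) * h a)).
Proof.
move=> mth w0 wi hi.
have /integrableP[/measurable_EFinP mw _] := wi.
have mwV : measurable_fun setT (fun y => (w y)^-1).
  rewrite (_ : (fun y => _) = (fun y => w y `^ (-1))).
    exact: (measurableT_comp (@measurable_powR R (-1)) mw).
  by apply/funext => y; rewrite powR_inv1// ltW.
have Fi y : cintegrable m (fun a => cexpi (theta (y, a)) * h a).
  apply: cintegrableM_cexpi => //; exact: measurableT_comp mth (measurable_pair1 y).
have wC : cintegrable nu (fun y => (w y)%:C).
  apply: cintegrable_le wi _; first exact: cmeas_real.
  by move=> y; rewrite normcE2 sqn_real sqrtr_sqr ger0_norm// ltW.
have [k1 k2] : cintegrable (nu \x m)%E (fun p => cexpi (theta p) * ((w p.1)%:C * h p.2)).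
  by apply: (cintegrableM_cexpi mth); exact: (cintegrable_tensor wC hi).
have e1 := measurable_Rintegral_param k1; have e2 := measurable_Rintegral_param k2.
suff -> : (fun y => cint m (fun a => cexpi (theta (y, a)) * h a)) =
   (fun y => ((w y)^-1)%:C * cint m (fun a => cexpi (theta (y, a)) * ((w y)%:C * h a))).
  apply: cmeasM; first exact: cmeas_real.
  by split.
apply/funext => y.
transitivity (((w y)^-1)%:C * cint m (fun a => (w y)%:C * (cexpi (theta (y, a)) * h a))).
  by rewrite cintZ// mulrA -realcM mulVf ?gt_eqF// mul1r.
by congr (_ * _); apply: eq_cint => a; ring.
Qed.

End ParametricMeasurability.

(** * Bounds for oscillatory integrals *)

Section FourierBound.
Variable R : realType.
Local Notation mu := (@lebesgue_measure R).

Lemma integral_gauss_sub (c a t : R) : 0 < c ->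
  (\int[mu]_b (gauss c (a - b))%:E = (Num.sqrt (pi / c))%:E)%E.
Proof.
move=> c0; transitivity (\int[mu]_b (gauss c (-1 * b + a))%:E)%E.
  by apply: eq_integral => b _; congr (gauss _ _)%:E; ring.
rewrite (@ge0_integral_affine R (-1) a (EFin \o gauss c))//.
- by rewrite normrN1 invr1 mul1e; exact: integral_gauss.
- by apply/measurable_EFinP; exact: measurable_gauss.
- by move=> x; rewrite lee_fin gauss_ge0.
Qed.

Lemma cvg_gauss_inv (x : R) : gauss n.+1%:R^-1 x @[n --> \oo] --> (1 : R).
Proof.
have h : (- (n.+1%:R^-1 * x ^+ 2)) @[n --> \oo] --> (0 : R).
  rewrite -[X in _ --> X]oppr0; apply: cvgN; rewrite -[X in _ --> X](mul0r (x ^+ 2)).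
  by apply: cvgM; [exact: cvg_harmonic|exact: cvg_cst].
by rewrite -[X in _ --> X](@expR0 R); exact: (cvg_comp _ _ h (@continuous_expR R 0)).
Qed.

Lemma nd_gauss_inv (x : R) : nondecreasing_seq (fun n => gauss n.+1%:R^-1 x : R).
Proof.
move=> m n mn; rewrite ler_expR lerN2 ler_wpM2r ?sqr_ge0// lef_pV2 ?posrE ?ltr0n//.
by rewrite ler_nat.
Qed.

(* Removal of the Gaussian cutoff by monotone convergence. *)
Lemma ge0_integral_gauss_lim d (T : measurableType d) (m : {measure set T -> \bar R})
    (q : T -> R) (f : T -> R) (C : \bar R) :
  measurable_fun setT q -> measurable_fun setT f -> (forall y, 0 <= f y) ->
  (forall e : R, 0 < e -> (\int[m]_y (gauss e (q y) * f y)%:E <= C)%E) ->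
  (\int[m]_y (f y)%:E <= C)%E.
Proof.
move=> mq mf f0 h.
pose g (n : nat) y := (gauss n.+1%:R^-1 (q y) * f y)%:E.
have mg n : measurable_fun setT (g n).
  apply/measurable_EFinP; apply: measurable_funM => //.
  by apply: measurableT_comp => //; exact: measurable_gauss.
have gf y : limn (g^~ y) = (f y)%:E.
  apply/cvg_lim => //; apply: cvg_EFin; first exact: nearW.
  rewrite -[X in _ --> X]mul1r /=.
  by apply: cvgM; [exact: cvg_gauss_inv|exact: cvg_cst].
have := @cvg_monotone_convergence _ _ _ m setT measurableT g mg.
move=> /(_ _ _)/cvg_lim H.
have <- : limn (fun n => \int[m]_y g n y)%E = (\int[m]_y (f y)%:E)%E.
  rewrite H//.
  - by apply: eq_integral => y _; rewrite gf.
  - by move=> n x _; rewrite lee_fin mulr_ge0// gauss_ge0.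
  - by move=> x _ i j ij; rewrite lee_fin ler_wpM2r// nd_gauss_inv.
apply: lime_le; last first.
  by apply: nearW => n; apply: h; rewrite invr_gt0 ltr0n.
apply: ereal_nondecreasing_is_cvgn => i j ij; apply: ge0_le_integral => //.
- by move=> x _; rewrite lee_fin mulr_ge0// gauss_ge0.
- by move=> x _; rewrite lee_fin ler_wpM2r// nd_gauss_inv.
Qed.

Definition osc (t : R) (h : R -> R[i]) (y : R) : R[i] :=
  cint mu (fun x => cexpi (t * x * y) * h x).

Lemma cmeas_osc t h : cintegrable mu h -> cmeas (osc t h).
Proof.
move=> hi; apply: (@cmeas_cint_param _ _ _ _ _ mu mu (fun p => t * p.2 * p.1) (gauss 1)) => //.
- by apply: measurable_funM => //; apply: measurable_funM.
- by move=> y; exact: expR_gt0.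
- exact: integrable_gauss.
Qed.

(** The TT* inequality with cutoff e^(-e y^2): the kernel is a Gaussian in a - b whose total mass is
    2 pi for every [e], so the bound survives the removal of the cutoff. The assumption on [t]
    covers both signs of the exponent. *)
Lemma osc_L2_le t h : t ^+ 2 = 1 -> cintegrable mu h ->
  (\int[mu]_y (sqn (osc t h y))%:E <= (2 * pi)%:E * \int[mu]_x (sqn (h x))%:E)%E.
Proof.
move=> t2 hi; have mo := cmeas_osc t hi.
apply: (@ge0_integral_gauss_lim _ _ mu id) => //.
- exact: cmeas_sqn.
- by move=> y; exact: sqn_ge0.
move=> e e0.
pose k (p : R * R) := Num.sqrt (pi / e) * gauss (4 * e)^-1 (p.1 - p.2).
have gt x : gauss (4 * e)^-1 (t * x) = gauss (4 * e)^-1 x.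
  by rewrite /gauss exprMn t2 mul1r.
have e4 : 0 < (4 * e)^-1 by rewrite invr_gt0 mulr_gt0.
apply: (@TTstar _ _ _ _ _ mu mu (fun p => t * p.2 * p.1) (gauss e) h k) => //.
- by apply: measurable_funM => //; apply: measurable_funM.
- by move=> y; exact: gauss_ge0.
- exact: integrable_gauss.
- apply: measurable_funM => //; apply: measurableT_comp; first exact: measurable_gauss.
  exact: measurable_funB.
- by move=> p; rewrite mulr_ge0 ?sqrtr_ge0 ?gauss_ge0.
- move=> a b; rewrite /k/= -gt -gcosE// /gcos.
  by apply: eq_Rintegral => y _ /=; congr (_ * cos _); ring.
- move=> a b; rewrite -(sin_gauss0 (t * (a - b)) e0).
  by apply: eq_Rintegral => y _ /=; congr (_ * sin _); ring.
- by move=> a b; rewrite /k/=; congr (_ * _); rewrite /gauss -sqrrN opprB.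
- move=> a; rewrite /k/=.
  under eq_integral do rewrite EFinM.
  rewrite ge0_integralZl//.
  + rewrite integral_gauss_sub// -EFinM lee_fin -sqrtrM; last by rewrite divr_ge0 ?pi_ge0// ltW.
    rewrite (_ : pi / e * (pi / (4 * e)^-1) = (2 * pi) ^+ 2); last by field; rewrite gt_eqF.
    by rewrite sqrtr_sqr ger0_norm// mulr_ge0 ?pi_ge0.
  + apply/measurable_EFinP; apply: measurableT_comp; first exact: measurable_gauss.
    exact: measurable_funB.
  + by move=> b _; rewrite lee_fin gauss_ge0.
Qed.

End FourierBound.

Section Tonelli.
Variable R : realType.
Context d1 d2 (T1 : measurableType d1) (T2 : measurableType d2).
Variables (m1 : {sigma_finite_measure set T1 -> \bar R})
          (m2 : {sigma_finite_measure set T2 -> \bar R}).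
Variable f : T1 -> T2 -> \bar R.
Hypothesis mf : measurable_fun setT (fun z : T1 * T2 => f z.1 z.2).
Hypothesis f0 : forall x y, (0 <= f x y)%E.

Lemma measurable_tonelli1 : measurable_fun setT (fun x => \int[m2]_y f x y)%E.
Proof. by have := measurable_fun_fubini_tonelli_F (m2 := m2) _ mf; apply. Qed.

Lemma measurable_tonelli2 : measurable_fun setT (fun y => \int[m1]_x f x y)%E.
Proof. by have := measurable_fun_fubini_tonelli_G (m1 := m1) _ mf; apply. Qed.

Lemma tonelli : (\int[m1]_x \int[m2]_y f x y = \int[m2]_y \int[m1]_x f x y)%E.
Proof. exact: (fubini_tonelli (fun z : T1 * T2 => f z.1 z.2)). Qed.

Lemma tonelli_sprod :
  (\int[sprod m1 m2]_z f z.1 z.2 = \int[m1]_x \int[m2]_y f x y)%E.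
Proof. exact: (fubini_tonelli1 (fun z : T1 * T2 => f z.1 z.2)). Qed.

End Tonelli.
Arguments measurable_tonelli1 {R d1 d2 T1 T2} m2 f.
Arguments measurable_tonelli2 {R d1 d2 T1 T2} m1 f.
Arguments tonelli {R d1 d2 T1 T2} m1 m2 f.
Arguments tonelli_sprod {R d1 d2 T1 T2} m1 m2 f.

(** * Integrals of approximate delta functions on circles *)

Section KernelBound.
Variable R : realType.
Local Notation mu := (@lebesgue_measure R).
Local Notation mu2 := (sprod mu mu).
Local Notation mu3 := (sprod mu mu2).
Local Notation Rm := (measurableTypeR R).
Variables (l kap : R -> R) (L M : R).
Hypotheses (cl : continuous l) (l0 : forall x, 0 <= l x)
  (lL : (\int[mu]_x (l x)%:E = L%:E)%E).
Hypotheses (ck : continuous kap) (k0 : forall x, 0 <= kap x)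
  (kM : (\int[mu]_x (kap x)%:E = M%:E)%E).

Let ml : measurable_fun setT l. Proof. exact: continuous_measurable_fun. Qed.
Let mk : measurable_fun setT kap. Proof. exact: continuous_measurable_fun. Qed.

Lemma integral_oneDsqrV : (\int[mu]_t ((1 + t ^+ 2)^-1)%:E = pi%:E)%E.
Proof.
rewrite (@ge0_symfun_integralT R (fun t => (oneDsqr t)^-1))//.
- rewrite (_ : [set x | _] = `[0, +oo[%classic); last first.
    by apply/seteqP; split => x/=; rewrite in_itv/= andbT.
  by rewrite integral0y_oneDsqr -EFinM; congr EFin; field.
- exact: continuous_oneDsqrV.
- by move=> x; rewrite /oneDsqr/= sqrrN.
Qed.

(** The substitution v = q^2 on the half-line, doubled by parity. It is only an inequality because v
    runs over nonnegative values. *)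
Lemma integral_sqr_subst Q : (\int[mu]_q (`|q| * l (Q - q ^+ 2))%:E <= L%:E)%E.
Proof.
pose f q := `|q| * l (Q - q ^+ 2).
have cf : continuous f.
  move=> x; apply: cvgM; first by apply: (@cvg_norm _ R^o); exact: cvg_id.
  have h : Q - q ^+ 2 @[q --> x] --> Q - x ^+ 2.
    by apply: cvgB; [exact: cvg_cst|exact: exprn_continuous].
  exact: (cvg_comp _ _ h (@cl _)).
have f0 q : 0 <= f q by rewrite mulr_ge0.
rewrite (@ge0_symfun_integralT R f)//; last by move=> x; rewrite /f/= normrN sqrrN.
rewrite (_ : [set x | _] = `[0, +oo[%classic); last first.
  by apply/seteqP; split => x/=; rewrite in_itv/= andbT.
have dF (x : R) : is_derive x 1 (fun x : R => x ^+ 2) (2 * x).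
  by apply: is_derive_eq; rewrite /GRing.scale/=; ring.
have F'E : (fun x : R => x ^+ 2)^`()%classic = (fun x => 2 * x).
  by apply/funext => x; rewrite derive1E; have [_ ->] := dF x.
have c2 : continuous (fun x : R => 2 * x).
  by move=> x; apply: cvgM; [exact: cvg_cst|exact: cvg_id].
have cg : continuous (fun v => l (Q - v)).
  move=> x; have h : Q - v @[v --> x] --> Q - x by apply: cvgB; [exact: cvg_cst|exact: cvg_id].
  exact: (cvg_comp _ _ h (@cl _)).
have sq := @exprn_continuous R 2.
have H := @ge0_cvgn_integral R mu f f0 (continuous_measurable_fun cf).
rewrite -(cvg_lim _ H)// -limeMl//; last by apply/cvg_ex; exists (\int[mu]_(x in `[0%R, +oo[) (f x)%:E)%E.
apply: lime_le.
  apply: is_cvgeMl => //; by apply/cvg_ex; exists (\int[mu]_(x in `[0%R, +oo[) (f x)%:E)%E.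
apply: nearW => n.
have -> : (2%:E * \int[mu]_(x in `[0%R, n%:R]) (f x)%:E =
   \int[mu]_(x in `[((0 : R) ^+ 2)%R, ((n%:R : R) ^+ 2)%R]) (l (Q - x))%:E)%E.
  rewrite (@integration_by_substitution_increasing R (fun x : R => x ^+ 2) (fun v => l (Q - v)))//.
  - rewrite F'E -ge0_integralZl//.
    + apply: eq_integral => x; rewrite inE/= in_itv/= => /andP[x0 _].
      by rewrite -EFinM; congr EFin; rewrite /f !fctE ger0_norm//; ring.
    + by apply/measurable_EFinP/measurable_funTS; exact: continuous_measurable_fun.
    + by move=> x _; rewrite lee_fin.
  - by move=> x y; rewrite !in_itv/= => /andP[x0 _] /andP[y0 _] xy; rewrite ltr_pXn2r.
  - by move=> x _; rewrite F'E; exact: c2.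
  - by rewrite F'E; apply/cvg_ex; exists (2 * 0); apply: cvg_at_right_filter; exact: c2.
  - by rewrite F'E; apply/cvg_ex; exists (2 * n%:R); apply: cvg_at_left_filter; exact: c2.
  - split; [by move=> x _; have [] := dF x|exact: cvg_at_right_filter (sq _)|exact: cvg_at_left_filter (sq _)].
  - by apply: continuous_subspaceT.
have mlQ : measurable_fun setT (fun x : R => (l (Q - x))%:E).
  by apply/measurable_EFinP; exact: continuous_measurable_fun.
apply: (@le_trans _ _ (\int[mu]_x (l (Q - x))%:E)%E).
  by apply: ge0_subset_integral => // x _; rewrite lee_fin.
rewrite (_ : (fun x => _) = (fun x => (EFin \o l) (-1 * x + Q))); last first.
  by apply/funext => x /=; congr (l _)%:E; ring.
rewrite (@ge0_integral_affine R (-1) Q (EFin \o l))//.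
- by rewrite normrN1 invr1 mul1e -lL.
- exact/measurable_EFinP.
Qed.

(* Polar coordinates in the form [p = q t], which only uses dilations. *)
Lemma annulus_bound Q :
  (\int[mu]_q \int[mu]_p (l (Q - q ^+ 2 - p ^+ 2))%:E <= (pi * L)%:E)%E.
Proof.
pose F (z : R * R) := (`|z.1| * l (Q - (1 + z.2 ^+ 2) * z.1 ^+ 2))%:E.
have mF : measurable_fun setT F.
  apply/measurable_EFinP; apply: measurable_funM; first by apply: measurableT_comp.
  apply: measurableT_comp => //; apply: measurable_funB => //.
  by apply: measurable_funM; [apply: measurable_funD => //|]; apply: measurable_funX.
have F0 z : (0 <= F z)%E by rewrite lee_fin mulr_ge0.
have mlq : measurable_fun setT (fun z : R * R => (l (Q - z.1 ^+ 2 - z.2 ^+ 2))%:E).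
  apply/measurable_EFinP; apply: measurableT_comp => //.
  by apply: measurable_funB; [apply: measurable_funB => //|]; apply: measurable_funX.
have e q : q != 0 -> (\int[mu]_p (l (Q - q ^+ 2 - p ^+ 2))%:E = \int[mu]_t F (q, t))%E.
  move=> q0; under [RHS]eq_integral do rewrite /F/= EFinM.
  rewrite ge0_integralZl//; last 2 first.
  - apply/measurable_EFinP; apply: measurableT_comp => //; apply: measurable_funB => //.
    by apply: measurable_funM => //; apply: measurable_funD.
  - by move=> t _; rewrite lee_fin.
  have := @ge0_integral_affine R q 0 (fun p => (l (Q - q ^+ 2 - p ^+ 2))%:E) q0.
  have mm : measurable_fun setT (fun p : R => (l (Q - q ^+ 2 - p ^+ 2))%:E).
    exact: (measurableT_comp mlq (measurable_pair1 q)).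
  move=> /(_ mm (fun x => ltac:(by rewrite lee_fin))) h.
  rewrite (_ : (\int[mu]_t (l (Q - (1 + t ^+ 2) * q ^+ 2))%:E =
     \int[mu]_t (l (Q - q ^+ 2 - (q * t + 0) ^+ 2))%:E)%E).
    by rewrite h muleA -EFinM divff ?normr_eq0// mul1e.
  by apply: eq_integral => t _; congr (l _)%:E; ring.
have -> : (\int[mu]_q \int[mu]_p (l (Q - q ^+ 2 - p ^+ 2))%:E = \int[mu]_q \int[mu]_t F (q, t))%E.
  apply: ge0_ae_eq_integral => //.
  - by apply: (@measurable_tonelli1 _ _ _ Rm Rm mu (fun q p => (l (Q - q ^+ 2 - p ^+ 2))%:E)) => // x y; rewrite lee_fin.
  - by apply: (@measurable_tonelli1 _ _ _ Rm Rm mu (fun q t => F (q, t))) => //; rewrite (_ : (fun z => _) = F)//; apply/funext => -[].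
  - by move=> q _; apply: integral_ge0 => p _; rewrite lee_fin.
  - by move=> q _; apply: integral_ge0.
  (* The dilation p = q t is valid except at q = 0, a null set. *)
  exists [set 0]; split => //; first exact: lebesgue_measure_set1.
  by move=> q /= h; apply: contrapT => q0; apply: h => _; apply: e; apply/eqP.
have -> : (\int[mu]_q \int[mu]_t F (q, t) = \int[mu]_t \int[mu]_q F (q, t))%E.
  by apply: (@tonelli _ _ _ Rm Rm mu mu (fun q t => F (q, t))).
(* For fixed t, rescaling q by sqrt (1 + t^2) in |q| dq produces the factor 1 / (1 + t^2), whose
   integral is pi. The dependence on [Q] has disappeared. *)
apply: (@le_trans _ _ (\int[mu]_t (L%:E * ((1 + t ^+ 2)^-1)%:E))%E).
  apply: ge0_le_integral => //.
  - by move=> t _; apply: integral_ge0.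
  - by apply: (@measurable_tonelli2 _ _ _ Rm Rm mu (fun q t => F (q, t))).
  - apply: emeasurable_funM => //; apply/measurable_EFinP.
    by apply: continuous_measurable_fun; exact: continuous_oneDsqrV.
  move=> t _; have k0' : 0 < 1 + t ^+ 2 by rewrite ltr_wpDr// sqr_ge0.
  have sk0 : 0 < Num.sqrt (1 + t ^+ 2) by rewrite sqrtr_gt0.
  have := @ge0_integral_affine R (Num.sqrt (1 + t ^+ 2)) 0 (fun q => (`|q| * l (Q - q ^+ 2))%:E).
  rewrite gt_eqF// => /(_ isT) h.
  have mm : measurable_fun setT (fun q : R => (`|q| * l (Q - q ^+ 2))%:E).
    apply/measurable_EFinP; apply: measurable_funM; first exact: normr_measurable.
    by apply: measurableT_comp => //; exact: measurable_funB.
  have {}h := h mm (fun x => ltac:(by rewrite lee_fin mulr_ge0)).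
  have i := integral_sqr_subst Q.
  rewrite -[X in (_ <= X)%E]muleC.
  apply: le_trans (lee_wpmul2l _ i); last by rewrite lee_fin invr_ge0 ltW.
  rewrite -[X in (X^-1)%:E](sqr_sqrtr (ltW k0')) expr2 invfM EFinM -muleA.
  rewrite -[X in X^-1](ger0_norm (ltW sk0)) -h -ge0_integralZl//.
  - rewrite le_eqVlt; apply/orP; left; apply/eqP; apply: eq_integral => q _.
    rewrite -EFinM /F/= addr0; congr EFin; rewrite normrM exprMn sqr_sqrtr ?ltW//.
    by rewrite -mulrA mulKf// normr_eq0 gt_eqF.
  - by apply: (measurableT_comp mm); exact: measurable_affine.
  - by move=> x _; rewrite lee_fin mulr_ge0.
have L0 : 0 <= L by rewrite -lee_fin -lL; apply: integral_ge0 => x _; rewrite lee_fin.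
rewrite ge0_integralZl//.
- by rewrite integral_oneDsqrV -EFinM mulrC.
- by apply/measurable_EFinP; apply: continuous_measurable_fun; exact: continuous_oneDsqrV.
- by move=> t _; rewrite lee_fin invr_ge0 addr_ge0// sqr_ge0.
Qed.


Let L0 : 0 <= L.
Proof. by rewrite -lee_fin -lL; apply: integral_ge0 => x _; rewrite lee_fin. Qed.

(** On the plane of sum s, the sum of the three squares equals s^2 / 3 + (3/2) (b1 - s/3)^2 + 2 (b2
    - (s - b1)/2)^2. Two affine changes of variable lead to [annulus_bound]; their Jacobian 1 / sqrt
    3 is bounded by 1. *)
Lemma quadratic_bound s T :
  (\int[mu]_b1 \int[mu]_b2 (l (T - (b1 ^+ 2 + b2 ^+ 2 + (s - b1 - b2) ^+ 2)))%:E
    <= (pi * L)%:E)%E.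
Proof.
have s2 : 0 < Num.sqrt 2 :> R by rewrite sqrtr_gt0.
have s3 : 0 < Num.sqrt (3 / 2) :> R by rewrite sqrtr_gt0.
have e22 : Num.sqrt 2 ^+ 2 = 2 :> R by rewrite sqr_sqrtr.
have e32 : Num.sqrt (3 / 2) ^+ 2 = 3 / 2 :> R by rewrite sqr_sqrtr.
have mlq : measurable_fun setT (fun z : R * R => (l (T - s ^+ 2 / 3 - z.1 ^+ 2 - z.2 ^+ 2))%:E).
  apply/measurable_EFinP; apply: measurableT_comp => //.
  by apply: measurable_funB; [apply: measurable_funB => //|]; apply: measurable_funX.
pose J q := (\int[mu]_p (l (T - s ^+ 2 / 3 - q ^+ 2 - p ^+ 2))%:E)%E.
have mJ : measurable_fun setT J.
  by apply: (@measurable_tonelli1 _ _ _ Rm Rm mu (fun q p => (l (T - s ^+ 2 / 3 - q ^+ 2 - p ^+ 2))%:E)) => // x y; rewrite lee_fin.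
have J0 q : (0 <= J q)%E by apply: integral_ge0 => p _; rewrite lee_fin.
have e b1 : (\int[mu]_b2 (l (T - (b1 ^+ 2 + b2 ^+ 2 + (s - b1 - b2) ^+ 2)))%:E =
   (Num.sqrt 2)^-1%:E * J (Num.sqrt (3 / 2) * b1 + - (Num.sqrt (3 / 2) * s / 3))%R)%E.
  have h := @ge0_integral_affine R (Num.sqrt 2) (- (Num.sqrt 2 * (s - b1) / 2))
    (fun p => (l (T - s ^+ 2 / 3 - (Num.sqrt (3 / 2) * b1 + - (Num.sqrt (3 / 2) * s / 3)) ^+ 2 - p ^+ 2))%:E).
  rewrite /J -[X in X^-1](ger0_norm (ltW s2)) -h.
  - apply: eq_integral => b2 _; congr (l _)%:E.
    have -> : (Num.sqrt (3 / 2) * b1 - Num.sqrt (3 / 2) * s / 3) ^+ 2 = 3 / 2 * (b1 - s / 3) ^+ 2.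
      by rewrite -[3 / 2 in RHS]e32; ring.
    have -> : (Num.sqrt 2 * b2 - Num.sqrt 2 * (s - b1) / 2) ^+ 2 = 2 * (b2 - (s - b1) / 2) ^+ 2.
      by rewrite -[X in _ = X * _]e22; ring.
    by field.
  - by rewrite gt_eqF.
  - apply/measurable_EFinP; apply: measurableT_comp => //; apply: measurable_funB => //.
  - by move=> p; rewrite lee_fin.
have sV (x : R) : 1 <= x -> (0 <= ((Num.sqrt x)^-1)%:E <= 1)%E.
  by move=> x1; rewrite lee_fin invr_ge0 sqrtr_ge0/= lee_fin invf_le1 ?sqrtr_gt0 ?(lt_le_trans _ x1)// -sqrtr1 ler_wsqrtr.
under eq_integral do rewrite e.
have /andP[u0 u1] := sV 2 ltac:(by rewrite ler1n).
have /andP[v0 v1] := sV (3 / 2) ltac:(lra).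
rewrite ge0_integralZl//; last by apply: (measurableT_comp mJ); exact: measurable_affine.
rewrite (@ge0_integral_affine R (Num.sqrt (3 / 2)) _ J) ?gt_eqF// (ger0_norm (ltW s3)).
have IJ0 : (0 <= \int[mu]_x J x)%E by apply: integral_ge0.
apply: le_trans (annulus_bound (T - s ^+ 2 / 3)) => //.
apply: (@le_trans _ _ ((Num.sqrt (3 / 2))^-1%:E * \int[mu]_x J x)%E).
  by rewrite -[leRHS]mul1e lee_wpmul2r// mule_ge0.
by rewrite -[leRHS]mul1e lee_wpmul2r.
Qed.

(** The third variable is replaced by the sum s = b1 + b2 + b3 and s is integrated last. With s
    fixed, [l] contributes at most pi L by [quadratic_bound]; then [kap] contributes M. Uniformity
    in [S] and [T] is what Schur's test requires. *)
Lemma kernel_bound S T :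
  (\int[mu3]_b (l (T - (b.1 ^+ 2 + (b.2.1 ^+ 2 + b.2.2 ^+ 2))) *
     kap (S - (b.1 + (b.2.1 + b.2.2))))%:E <= (pi * L * M)%:E)%E.
Proof.
pose f (b1 b2 b3 : R) := (l (T - (b1 ^+ 2 + (b2 ^+ 2 + b3 ^+ 2))) *
     kap (S - (b1 + (b2 + b3))))%:E.
pose g (b1 b2 s : R) := (l (T - (b1 ^+ 2 + b2 ^+ 2 + (s - b1 - b2) ^+ 2)) * kap (S - s))%:E.
have f0 b1 b2 b3 : (0 <= f b1 b2 b3)%E by rewrite lee_fin mulr_ge0.
have g0 b1 b2 b3 : (0 <= g b1 b2 b3)%E by rewrite lee_fin mulr_ge0.
have mf d (X : measurableType d) (u v w : X -> R) : measurable_fun setT u ->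
    measurable_fun setT v -> measurable_fun setT w ->
    measurable_fun setT (fun z => f (u z) (v z) (w z)).
  move=> mu' mv mw; apply/measurable_EFinP; apply: measurable_funM;
    apply: measurableT_comp => //; apply: measurable_funB => //.
    by apply: measurable_funD; [|apply: measurable_funD]; exact: measurable_funX.
  by apply: measurable_funD => //; apply: measurable_funD.
have mg d (X : measurableType d) (u v w : X -> R) : measurable_fun setT u ->
    measurable_fun setT v -> measurable_fun setT w ->
    measurable_fun setT (fun z => g (u z) (v z) (w z)).
  move=> mu' mv mw; apply/measurable_EFinP; apply: measurable_funM;
    apply: measurableT_comp => //; apply: measurable_funB => //.
  apply: measurable_funD; first by apply: measurable_funD; exact: measurable_funX.
  by apply: measurable_funX; apply: measurable_funB => //; exact: measurable_funB.
have m21 : measurable_fun setT (fun b : R * (R * R) => b.2.1).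
  exact: measurableT_comp measurable_fst measurable_snd.
have m22 : measurable_fun setT (fun b : R * (R * R) => b.2.2).
  exact: measurableT_comp measurable_snd measurable_snd.
have -> : (\int[mu3]_b (l (T - (b.1 ^+ 2 + (b.2.1 ^+ 2 + b.2.2 ^+ 2))) *
     kap (S - (b.1 + (b.2.1 + b.2.2))))%:E = \int[mu]_b1 \int[mu2]_b' f b1 b'.1 b'.2)%E.
  apply: (@tonelli_sprod _ _ _ Rm (Rm * Rm)%type mu mu2 (fun b1 b' => f b1 b'.1 b'.2)) => //.
  exact: mf.
have -> : (\int[mu]_b1 \int[mu2]_b' f b1 b'.1 b'.2 = \int[mu]_b1 \int[mu]_b2 \int[mu]_s g b1 b2 s)%E.
  apply: eq_integral => b1 _.
  transitivity (\int[mu]_b2 \int[mu]_b3 f b1 b2 b3)%E.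
    apply: (@tonelli_sprod _ _ _ Rm Rm mu mu (fun b2 b3 => f b1 b2 b3)) => //.
    exact: (mf _ _ (fun=> b1)).
  apply: eq_integral => b2 _.
  have h := @ge0_integral_affine R 1 (b1 + b2) (fun s => g b1 b2 s).
  rewrite normr1 invr1 mul1e in h; rewrite -h//; last exact: (mg _ _ (fun=> b1) (fun=> b2)).
  by apply: eq_integral => b3 _; rewrite /f /g; congr (l _ * kap _)%:E; ring.
have -> : (\int[mu]_b1 \int[mu]_b2 \int[mu]_s g b1 b2 s = \int[mu]_s \int[mu]_b1 \int[mu]_b2 g b1 b2 s)%E.
  transitivity (\int[mu]_b1 \int[mu]_s \int[mu]_b2 g b1 b2 s)%E.
    apply: eq_integral => b1 _; apply: (@tonelli _ _ _ Rm Rm mu mu (fun b2 s => g b1 b2 s)) => //.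
    exact: (mg _ _ (fun=> b1)).
  apply: (@tonelli _ _ _ Rm Rm mu mu (fun b1 s => \int[mu]_b2 g b1 b2 s)%E).
  - apply: (@measurable_tonelli1 _ _ _ (Rm * Rm)%type Rm mu (fun (z : R * R) b2 => g z.1 b2 z.2)) => //.
    apply: mg => //; first exact: measurableT_comp measurable_fst measurable_fst.
    exact: measurableT_comp measurable_snd measurable_fst.
  - by move=> x y; apply: integral_ge0.
apply: (@le_trans _ _ (\int[mu]_s ((pi * L)%:E * (kap (S - s))%:E))%E).
  apply: ge0_le_integral => //.
  - by move=> s _; apply: integral_ge0 => b1 _; apply: integral_ge0.
  - apply: (@measurable_tonelli2 _ _ _ Rm Rm mu (fun b1 s => \int[mu]_b2 g b1 b2 s)%E).
      apply: (@measurable_tonelli1 _ _ _ (Rm * Rm)%type Rm mu (fun (z : R * R) b2 => g z.1 b2 z.2)) => //.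
      apply: mg => //; first exact: measurableT_comp measurable_fst measurable_fst.
      exact: measurableT_comp measurable_snd measurable_fst.
    by move=> x y; apply: integral_ge0.
  - apply: emeasurable_funM => //; apply/measurable_EFinP; apply: measurableT_comp => //.
    exact: measurable_funB.
  move=> s _; rewrite muleC.
  have q := quadratic_bound s T.
  have ks : (0 <= (kap (S - s))%:E)%E by rewrite lee_fin.
  apply: le_trans (lee_wpmul2l ks q).
  have mq d (X : measurableType d) (u v : X -> R) : measurable_fun setT u -> measurable_fun setT v ->
      measurable_fun setT (fun z => (l (T - (u z ^+ 2 + v z ^+ 2 + (s - u z - v z) ^+ 2)))%:E).
    move=> mu' mv; apply/measurable_EFinP; apply: measurableT_comp => //; apply: measurable_funB => //.
    apply: measurable_funD; first by apply: measurable_funD; exact: measurable_funX.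
    by apply: measurable_funX; apply: measurable_funB => //; exact: measurable_funB.
  rewrite -ge0_integralZl//; first last.
  - by move=> x _; apply: integral_ge0 => y _; rewrite lee_fin.
  - apply: (@measurable_tonelli1 _ _ _ Rm Rm mu (fun b1 b2 => (l (T - (b1 ^+ 2 + b2 ^+ 2 + (s - b1 - b2) ^+ 2)))%:E)).
      exact: mq.
    by move=> x y; rewrite lee_fin.
  rewrite le_eqVlt; apply/orP; left; apply/eqP; apply: eq_integral => b1 _.
  rewrite -ge0_integralZl//.
  - by apply: eq_integral => b2 _; rewrite -EFinM /g mulrC.
  - exact: (mq _ _ (fun=> b1)).
  - by move=> x _; rewrite lee_fin.
have pL0 : 0 <= pi * L by rewrite mulr_ge0 ?pi_ge0.
have mkS : measurable_fun setT (fun s : R => (kap (S - s))%:E).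
  by apply/measurable_EFinP; apply: measurableT_comp => //; exact: measurable_funB.
rewrite ge0_integralZl//; last by move=> s _; rewrite lee_fin.
rewrite [X in (_ <= X)%E]EFinM lee_wpmul2l// (_ : (fun x => (kap (S - x))%:E) = (fun x => (EFin \o kap) (-1 * x + S))); last first.
  by apply/funext => x /=; congr (kap _)%:E; ring.
rewrite (@ge0_integral_affine R (-1) S (EFin \o kap))//.
- by rewrite normrN1 invr1 mul1e -kM.
- exact/measurable_EFinP.
Qed.

End KernelBound.

(** * The local Strichartz estimate *)

Section Strichartz.
Variable R : realType.
Local Notation mu := (@lebesgue_measure R).
Local Notation mu2 := (sprod mu mu).
Local Notation mu3 := (sprod mu mu2).
Local Notation Rm := (measurableTypeR R).

(** The Fourier extension operator of the parabola: up to a constant, the free evolution of a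
    function whose Fourier transform is [g]. *)
Definition extension (g : R -> R[i]) (r x : R) : R[i] :=
  cint mu (fun eta => cexpi (x * eta - r * eta ^+ 2) * g eta).

Variables (g : R -> R[i]) (I : R).
Hypothesis gi : cintegrable mu g.
Hypothesis gI : (\int[mu]_x (sqn (g x))%:E = I%:E)%E.

Let G (a : R * (R * R)) : R[i] := g a.1 * (g a.2.1 * g a.2.2).
Let S (a : R * (R * R)) : R := a.1 + (a.2.1 + a.2.2).
Let Q (a : R * (R * R)) : R := a.1 ^+ 2 + (a.2.1 ^+ 2 + a.2.2 ^+ 2).
Let theta (p : (R * R) * (R * (R * R))) : R := p.1.2 * S p.2 - p.1.1 * Q p.2.
(** [l] and [kap e] are the Fourier transforms of the weights [gauss 1] in time and [gauss e] in
    space; evaluated at differences of [Q] and of [S] they form the kernel. *)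
Let l (t : R) := Num.sqrt (pi / 1) * gauss (4 * 1)^-1 t.
Let kap e (t : R) := Num.sqrt (pi / e) * gauss (4 * e)^-1 t.

Let mS : measurable_fun setT S.
Proof.
apply: measurable_funD => //; apply: measurable_funD.
  exact: measurableT_comp measurable_fst measurable_snd.
exact: measurableT_comp measurable_snd measurable_snd.
Qed.

Let mQ : measurable_fun setT Q.
Proof.
apply: measurable_funD; first exact: measurable_funX.
apply: measurable_funD; apply: measurable_funX.
  exact: measurableT_comp measurable_fst measurable_snd.
exact: measurableT_comp measurable_snd measurable_snd.
Qed.

Let mtheta : measurable_fun setT theta.
Proof.
apply: measurable_funB; apply: measurable_funM.
- exact: measurableT_comp measurable_snd measurable_fst.
- exact: measurableT_comp mS measurable_snd.
- exact: measurableT_comp measurable_fst measurable_fst.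
- exact: measurableT_comp mQ measurable_snd.
Qed.

Let fi r x : cintegrable mu (fun eta => cexpi (x * eta - r * eta ^+ 2) * g eta).
Proof.
apply: cintegrableM_cexpi => //; apply: measurable_funB; apply: measurable_funM => //.
Qed.

Let Gi : cintegrable mu3 G.
Proof. exact: (@cintegrable_tensor _ _ _ Rm (Rm * Rm)%type mu mu2 g _ gi (@cintegrable_tensor _ _ _ Rm Rm mu mu g g gi gi)). Qed.

(** The sixth power of a modulus is the square of the modulus of the cube, so that an L^6 bound
    becomes an L^2 bound for one oscillatory integral in three frequencies. *)
Lemma extension_cube r x :
  extension g r x * (extension g r x * extension g r x) =
  cint mu3 (fun a => cexpi (theta ((r, x), a)) * G a).
Proof.
pose f eta := cexpi (x * eta - r * eta ^+ 2) * g eta.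
have h2 := @cint_tensor _ _ _ Rm Rm mu mu f f (fi r x) (fi r x).
have i2 := @cintegrable_tensor _ _ _ Rm Rm mu mu f f (fi r x) (fi r x).
have h3 := @cint_tensor _ _ _ Rm (Rm * Rm)%type mu mu2 f _ (fi r x) i2.
transitivity (cint mu f * cint mu2 (fun p => f p.1 * f p.2)); first by rewrite -h2.
rewrite -h3; apply: eq_cint => -[a [b c]]; rewrite /f /G /theta /S /Q/=.
transitivity ((cexpi (x * a - r * a ^+ 2) * (cexpi (x * b - r * b ^+ 2) * cexpi (x * c - r * c ^+ 2))) * (g a * (g b * g c))).
  by ring.
by congr (_ * _); rewrite -!cexpiD; congr cexpi; ring.
Qed.

Let GI : (\int[mu3]_a (sqn (G a))%:E = (I ^+ 3)%:E)%E.
Proof.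
have I0 : 0 <= I by rewrite -lee_fin -gI; apply: integral_ge0 => x _; rewrite lee_fin sqn_ge0.
have ms := cmeas_sqn (cintegrable_cmeas gi).
have e2 : (\int[mu2]_b (sqn (g b.1) * sqn (g b.2))%:E = (I ^+ 2)%:E)%E.
  transitivity (\int[mu]_x \int[mu]_y (sqn (g x) * sqn (g y))%:E)%E.
    apply: (@tonelli_sprod _ _ _ Rm Rm mu mu (fun x y => (sqn (g x) * sqn (g y))%:E)).
      apply/measurable_EFinP; apply: measurable_funM.
        exact: measurableT_comp ms measurable_fst.
      exact: measurableT_comp ms measurable_snd.
    by move=> x y; rewrite lee_fin mulr_ge0 ?sqn_ge0.
  transitivity (\int[mu]_x (I%:E * (sqn (g x))%:E))%E.
    apply: eq_integral => x _; under eq_integral do rewrite EFinM.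
    rewrite ge0_integralZl//.
    - by rewrite gI muleC.
    - exact/measurable_EFinP.
    - by move=> y _; rewrite lee_fin sqn_ge0.
    - by rewrite lee_fin sqn_ge0.
  rewrite ge0_integralZl//.
  - by rewrite gI -EFinM.
  - exact/measurable_EFinP.
  - by move=> y _; rewrite lee_fin sqn_ge0.
have ms2 : measurable_fun setT (fun b : R * R => sqn (g b.1) * sqn (g b.2)).
  apply: measurable_funM.
    exact: measurableT_comp ms measurable_fst.
  exact: measurableT_comp ms measurable_snd.
transitivity (\int[mu]_x \int[mu2]_b (sqn (g x) * (sqn (g b.1) * sqn (g b.2)))%:E)%E.
  transitivity (\int[mu3]_a (sqn (g a.1) * (sqn (g a.2.1) * sqn (g a.2.2)))%:E)%E.
    by apply: eq_integral => a _; rewrite /G !sqnM.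
  apply: (@tonelli_sprod _ _ _ Rm (Rm * Rm)%type mu mu2 (fun x b => (sqn (g x) * (sqn (g b.1) * sqn (g b.2)))%:E)).
    apply/measurable_EFinP; apply: measurable_funM.
      exact: measurableT_comp ms measurable_fst.
    exact: measurableT_comp ms2 measurable_snd.
  by move=> x y; rewrite lee_fin !mulr_ge0 ?sqn_ge0.
transitivity (\int[mu]_x ((I ^+ 2)%:E * (sqn (g x))%:E))%E.
  apply: eq_integral => x _; under eq_integral do rewrite EFinM.
  rewrite ge0_integralZl//.
  - by rewrite e2 muleC.
  - exact/measurable_EFinP.
  - by move=> y _; rewrite lee_fin mulr_ge0 ?sqn_ge0.
  - by rewrite lee_fin sqn_ge0.
rewrite ge0_integralZl//.
- by rewrite gI -EFinM -exprSr.
- exact/measurable_EFinP.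
- by move=> y _; rewrite lee_fin sqn_ge0.
- by rewrite lee_fin exprn_ge0.
Qed.

Let ckern c e : continuous (fun t : R => c * gauss e t).
Proof. by move=> x; apply: cvgM; [exact: cvg_cst|exact: continuous_gauss]. Qed.

Let kernL e : 0 < e -> (\int[mu]_x (Num.sqrt (pi / e) * gauss (4 * e)^-1 x)%:E = (2 * pi)%:E)%E.
Proof.
move=> e0; under eq_integral do rewrite EFinM.
have e4 : 0 < (4 * e)^-1 by rewrite invr_gt0 mulr_gt0.
rewrite ge0_integralZl//.
- rewrite integral_gauss// -EFinM -sqrtrM; last by rewrite divr_ge0 ?pi_ge0// ltW.
  rewrite (_ : pi / e * (pi / (4 * e)^-1) = (2 * pi) ^+ 2); last by field; rewrite gt_eqF.
  by rewrite sqrtr_sqr ger0_norm// mulr_ge0 ?pi_ge0.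
- by apply/measurable_EFinP; exact: measurable_gauss.
- by move=> x _; rewrite lee_fin gauss_ge0.
Qed.

Let osc2 e s t : 0 < e ->
  \int[mu2]_z (gauss 1 z.1 * gauss e z.2 * cos (z.2 * s - z.1 * t)) = l t * kap e s /\
  \int[mu2]_z (gauss 1 z.1 * gauss e z.2 * sin (z.2 * s - z.1 * t)) = 0.
Proof.
move=> e0.
have mm (c : R) : measurable_fun setT (fun x : R => x * c) by apply: measurable_funM.
have i1 := cintegrable_gauss (@ltr01 R) (mm (- t)).
have i2 := cintegrable_gauss e0 (mm s).
have h := @cint_tensor _ _ _ Rm Rm mu mu _ _ i1 i2.
rewrite !cint_gauss// -realcM in h.
have hE : cint mu2 (fun z => (gauss 1 z.1 * gauss e z.2)%:C * cexpi (z.2 * s - z.1 * t)) =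
    (l t * kap e s)%:C.
  have lt : l (- t) = l t by rewrite /l /gauss sqrrN.
  rewrite -lt -[RHS]h; apply: eq_cint => -[x y] /=.
  transitivity ((gauss 1 x)%:C * (gauss e y)%:C * (cexpi (x * - t) * cexpi (y * s))); last by ring.
  by rewrite -cexpiD -realcM; congr (_ * cexpi _); ring.
split.
  rewrite -[RHS]/(@complex.Re R (l t * kap e s)%:C) -hE.
  by apply: eq_Rintegral => z _ /=; rewrite mul0r subr0.
rewrite -[RHS]/(@complex.Im R (l t * kap e s)%:C) -hE.
by apply: eq_Rintegral => z _ /=; rewrite mul0r addr0.
Qed.

Let gauss1i e : 0 < e -> mu2.-integrable setT (EFin \o (fun z => gauss 1 z.1 * gauss e z.2)).
Proof.
move=> e0; exact: (@integrable_tensor _ _ _ Rm Rm mu mu _ _ (integrable_gauss ltr01) (integrable_gauss e0)).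
Qed.

Lemma cmeas_extension : cmeas (fun z : R * R => extension g z.1 z.2).
Proof.
have mt : measurable_fun setT (fun p : (R * R) * R => p.1.2 * p.2 - p.1.1 * p.2 ^+ 2).
  apply: measurable_funB; apply: measurable_funM => //.
  - exact: measurableT_comp measurable_snd measurable_fst.
  - exact: measurableT_comp measurable_fst measurable_fst.
  - exact: measurable_funX.
apply: (@cmeas_cint_param _ _ _ (Rm * Rm)%type Rm mu2 mu
   (fun p => p.1.2 * p.2 - p.1.1 * p.2 ^+ 2) (fun z => gauss 1 z.1 * gauss 1 z.2)) => //.
- by move=> z; rewrite mulr_gt0 ?expR_gt0.
- exact: gauss1i.
Qed.

(** The constant pi L M of [kernel_bound] for two Gaussian kernels of mass 2 pi each. *)
Definition strichartz_const : R := pi * (2 * pi) * (2 * pi).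

(** The weight in space serves only to make TT* applicable: the constant does not depend on [e], and
    the weight is removed by monotone convergence. The weight in time stays. *)
Lemma strichartz_weighted :
  (\int[mu2]_z (gauss 1 z.1 * sqn (extension g z.1 z.2) ^+ 3)%:E <=
   (strichartz_const * I ^+ 3)%:E)%E.
Proof.
have mE := cmeas_sqn cmeas_extension.
apply: (@ge0_integral_gauss_lim _ _ _ mu2 snd) => //.
- apply: measurable_funM; last exact: measurable_funX.
  exact: measurableT_comp (@measurable_gauss R 1) measurable_fst.
- by move=> z; rewrite mulr_ge0 ?gauss_ge0// exprn_ge0// sqn_ge0.
move=> e e0.
have := @TTstar _ _ _ (Rm * Rm)%type (Rm * (Rm * Rm))%type mu2 mu3 theta
  (fun z => gauss 1 z.1 * gauss e z.2) G
  (fun p => l (Q p.1 - Q p.2) * kap e (S p.1 - S p.2)) strichartz_const.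
have ml : measurable_fun setT l by apply: continuous_measurable_fun; exact: ckern.
have mk : measurable_fun setT (kap e) by apply: continuous_measurable_fun; exact: ckern.
have l0 x : 0 <= l x by rewrite mulr_ge0 ?sqrtr_ge0 ?gauss_ge0.
have k0 x : 0 <= kap e x by rewrite mulr_ge0 ?sqrtr_ge0 ?gauss_ge0.
have d3 (f : R * (R * R) -> R) : measurable_fun setT f ->
    measurable_fun setT (fun p : (R * (R * R)) * (R * (R * R)) => f p.1 - f p.2).
  move=> mf; apply: measurable_funB; [exact: measurableT_comp mf measurable_fst|exact: measurableT_comp mf measurable_snd].
move=> /(_ mtheta) H.
have {}H := H (fun y => mulr_ge0 (gauss_ge0 1 y.1) (gauss_ge0 e y.2)) (gauss1i e0) Gi.
have H1 : measurable_fun setT (fun p : (R * (R * R)) * (R * (R * R)) => l (Q p.1 - Q p.2) * kap e (S p.1 - S p.2)).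
  by apply: measurable_funM; [exact: (measurableT_comp ml (d3 Q mQ))|exact: (measurableT_comp mk (d3 S mS))].
have {H H1}H := H H1 (fun p => mulr_ge0 (l0 _) (k0 _)).
have thE z a b : theta (z, a) - theta (z, b) = z.2 * (S a - S b) - z.1 * (Q a - Q b).
  by rewrite /theta/=; ring.
have H2 a b : \int[mu2]_y (gauss 1 y.1 * gauss e y.2 * cos (theta (y, a) - theta (y, b))) =
   l (Q a - Q b) * kap e (S a - S b).
  have [<- _] := osc2 (S a - S b) (Q a - Q b) e0.
  by apply: eq_Rintegral => z _; rewrite thE.
have H3 a b : \int[mu2]_y (gauss 1 y.1 * gauss e y.2 * sin (theta (y, a) - theta (y, b))) = 0.
  have [_ <-] := osc2 (S a - S b) (Q a - Q b) e0.
  by apply: eq_Rintegral => z _; rewrite thE.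
have {H H2 H3}H := H H2 H3.
have H4 a b : l (Q a - Q b) * kap e (S a - S b) = l (Q b - Q a) * kap e (S b - S a).
  by rewrite /l /kap /gauss -(sqrrN (Q a - _)) -(sqrrN (S a - _)) !opprB.
have H5 a : (\int[mu3]_b (l (Q a - Q b) * kap e (S a - S b))%:E <= strichartz_const%:E)%E.
  have := @kernel_bound R l (kap e) (2 * pi) (2 * pi) (@ckern _ _) l0 (kernL ltr01) (@ckern _ _) k0 (kernL e0) (S a) (Q a).
  exact.
have {H H4 H5}H := H H4 H5.
rewrite EFinM -GI.
apply: le_trans H; rewrite le_eqVlt; apply/orP; left; apply/eqP.
apply: eq_integral => -[r x] _; congr EFin; rewrite /= -extension_cube !sqnM; ring.
Qed.

Lemma local_strichartz :
  (\int[mu]_(r in `[0%R, 1%R]) \int[mu]_x (sqn (extension g r x) ^+ 3)%:E <=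
   (expR 1 * (strichartz_const * I ^+ 3))%:E)%E.
Proof.
have mE := cmeas_sqn cmeas_extension.
have mE3 : measurable_fun setT (fun z : R * R => (sqn (extension g z.1 z.2) ^+ 3)%:E).
  by apply/measurable_EFinP; exact: measurable_funX.
have mI : measurable_fun setT (fun r => \int[mu]_x (sqn (extension g r x) ^+ 3)%:E)%E.
  apply: (@measurable_tonelli1 _ _ _ Rm Rm mu (fun r x => (sqn (extension g r x) ^+ 3)%:E)) => // r x.
  by rewrite lee_fin exprn_ge0// sqn_ge0.
have I0 r : (0 <= \int[mu]_x (sqn (extension g r x) ^+ 3)%:E)%E.
  by apply: integral_ge0 => x _; rewrite lee_fin exprn_ge0// sqn_ge0.
have W : (\int[mu]_r ((gauss 1 r)%:E * \int[mu]_x (sqn (extension g r x) ^+ 3)%:E) <= (strichartz_const * I ^+ 3)%:E)%E.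
  apply: le_trans strichartz_weighted; rewrite le_eqVlt; apply/orP; left; apply/eqP.
  transitivity (\int[mu]_r \int[mu]_x (gauss 1 r * sqn (extension g r x) ^+ 3)%:E)%E.
    apply: eq_integral => r _; rewrite -ge0_integralZl//.
    - exact: (measurableT_comp mE3 (measurable_pair1 r)).
    - by move=> x _; rewrite lee_fin exprn_ge0// sqn_ge0.
    - by rewrite lee_fin gauss_ge0.
  apply/esym; apply: (@tonelli_sprod _ _ _ Rm Rm mu mu (fun r x => (gauss 1 r * sqn (extension g r x) ^+ 3)%:E)).
    apply/measurable_EFinP; apply: measurable_funM; last exact: measurable_funX.
    exact: measurableT_comp (@measurable_gauss R 1) measurable_fst.
  by move=> r x; rewrite lee_fin mulr_ge0 ?gauss_ge0// exprn_ge0// sqn_ge0.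
(* On [0, 1] the weight e^(-r^2) is at least 1/e, which accounts for the factor [expR 1]. *)
rewrite EFinM; apply: le_trans (lee_wpmul2l _ W); last by rewrite lee_fin expR_ge0.
rewrite -ge0_integralZl//; first last.
- by move=> r _; rewrite mule_ge0// lee_fin gauss_ge0.
- by apply: emeasurable_funM => //; apply/measurable_EFinP; exact: measurable_gauss.
apply: (@le_trans _ _ (\int[mu]_(r in `[0%R, 1%R]) ((expR 1)%:E * ((gauss 1 r)%:E * \int[mu]_x (sqn (extension g r x) ^+ 3)%:E)))%E).
  apply: ge0_le_integral => //.
  - exact: measurable_funTS.
  - apply: measurable_funTS; apply: emeasurable_funM => //.
    by apply: emeasurable_funM => //; apply/measurable_EFinP; exact: measurable_gauss.
  move=> r; rewrite /= in_itv/= => /andP[r0 r1]; rewrite muleA -EFinM -[X in (X <= _)%E]mul1e.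
  rewrite lee_wpmul2r// lee_fin /gauss mul1r -expRD -[X in X <= _](@expR0 R) ler_expR.
  by rewrite subr_ge0 exprn_ile1.
apply: ge0_subset_integral => //.
- apply: emeasurable_funM => //.
  by apply: emeasurable_funM => //; apply/measurable_EFinP; exact: measurable_gauss.
- move=> r _; rewrite mule_ge0 ?lee_fin ?expR_ge0// mule_ge0// lee_fin gauss_ge0//.
Qed.

End Strichartz.

(** * Completeness of L^2 and the Fourier transform *)

Section SquareIntegrable.
Variable R : realType.
Local Notation mu := (@lebesgue_measure R).
Local Notation re := (@complex.Re R).
Local Notation im := (@complex.Im R).
Local Notation normc := (@ComplexField.Normc.normc R).
Implicit Types f g h : R -> R[i].

Lemma fatou_le d (T : measurableType d) (m : {measure set T -> \bar R})
    (D : set T) (f : nat -> T -> \bar R) (g : T -> \bar R) (C : \bar R) :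
  measurable D -> (forall n, measurable_fun D (f n)) ->
  (forall n x, 0 <= f n x)%E ->
  measurable_fun D g -> (forall x, 0 <= g x)%E ->
  {ae m, forall x, D x -> f ^~ x @ \oo --> g x} ->
  (forall n, \int[m]_(x in D) f n x <= C)%E -> (\int[m]_(x in D) g x <= C)%E.
Proof.
move=> mD mf f0 mg g0 fg fC.
have -> : (\int[m]_(x in D) g x = \int[m]_(x in D) limn_einf (f ^~ x))%E.
  apply: ge0_ae_eq_integral => //.
  - rewrite (_ : (fun x => _) = -%E \o (fun x => limn_esup (-%E \o f ^~ x))).
      apply: measurableT_comp => //; apply: measurable_fun_limn_esup => n.
      exact: measurableT_comp.
    by apply/funext => x /=; rewrite -limn_einfN; congr limn_einf; apply/funext => n /=; rewrite oppeK.
  - move=> x _; rewrite limn_einf_lim; apply: lime_ge; first exact: is_cvg_einfs.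
    by apply: nearW => n; apply: le_ereal_inf_tmp => _ [k _ <-].
  - by apply: filterS fg => x h Dx; have [->] := cvg_limn_einf_sup (h Dx).
apply: (le_trans (fatou _ _ _ _)) => //.
rewrite limn_einf_lim; apply: lime_le; first exact: is_cvg_einfs.
apply: nearW => n; apply: le_trans (fC n).
by apply: ge_ereal_inf; eexists; last exact: lexx; exists n => //=.
Qed.

(** Squared norms keep all estimates free of roots; [L2norm_sqr], [L2P] and [cvg_L2norm] translate
    to and from the given definitions. *)
Definition esq f : \bar R := (\int[mu]_x (sqn (f x))%:E)%E.

Definition sqint f := cmeas f /\ (esq f < +oo)%E.

Lemma esq_ge0 f : (0 <= esq f)%E.
Proof. by apply: integral_ge0 => x _; rewrite lee_fin sqn_ge0. Qed.

Lemma L2norm_sqr f : (L2norm f ^+ 2 = esq f)%E.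
Proof.
have h := @poweR_Lnorm _ _ R mu (EFin \o normc \o f) 2 ltac:(by []).
have e : (\int[mu]_x (`|(normc (f x))%:E| `^ 2) = esq f)%E.
  by apply: eq_integral => x _; rewrite /comp gee0_abs ?lee_fin ?normc_ge0// poweR_EFin powR_mulrn ?normc_ge0// normc_sqr.
move: h; rewrite /= e => <-; rewrite /L2norm.
have := Lnorm_ge0 mu 2%:E (EFin \o normc \o f).
set t := ('N[mu]_2%:E[_])%E; case: t => [r| |//].
  by rewrite lee_fin => r0; rewrite poweR_EFin powR_mulrn// -EFin_expe.
by move=> _; rewrite poweRyr// expe2 mulyy.
Qed.

Lemma L2P f : L2 f <-> sqint f.
Proof.
split=> [[f1 f2]|[[f1 f2] fo]].
  have i1 := Lfun2_integrable_sqr f1; have i2 := Lfun2_integrable_sqr f2.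
  have [/andP[]] := (f1, f2) => /set_mem m1 _ /andP[/set_mem m2 _].
  split; first by split.
  have /= := integrableD measurableT i1 i2.
  move=> /integrableP[_]; apply: le_lt_trans.
  apply: ge0_le_integral => //.
  - by move=> x _; rewrite lee_fin sqn_ge0.
  - by apply/measurable_EFinP; apply: measurable_funD; apply: measurable_funX.
  - apply: measurableT_comp => //; apply/measurable_EFinP.
    by apply: measurable_funD; apply: measurable_funX.
  - by move=> x _; rewrite -EFinD /= lee_fin ler_norm.
suff H (k : R -> R) : measurable_fun setT k -> (forall x, k x ^+ 2 <= sqn (f x)) ->
    k \in Lfun mu 2%:E.
  split; apply: H => // x; rewrite /sqn /=.
    by rewrite lerDl sqr_ge0.
  by rewrite lerDr sqr_ge0.
move=> mk kf; rewrite inE; apply/andP; split; apply/mem_set => //=.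
apply: (@lty_poweRy _ _ 2) => //; rewrite poweR_Lnorm//.
rewrite (_ : \int[mu]_x _ = \int[mu]_x (k x ^+ 2)%:E)%E; last first.
  apply: eq_integral => x _; rewrite -[(`|_|)%E]/(`|k x|%R)%:E poweR_EFin powR_mulrn ?normr_ge0//.
  by rewrite real_normK ?num_real.
apply: le_lt_trans fo; apply: ge0_le_integral => //.
- by move=> x _; rewrite lee_fin sqr_ge0.
- by apply/measurable_EFinP; exact: measurable_funX.
- by apply/measurable_EFinP; apply: cmeas_sqn.
- by move=> x _ /=; rewrite lee_fin.
Qed.

Lemma cvge0P (v : nat -> \bar R) : (forall n, 0 <= v n)%E ->
  v n @[n --> \oo] --> 0%E <->
  (forall e : R, 0 < e -> \forall n \near \oo, (v n <= e%:E)%E).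
Proof.
move=> v0; split=> [/fine_cvgP[vf /cvgr0Pnorm_le h] e e0|h].
  have := h e e0; move: vf; apply: filterS2 => n vn /= hn.
  by rewrite -(fineK vn) lee_fin (le_trans _ hn)// ler_norm.
apply/fine_cvgP; split.
  apply: filterS (h 1 ltr01) => n vn; rewrite ge0_fin_numE//.
  exact: le_lt_trans vn (ltry _).
apply/cvgr0Pnorm_le => e e0; apply: filterS (h e e0) => n vn /=.
rewrite ger0_norm ?fine_ge0// -lee_fin fineK// ge0_fin_numE//.
exact: le_lt_trans vn (ltry _).
Qed.

Lemma cvg_L2norm (u : nat -> R -> R[i]) :
  (L2norm (u n) @[n --> \oo] --> 0%E) <-> (esq (u n) @[n --> \oo] --> 0%E).
Proof.
have N0 f : (0 <= L2norm f)%E by exact: Lnorm_ge0.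
split => h.
  apply/cvge0P => [n|e e0]; first exact: esq_ge0.
  have /cvge0P/(_ (Num.sqrt e)) := h; rewrite sqrtr_gt0 => /(_ (fun n => N0 _) e0).
  apply: filterS => n hn; rewrite -L2norm_sqr -(sqr_sqrtr (ltW e0)) EFin_expe !expe2.
  exact: lee_pmul.
apply/cvge0P => [n|e e0]; first exact: N0.
have /cvge0P := h => /(_ (fun n => esq_ge0 _)) /(_ (e ^+ 2)) /(_ (exprn_gt0 _ e0)).
apply: filterS => n; rewrite -L2norm_sqr EFin_expe !expe2 => hn.
rewrite leNgt; apply/negP => lt; move: hn; rewrite leNgt => /negP; apply.
by rewrite lte_pmul// ?lee_fin ltW.
Qed.


Lemma esqD_le f g : cmeas f -> cmeas g ->
  (esq (fun x => (f x + g x)%R) <= 2%:E * (esq f + esq g))%E.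
Proof.
move=> mf mg; have msf := cmeas_sqn mf; have msg := cmeas_sqn mg.
rewrite /esq -ge0_integralD//; first last.
- by apply/measurable_EFinP.
- by move=> x _; rewrite lee_fin sqn_ge0.
- by apply/measurable_EFinP.
- by move=> x _; rewrite lee_fin sqn_ge0.
rewrite -ge0_integralZl//; first last.
- by move=> x _; rewrite -EFinD lee_fin addr_ge0// sqn_ge0.
- by apply/measurable_EFinP; exact: measurable_funD.
apply: ge0_le_integral => //.
- by move=> x _; rewrite lee_fin sqn_ge0.
- by apply/measurable_EFinP; apply: cmeas_sqn; exact: cmeasD.
- apply: emeasurable_funM => //; apply/measurable_EFinP; exact: measurable_funD.
- by move=> x _; rewrite -EFinD -EFinM lee_fin sqnD_le.
Qed.

Lemma esqN f : esq (fun x => - f x) = esq f.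
Proof. by apply: eq_integral => x _; rewrite sqnN. Qed.

Lemma esqB_le f g : cmeas f -> cmeas g ->
  (esq (fun x => (f x - g x)%R) <= 2%:E * (esq f + esq g))%E.
Proof. by move=> mf mg; rewrite -(esqN g); apply: esqD_le => //; exact: cmeasN. Qed.

Lemma sqintD f g : sqint f -> sqint g -> sqint (fun x => f x + g x).
Proof.
move=> [mf fo] [mg go]; split; first exact: cmeasD.
apply: le_lt_trans (esqD_le mf mg) _; apply: lte_mul_pinfty => //; exact: lte_add_pinfty.
Qed.

Lemma sqintN f : sqint f -> sqint (fun x => - f x).
Proof. by move=> [mf fo]; split; [exact: cmeasN|rewrite esqN]. Qed.

Lemma sqintB f g : sqint f -> sqint g -> sqint (fun x => f x - g x).
Proof. by move=> fi gi; apply: sqintD => //; exact: sqintN. Qed.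

Lemma esqM_cst (c : R[i]) f : cmeas f -> esq (fun x => c * f x) = ((sqn c)%:E * esq f)%E.
Proof.
move=> mf; rewrite /esq -ge0_integralZl//.
- by apply: eq_integral => x _; rewrite sqnM.
- by apply/measurable_EFinP; exact: cmeas_sqn.
- by move=> x _; rewrite lee_fin sqn_ge0.
- by rewrite lee_fin sqn_ge0.
Qed.

Lemma esq_cexpi (h : R -> R) f : esq (fun x => cexpi (h x) * f x) = esq f.
Proof. by apply: eq_integral => x _; rewrite sqnM sqn_cexpi mul1r. Qed.

Lemma esq_eq0 f : cmeas f -> esq f = 0%E -> {ae mu, forall x, f x = 0}.
Proof.
move=> mf f0; have ms : measurable_fun setT (EFin \o (fun x => sqn (f x))).
  by apply/measurable_EFinP; exact: cmeas_sqn.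
have /(ae_eq_integral_abs mu measurableT ms) : (\int[mu]_x `|(EFin \o (fun x => sqn (f x))) x| = 0)%E.
  by rewrite -f0; apply: eq_integral => x _; rewrite /comp gee0_abs// lee_fin sqn_ge0.
by apply: filterS => x /(_ I) [] /sqn_eq0.
Qed.

Lemma ae_eq_esq f g : cmeas f -> cmeas g -> {ae mu, forall x, f x = g x} -> esq f = esq g.
Proof.
move=> mf mg fg; apply: ge0_ae_eq_integral => //.
- by apply/measurable_EFinP; exact: cmeas_sqn.
- by apply/measurable_EFinP; exact: cmeas_sqn.
- by move=> x _; rewrite lee_fin sqn_ge0.
- by move=> x _; rewrite lee_fin sqn_ge0.
- case: fg => N [mN N0 hN]; exists N; split => //.
  by apply: subset_trans hN => x /= h fgx; apply: h => _; rewrite fgx.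
Qed.

Definition L2cauchy (u : nat -> R -> R[i]) :=
  forall e : R, 0 < e -> exists N, forall n m, (N <= n)%N -> (N <= m)%N ->
    (esq (fun x => (u n x - u m x)%R) <= e%:E)%E.

(** From |d| <= 2^k d^2 + 2^(-k), the increments are absolutely summable, with sum at most M + 2. *)
Lemma cvg_weighted_increments (r : nat -> R) (M : R) :
  (forall n, \sum_(k < n) 2 ^+ k * (r k.+1 - r k) ^+ 2 <= M) -> cvgn r.
Proof.
move=> rM.
have : cvgn (series (telescope r)).
  apply: normed_cvg; apply: nondecreasing_is_cvgn.
    by apply: nondecreasing_series => n _ _; exact: normr_ge0.
  exists (M + 2) => _ [n _ <-].
  rewrite [X in X <= _](_ : _ = \sum_(k < n) `|telescope r k|); last first.
    by rewrite -(big_mkord xpredT (fun k => `|telescope r k|)).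
  apply: (@le_trans _ _ (\sum_(k < n) (2 ^+ k * (r k.+1 - r k) ^+ 2 + 2^-1 ^+ k))).
    apply: ler_sum => k _; rewrite /telescope exprVn.
    have q0 : 0 < 2 ^+ k :> R by rewrite exprn_gt0.
    set y := r k.+1 - r k; rewrite -(real_normK (num_real y)).
    have y0 := normr_ge0 y; set z := `|y| in y0 *.
    rewrite -(ler_pM2l q0) mulrDr divff ?gt_eqF//.
    have := sqr_ge0 (2 ^+ k * z - 1); nra.
  rewrite big_split/= lerD//; first exact: rM.
  elim: n => [|n IH]; first by rewrite big_ord0.
  suff : \sum_(k < n.+1) 2^-1 ^+ k = 2 - 2^-1 ^+ n :> R.
    by move=> ->; rewrite gerBl exprn_ge0.
  elim: n {IH} => [|n IH]; first by rewrite big_ord1 !expr0; lra.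
  by rewrite big_ord_recr/= IH exprS; lra.
rewrite telescopeK => h.
have : cvgn ((fun n => r n - r 0%N) \+ (fun=> r 0%N)) by apply: is_cvgD => //; exact: is_cvg_cst.
by rewrite (_ : _ \+ _ = r)//; apply/funext => n /=; rewrite subrK.
Qed.

Lemma sqn_cvg (v : nat -> R[i]) (w z : R[i]) :
  re (v n) @[n --> \oo] --> re w -> im (v n) @[n --> \oo] --> im w ->
  sqn (z - v n) @[n --> \oo] --> sqn (z - w).
Proof.
move=> h1 h2; rewrite /sqn; apply: cvgD; apply: cvgM; rewrite !(reD, imD, reN, imN);
under eq_fun do rewrite !(reD, imD, reN, imN); apply: cvgD; (try exact: cvg_cst); exact: cvgN.
Qed.

(** A fast subsequence has increments whose squared moduli, weighted by 2^k, have an integrable sum.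
    Where that sum is finite, hence almost everywhere, the subsequence converges; Fatou's lemma then
    bounds the distance of [u n] to the pointwise limit. *)
Lemma L2_complete (u : nat -> R -> R[i]) : (forall n, sqint (u n)) -> L2cauchy u ->
  exists2 g, sqint g & esq (fun x => u n x - g x) @[n --> \oo] --> 0%E.
Proof.
move=> ui uC.
have mu' n : cmeas (u n) by have [] := ui n.
(* The factor 2^(-k) compensates the weight in [a k]; what is left, 2^(-k-1), sums to 1. *)
pose ep k : R := (2 ^+ k)^-1 / (2 ^ k.+1)%:R.
have ep0 k : 0 < ep k by rewrite divr_gt0 ?invr_gt0 ?exprn_gt0// ltr0n expn_gt0.
have /choice[N HN] : forall k, exists N, forall n m, (N <= n)%N -> (N <= m)%N ->
    (esq (fun x => (u n x - u m x)%R) <= (ep k)%:E)%E by move=> k; exact: uC.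
(* Summing all earlier thresholds makes the indices nondecreasing; adding k makes them tend to
   infinity. *)
pose nk k := (k + \sum_(i < k.+1) N i)%N.
have nkN k : (N k <= nk k)%N by rewrite /nk big_ord_recr/= addnA leq_addl.
have nkS k : (nk k <= nk k.+1)%N by rewrite /nk [X in (_ <= _ + X)%N]big_ord_recr/= leq_add// leq_addr.
have nkk k : (k <= nk k)%N by rewrite leq_addr.
pose v k := u (nk k).
pose a k x := 2 ^+ k * sqn (v k.+1 x - v k x).
have a0 k x : 0 <= a k x by rewrite mulr_ge0 ?exprn_ge0 ?sqn_ge0.
have ma k : measurable_fun setT (fun x => (a k x)%:E).
  apply/measurable_EFinP; apply: measurable_funM => //; apply: cmeas_sqn.
  by apply: cmeasB; exact: mu'.
pose S x : \bar R := (\sum_(k <oo) (a k x)%:E)%E.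
have mS : measurable_fun setT S.
  by apply: (@ge0_emeasurable_sum _ _ _ setT (fun k x => (a k x)%:E) xpredT) => // k x _ _; rewrite lee_fin.
have S0 x : (0 <= S x)%E by apply: nneseries_ge0 => k _ _; rewrite lee_fin.
have Soo : (\int[mu]_x S x < +oo)%E.
  rewrite integral_nneseries//; last by move=> n x _; rewrite lee_fin.
  apply: (@le_lt_trans _ _ 1%:E); last exact: ltry.
  apply: le_trans (@epsilon_trick0 R 1 xpredT ler01).
  apply: lee_nneseries => [k _ _|k _].
    by apply: integral_ge0 => x _; rewrite lee_fin.
  under eq_integral do rewrite EFinM.
  rewrite ge0_integralZl//; first last.
  - by move=> x _; rewrite lee_fin sqn_ge0.
  - by apply/measurable_EFinP; apply: cmeas_sqn; apply: cmeasB; exact: mu'.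
  have := HN k _ _ (leq_trans (nkN k) (nkS k)) (nkN k).
  rewrite -/(v k) -/(v k.+1) => /(lee_wpmul2l (x := (2 ^+ k)%:E)).
  rewrite lee_fin exprn_ge0// => /(_ isT) /le_trans; apply.
  by rewrite -EFinM /ep mulrA divff ?mul1r// gt_eqF// exprn_gt0.
have iS : mu.-integrable setT S.
  by apply/integrableP; split => //; under eq_integral do rewrite gee0_abs//.
pose E := [set x | S x \is a fin_num].
have mE : measurable E.
  by have := emeasurable_fin_num measurableT mS; rewrite setTI.
(* Set to zero off [E], the subsequence converges everywhere, and its limit is measurable. *)
pose w k x := if x \in E then v k x else 0.
have mw k : cmeas (w k).
  rewrite (_ : w k = fun x => (\1_E x)%:C * v k x).
    by apply: cmeasM; [apply: cmeas_real; exact: measurable_indic|exact: mu'].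
  by apply/funext => x; rewrite /w indicE; case: ifP => _; rewrite ?mul1r ?mul0r.
have cw x : cvgn (fun k => re (w k x)) /\ cvgn (fun k => im (w k x)).
  rewrite /w; case: (boolP (x \in E)) => [/set_mem xE|_]; last by split; exact: is_cvg_cst.
  have B n : \sum_(k < n) a k x <= fine (S x).
    rewrite -lee_fin fineK// -sumEFin -(big_mkord xpredT (fun k => (a k x)%:E)).
    by apply: nneseries_lim_ge => k _ _; rewrite lee_fin.
  split; apply: (@cvg_weighted_increments _ (fine (S x))) => n; apply: le_trans (B n);
    apply: ler_sum => k _; rewrite ler_pM2l ?exprn_gt0// /sqn !(reD,imD,reN,imN).
    by rewrite lerDl sqr_ge0.
  by rewrite lerDr sqr_ge0.
pose g x := limn (fun k => re (w k x)) +i* limn (fun k => im (w k x)).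
have mg : cmeas g.
  by split; [apply: (measurable_fun_cvg (fun k => (mw k).1))|
             apply: (measurable_fun_cvg (fun k => (mw k).2))] => x _; have [] := cw x.
(* Fatou's lemma along the subsequence shifted by n0, so that all its indices are in the range where
   the Cauchy bound holds. *)
have key (e : R) : 0 < e -> exists n0, forall n, (n0 <= n)%N ->
    (esq (fun x => (u n x - g x)%R) <= e%:E)%E.
  move=> e0; have [n0 H] := uC _ e0; exists n0 => n n0n.
  apply: (@fatou_le _ _ mu setT (fun k x => (sqn (u n x - v (k + n0)%N x))%:E)) => //.
  - by move=> k; apply/measurable_EFinP/cmeas_sqn/cmeasB; exact: mu'.
  - by move=> k x; rewrite lee_fin sqn_ge0.
  - by apply/measurable_EFinP/cmeas_sqn/cmeasB => //; exact: mu'.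
  - by move=> x; rewrite lee_fin sqn_ge0.
  - apply: filterS (integrable_ae measurableT iS) => x /(_ I) xE _.
    have [c1 c2] := cw x.
    have wv k : w k x = v k x by rewrite /w ifT//; apply/mem_set.
    apply: cvg_EFin; first exact: nearW.
    rewrite (cvg_shiftn n0 (fun k => sqn (u n x - v k x))).
    apply: sqn_cvg; under eq_fun do rewrite -wv; [exact: c1|exact: c2].
  - by move=> k; apply: H => //; apply: leq_trans (nkk _); rewrite leq_addl.
exists g.
  split=> //; have [n0 H] := key 1 ltr01.
  have [m1 o1] := ui n0.
  rewrite (_ : g = (fun x => u n0 x - (u n0 x - g x))); last by apply/funext => x; rewrite subKr.
  apply: (sqintB (ui n0) _).2; split; first exact: cmeasB.
  by apply: le_lt_trans (H _ (leqnn _)) _; exact: ltry.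
apply/cvge0P => [n|e e0]; first exact: esq_ge0.
by have [n0 H] := key _ e0; exists n0.
Qed.

End SquareIntegrable.

Section FourierL2.
Variable R : realType.
Local Notation mu := (@lebesgue_measure R).
Local Notation normc := (@ComplexField.Normc.normc R).
Local Notation Rm := (measurableTypeR R).
Implicit Types (f g h : R -> R[i]) (u : nat -> R -> R[i]).

Lemma esq_sub_cvg0 u g h : (forall n, cmeas (u n)) -> cmeas g -> cmeas h ->
  esq (fun x => u n x - g x) @[n --> \oo] --> 0%E ->
  esq (fun x => u n x - h x) @[n --> \oo] --> 0%E ->
  {ae mu, forall x, g x = h x}.
Proof.
move=> um gm hm ug uh.
have m1 n := cmeasB (um n) gm; have m2 n := cmeasB (um n) hm.
have H (e : R) : 0 < e -> (esq (fun x => (g x - h x)%R) <= e%:E)%E.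
  move=> e0; have e4 : 0 < e / 4 by rewrite divr_gt0.
  have := (cvge0P (fun n => esq_ge0 _)).1 ug _ e4.
  have := (cvge0P (fun n => esq_ge0 _)).1 uh _ e4.
  move=> h1 h2; have [n []] : exists n, (esq (fun x => (u n x - g x)%R) <= (e / 4)%:E)%E /\
      (esq (fun x => (u n x - h x)%R) <= (e / 4)%:E)%E.
    near \oo => n; exists n; split; near: n; [exact: h2|exact: h1].
  move=> l1 l2.
  rewrite (_ : (fun x => _) = (fun x => (u n x - h x) - (u n x - g x))); last first.
    by apply/funext => x; ring.
  apply: le_trans (esqB_le (m2 n) (m1 n)) _.
  rewrite (_ : e = 2 * (e / 4 + e / 4)); last by field.
  rewrite [X in (_ <= X)%E]EFinM; apply: lee_pmul => //.
    by rewrite adde_ge0 ?esq_ge0.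
  by rewrite EFinD leeD.
have : esq (fun x => g x - h x) = 0%E.
  apply/eqP; rewrite eq_le esq_ge0 andbT; apply/lee_addgt0Pr => e e0.
  by rewrite add0e; exact: H.
move=> /(esq_eq0 (cmeasB gm hm)) [N [mN N0 hN]]; exists N; split => //.
apply: subset_trans hN => x /= gh h0; apply: gh.
by apply/eqP; rewrite -subr_eq0 h0.
Unshelve. all: by end_near. Qed.

(** As soon as some limit exists, the choice operator in [L2lim] returns a genuine limit and not its
    default value. *)
Lemma L2limP u g : sqint g -> esq (fun x => u n x - g x) @[n --> \oo] --> 0%E ->
  sqint (L2lim u) /\ esq (fun x => u n x - L2lim u x) @[n --> \oo] --> 0%E.
Proof.
move=> gi ug; rewrite /L2lim; case: xgetP => [l -> [/L2P li /cvg_L2norm lu]//|/(_ g)].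
by case; split; [exact/L2P|exact/(cvg_L2norm (fun n x => u n x - g x))].
Qed.

Definition trunc (n : nat) f (x : R) : R[i] := (\1_`[- n%:R, n%:R]%classic x)%:C * f x.

Lemma cmeas_trunc n f : cmeas f -> cmeas (trunc n f).
Proof. by move=> mf; apply: cmeasM => //; apply: cmeas_real; exact: measurable_indic. Qed.

Lemma sqn_trunc n f x : sqn (trunc n f x) = \1_`[- n%:R, n%:R]%classic x * sqn (f x).
Proof. by rewrite sqnM sqn_real indicE; case: (_ \in _) => /=; rewrite ?expr1n ?expr0n/=. Qed.

Lemma sqn_truncB n f x : sqn (trunc n f x - f x) = (1 - \1_`[- n%:R, n%:R]%classic x) * sqn (f x).
Proof.
rewrite /trunc indicE; case: (_ \in _) => /=.
  by rewrite mul1r !subrr mul0r sqn0.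
by rewrite mul0r sub0r sqnN subr0 mul1r.
Qed.

Lemma sqint_trunc n f : sqint f -> sqint (trunc n f).
Proof.
move=> [mf fo]; split; first exact: cmeas_trunc.
apply: le_lt_trans fo; apply: ge0_le_integral => //.
- by move=> x _; rewrite lee_fin sqn_ge0.
- by apply/measurable_EFinP/cmeas_sqn/cmeas_trunc.
- by apply/measurable_EFinP/cmeas_sqn.
- move=> x _; rewrite lee_fin sqn_trunc indicE; case: (_ \in _) => /=.
    by rewrite mul1r.
  by rewrite mul0r sqn_ge0.
Qed.

Lemma integrable_sqn f : sqint f -> mu.-integrable setT (EFin \o (fun x => sqn (f x))).
Proof.
move=> [mf fo]; apply/integrableP; split; first exact/measurable_EFinP/cmeas_sqn.
by under eq_integral do rewrite /comp gee0_abs ?lee_fin ?sqn_ge0//.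
Qed.

(** On a bounded interval L^2 is contained in L^1: |f| <= 1 + |f|^2. *)
Lemma cintegrable_trunc n f : sqint f -> cintegrable mu (trunc n f).
Proof.
move=> fi; have [mf _] := fi.
apply: (@cintegrable_le _ _ _ mu (trunc n f) (fun x : R => \1_`[- n%:R, n%:R]%classic x + sqn (f x))).
- exact: cmeas_trunc.
- have := integrableD measurableT (integrable_indic_itv (- n%:R) n%:R true false) (integrable_sqn fi).
  by apply: eq_integrable => // x _.
move=> x; rewrite normcE2 sqn_trunc indicE; case: (_ \in _) => /=.
  have s0 := sqn_ge0 (f x); have s1 : 0 <= 1 + sqn (f x) by rewrite addr_ge0.
  rewrite mul1r -(ger0_norm s1) -sqrtr_sqr ler_wsqrtr//.
  rewrite -subr_ge0 (_ : _ - _ = 1 + sqn (f x) + sqn (f x) ^+ 2); last by ring.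
  by rewrite addr_ge0// sqr_ge0.
by rewrite mul0r sqrtr0 add0r sqn_ge0.
Qed.

Lemma trunc_cvg f : sqint f -> esq (fun x => trunc n f x - f x) @[n --> \oo] --> 0%E.
Proof.
move=> fi; have [mf _] := fi; rewrite /esq.
rewrite -[X in _ --> X](@integral0 _ _ _ mu setT).
apply: (@dominated_cvg _ _ _ mu setT measurableT _ _ (EFin \o (fun x => sqn (f x)))).
- by move=> n; apply/measurable_EFinP/cmeas_sqn/cmeasB => //; exact: cmeas_trunc.
- move=> x _; apply: cvg_near_cst; exists (Num.bound x) => // n /= hn.
  rewrite sqn_truncB indicE mem_set/= ?subrr ?mul0r//.
  have /ltW xn := archi_boundP (normr_ge0 x).
  rewrite in_itv/= -ler_norml; apply: (le_trans xn); rewrite ler_nat.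
  by apply: leq_trans hn; rewrite /Num.bound normr_id.
- by move=> x _.
- exact: integrable_sqn.
- move=> n x _; rewrite gee0_abs ?lee_fin ?sqn_ge0// sqn_truncB indicE.
  by case: (_ \in _) => /=; rewrite ?subrr ?mul0r ?sqn_ge0// subr0 mul1r.
Qed.

Lemma L2cauchy_cvg u g : (forall n, cmeas (u n)) -> cmeas g ->
  esq (fun x => u n x - g x) @[n --> \oo] --> 0%E -> L2cauchy u.
Proof.
move=> um gm ug e e0; have e4 : 0 < e / 4 by rewrite divr_gt0.
have [N _ HN] := (cvge0P (fun n => esq_ge0 _)).1 ug _ e4.
exists N => n m Nn Nm.
rewrite (_ : (fun x => _) = (fun x => (u n x - g x) - (u m x - g x))); last first.
  by apply/funext => x; ring.
apply: le_trans (esqB_le (cmeasB (um n) gm) (cmeasB (um m) gm)) _.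
rewrite (_ : e = 2 * (e / 4 + e / 4)); last by field.
rewrite [X in (_ <= X)%E]EFinM; apply: lee_pmul => //.
  by rewrite adde_ge0 ?esq_ge0.
by rewrite EFinD leeD//; apply: HN.
Qed.

Definition fourier_const : R[i] := (Num.sqrt (2 * pi))^-1%:C.

Lemma sqn_fourier_const : sqn fourier_const = (2 * pi)^-1.
Proof. by rewrite sqn_real exprVn sqr_sqrtr// mulr_ge0// pi_ge0. Qed.

Lemma fourier_truncE s f n y :
  fourier_trunc s f n y = fourier_const * osc (- s) (trunc n f) y.
Proof.
rewrite /fourier_trunc; congr (_ * _).
apply: eq_c; rewrite /= [LHS]Rintegral_mkcond; apply: eq_Rintegral => x _; rewrite patchE /trunc indicE;
  case: ifPn => _; rewrite ?mul0r ?mulr0//= mul1r !mulNr//.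
Qed.

Lemma oscB t f g y : cintegrable mu f -> cintegrable mu g ->
  osc t (fun x => f x - g x) y = osc t f y - osc t g y.
Proof.
have m : measurable_fun setT (fun x : R => t * x * y) by apply: measurable_funM => //; apply: measurable_funM.
move=> fi gi; rewrite /osc -cintB; [|exact: cintegrableM_cexpi|exact: cintegrableM_cexpi].
by apply: eq_cint => x; rewrite mulrBr.
Qed.

Lemma esq_osc_le t f : t ^+ 2 = 1 -> cintegrable mu f ->
  (esq (fun y => fourier_const * osc t f y)%R <= esq f)%E.
Proof.
move=> t2 fi; rewrite esqM_cst; last exact: cmeas_osc.
rewrite sqn_fourier_const; have p0 : 0 < 2 * pi :> R by rewrite mulr_gt0 ?pi_gt0.
apply: le_trans (lee_wpmul2l _ (osc_L2_le t2 fi)) _; first by rewrite lee_fin invr_ge0 ltW.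
by rewrite muleA -EFinM mulVf ?mul1e// gt_eqF.
Qed.

Lemma cmeas_fourier_trunc s f n : sqint f -> cmeas (fourier_trunc s f n).
Proof.
move=> fi; rewrite (_ : fourier_trunc s f n = (fun y => fourier_const * osc (- s) (trunc n f) y)).
  by apply: cmeasM; [exact: cmeas_cst|apply: cmeas_osc; exact: cintegrable_trunc].
by apply/funext => y; rewrite fourier_truncE.
Qed.

Lemma sqint_fourier_trunc s f n : s ^+ 2 = 1 -> sqint f -> sqint (fourier_trunc s f n).
Proof.
move=> s2 fi; split; first exact: cmeas_fourier_trunc.
rewrite (_ : fourier_trunc s f n = (fun y => fourier_const * osc (- s) (trunc n f) y)); last first.
  by apply/funext => y; rewrite fourier_truncE.
apply: le_lt_trans (esq_osc_le _ (cintegrable_trunc n fi)) _; first by rewrite sqrrN.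
by have [] := sqint_trunc n fi.
Qed.

(** The truncations of [f] are Cauchy in L^2, and [esq_osc_le], applied to their differences,
    carries this over to their transforms. *)
Lemma fourier_trunc_cvg s f : s ^+ 2 = 1 -> sqint f ->
  exists2 g, sqint g & esq (fun x => fourier_trunc s f n x - g x) @[n --> \oo] --> 0%E.
Proof.
move=> s2 fi; apply: L2_complete; first by move=> n; exact: sqint_fourier_trunc.
have mf : cmeas f by have [] := fi.
move=> e e0; have [N HN] := L2cauchy_cvg (fun n => cmeas_trunc n mf) mf (trunc_cvg fi) e0.
exists N => n m Nn Nm; apply: le_trans (HN n m Nn Nm).
have i1 := cintegrable_trunc n fi; have i2 := cintegrable_trunc m fi.
under eq_fun do rewrite !fourier_truncE -mulrBr -oscB//.
apply: esq_osc_le; first by rewrite sqrrN.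
by have := cintegrableD i1 (cintegrableZ (-1) i2); under eq_fun do rewrite mulN1r.
Qed.

(* Meaningful for [s = 1] and [s = - 1]. *)
Definition l2fourier s f := L2lim (fourier_trunc s f).

Lemma sqint_l2fourier s f : s ^+ 2 = 1 -> sqint f -> sqint (l2fourier s f).
Proof. by move=> s2 fi; have [g gi h] := fourier_trunc_cvg s2 fi; have [] := L2limP gi h. Qed.

Lemma l2fourier_cvg s f : s ^+ 2 = 1 -> sqint f ->
  esq (fun x => fourier_trunc s f n x - l2fourier s f x) @[n --> \oo] --> 0%E.
Proof. by move=> s2 fi; have [g gi h] := fourier_trunc_cvg s2 fi; have [] := L2limP gi h. Qed.

Lemma l2fourier_unique s f g : s ^+ 2 = 1 -> sqint f -> cmeas g ->
  esq (fun x => fourier_trunc s f n x - g x) @[n --> \oo] --> 0%E ->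
  {ae mu, forall x, l2fourier s f x = g x}.
Proof.
move=> s2 fi mg; apply: esq_sub_cvg0 => //; last exact: l2fourier_cvg.
- by move=> n; exact: cmeas_fourier_trunc.
- by have [] := sqint_l2fourier s2 fi.
Qed.

Lemma ae_fourier_trunc s f g n y : sqint f -> sqint g -> {ae mu, forall x, f x = g x} ->
  fourier_trunc s f n y = fourier_trunc s g n y.
Proof.
move=> fi gi fg; rewrite !fourier_truncE; congr (_ * _).
have m : measurable_fun setT (fun x : R => - s * x * y) by apply: measurable_funM => //; apply: measurable_funM.
have [f1 f2] := cintegrable_cmeas (@cintegrableM_cexpi R _ Rm mu (fun x : R => - s * x * y) _ m (cintegrable_trunc n fi)).
have [g1 g2] := cintegrable_cmeas (@cintegrableM_cexpi R _ Rm mu (fun x : R => - s * x * y) _ m (cintegrable_trunc n gi)).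
have [N [mN N0 hN]] := fg.
have H (p : R[i] -> R) : measurable_fun setT (fun x => p (cexpi (- s * x * y) * trunc n f x)) ->
    measurable_fun setT (fun x => p (cexpi (- s * x * y) * trunc n g x)) ->
    \int[mu]_x p (cexpi (- s * x * y) * trunc n f x) = \int[mu]_x p (cexpi (- s * x * y) * trunc n g x).
  move=> m1 m2; congr fine; apply: ae_eq_integral => //; try exact/measurable_EFinP.
  exists N; split => // x /= h; apply: hN => /= fgx; apply: h => _.
  by rewrite /trunc fgx.
apply: eq_c; apply: H.
- exact: f1.
- exact: g1.
- exact: f2.
- exact: g2.
Qed.

Lemma ae_l2fourier s f g : s ^+ 2 = 1 -> sqint f -> sqint g ->
  {ae mu, forall x, f x = g x} -> {ae mu, forall x, l2fourier s f x = l2fourier s g x}.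
Proof.
move=> s2 fi gi fg; apply: l2fourier_unique => //.
  by have [] := sqint_l2fourier s2 gi.
rewrite (_ : fourier_trunc s f = fourier_trunc s g); first exact: l2fourier_cvg.
by apply/funext => n; apply/funext => y; exact: ae_fourier_trunc.
Qed.

(** For integrable [f] the limit in L^2 is the absolutely convergent integral; this is the link that
    makes explicit transforms available. *)
Lemma l2fourier_osc s f : s ^+ 2 = 1 -> sqint f -> cintegrable mu f ->
  {ae mu, forall y, l2fourier s f y = fourier_const * osc (- s) f y}.
Proof.
move=> s2 f2 f1; apply: l2fourier_unique => //.
  by apply: cmeasM; [exact: cmeas_cst|exact: cmeas_osc].
apply/cvge0P => [n|e e0]; first exact: esq_ge0.
have := (cvge0P (fun n => esq_ge0 _)).1 (trunc_cvg f2) e e0.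
apply: filterS => n; apply: le_trans.
have i1 := cintegrable_trunc n f2.
under eq_fun do rewrite !fourier_truncE -mulrBr -oscB//.
apply: esq_osc_le; first by rewrite sqrrN.
by have := cintegrableD i1 (cintegrableZ (-1) f1); under eq_fun do rewrite mulN1r.
Qed.

Lemma sqint_cexpi (h : R -> R) f : measurable_fun setT h -> sqint f ->
  sqint (fun x => cexpi (h x) * f x).
Proof.
move=> mh [mf fo]; split; last by rewrite esq_cexpi.
by apply: cmeasM => //; exact: cmeas_cexpi.
Qed.

End FourierL2.

(** * The energy along the Schrodinger flow *)

Section SpaceTime.
Variable R : realType.
Local Notation mu := (@lebesgue_measure R).
Local Notation Rm := (measurableTypeR R).
Implicit Types (f g h : R -> R[i]) (u : nat -> R -> R[i]).

(* Unlike the sextic energy itself, its truncation is continuous on L^2, which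
   gives the measurability in time. *)
Definition capped_cube (K : R) (z : R[i]) : R := Num.min (sqn z) K ^+ 3.

Lemma capped_cube_ge0 K z : 0 <= K -> 0 <= capped_cube K z.
Proof. by move=> K0; rewrite exprn_ge0// le_min sqn_ge0. Qed.

Lemma capped_cube_le K z : 0 <= K -> capped_cube K z <= sqn z ^+ 3.
Proof.
by move=> K0; rewrite lerXn2r// ?nnegrE ?le_min ?sqn_ge0//= ge_min lexx.
Qed.

(** Truncation at K is 1-Lipschitz, and on [0, K] the cube has Lipschitz constant 3 K^2. *)
Lemma capped_cube_lip K z w : 0 <= K ->
  capped_cube K z <= capped_cube K w + 3 * K ^+ 2 * `|sqn z - sqn w|.
Proof.
move=> K0; rewrite /capped_cube.
have := sqn_ge0 z; have := sqn_ge0 w.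
move: (sqn z) (sqn w) => a b b0 a0.
have [ab|ba] := leP a b.
  have /le_trans -> // : Num.min a K ^+ 3 <= Num.min b K ^+ 3.
    rewrite lerXn2r ?nnegrE ?le_min ?a0 ?b0 ?K0//= ge_min ab/=.
    by rewrite ge_min lexx orbT.
  by rewrite lerDl mulr_ge0// mulr_ge0// sqr_ge0.
rewrite gtr0_norm ?subr_gt0//.
have m0 : 0 <= Num.min b K by rewrite le_min b0.
have mK : Num.min b K <= K by rewrite ge_min lexx orbT.
have nK : Num.min a K <= K by rewrite ge_min lexx orbT.
have mn : Num.min b K <= Num.min a K.
  by rewrite le_min !ge_min (ltW ba) lexx orbT.
have d : Num.min a K - Num.min b K <= a - b.
  by rewrite /Num.min; case: ltP => h1; case: ltP => h2; lra.
move: (Num.min b K) (Num.min a K) m0 mK nK mn d => p q p0 pK qK pq d.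
have -> : q ^+ 3 = p ^+ 3 + (q - p) * (q ^+ 2 + q * p + p ^+ 2) by ring.
rewrite lerD2l mulrC; apply: ler_pM.
- by rewrite addr_ge0 ?addr_ge0 ?sqr_ge0// mulr_ge0// (le_trans p0).
- by rewrite subr_ge0.
- have q0 := le_trans p0 pq.
  rewrite (_ : 3 * K ^+ 2 = K * K + K * K + K * K); last by ring.
  by rewrite !expr2 lerD ?lerD// ler_pM.
- exact: d.
Qed.

(** Expand |z|^2 around w and split the cross term by Young's inequality; the parameter [e] is free,
    so the first term can be made small after integration. *)
Lemma sqn_dist (e : R) z w : 0 < e ->
  `|sqn z - sqn w| <= e * sqn w + (1 + e^-1) * sqn (z - w).
Proof.
move=> e0; case: z => a b; case: w => c d; rewrite /sqn/=.
have i0 : 0 < e^-1 by rewrite invr_gt0.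
have h (x y : R) : `|2 * x * y| <= e * x ^+ 2 + e^-1 * y ^+ 2.
  have -> : e * x ^+ 2 + e^-1 * y ^+ 2 = e^-1 * ((e * x) ^+ 2 + y ^+ 2) by field; rewrite gt_eqF.
  have -> : 2 * x * y = e^-1 * (2 * (e * x) * y) by field; rewrite gt_eqF.
  rewrite normrM (gtr0_norm i0) ler_pM2l// ler_norml.
  by apply/andP; split; rewrite -subr_ge0;
    [rewrite (_ : _ - _ = (e * x + y) ^+ 2)|rewrite (_ : _ - _ = (e * x - y) ^+ 2)];
    rewrite ?sqr_ge0//; ring.
have -> : a ^+ 2 + b ^+ 2 - (c ^+ 2 + d ^+ 2) =
  2 * c * (a - c) + 2 * d * (b - d) + ((a - c) ^+ 2 + (b - d) ^+ 2) by ring.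
apply: (le_trans (ler_normD _ _)).
rewrite [X in _ + X]ger0_norm ?addr_ge0 ?sqr_ge0//.
apply: (le_trans (lerD (ler_normD _ _) (lexx _))).
have := h c (a - c); have := h d (b - d).
move: `|_| => s; move: `|_| => t hs ht.
have := lerD hs ht; lra.
Qed.

Definition capped_energy (K : R) f : \bar R := (\int[mu]_x (capped_cube K (f x))%:E)%E.

Lemma measurable_capped_cube d (T : measurableType d) (K : R) (f : T -> R[i]) : cmeas f ->
  measurable_fun setT (fun x => (capped_cube K (f x))%:E).
Proof.
move=> mf; apply/measurable_EFinP; apply: measurable_funX.
by apply: measurable_minr => //; exact: cmeas_sqn.
Qed.

Lemma sqn_dist_cvg0 u v : (forall n, cmeas (u n)) -> sqint v ->
  esq (fun x => u n x - v x) @[n --> \oo] --> 0%E ->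
  (\int[mu]_x `|sqn (u n x) - sqn (v x)|%:E)%E @[n --> \oo] --> 0%E.
Proof.
move=> um [mv vo] uv; apply/cvge0P => [n|e e0]; first by apply: integral_ge0 => x _; rewrite lee_fin.
have E0 := esq_ge0 v.
have Ef : esq v \is a fin_num by rewrite ge0_fin_numE.
pose E := fine (esq v); have E0' : 0 <= E by rewrite fine_ge0.
(* Chosen so that dl E <= e / 2; the summand 1 keeps the denominator positive when E = 0. *)
pose dl := e / (2 * (E + 1)).
have dl0 : 0 < dl by rewrite divr_gt0// mulr_gt0// ltr_wpDl.
have c0 : 0 < 1 + dl^-1 by rewrite addr_gt0// invr_gt0.
have e2 : 0 < e / (2 * (1 + dl^-1)) by rewrite divr_gt0// mulr_gt0.
have := (cvge0P (fun n => esq_ge0 _)).1 uv _ e2; apply: filterS => n hn.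
have md := cmeasB (um n) mv.
have md' : measurable_fun setT (fun x => `|sqn (u n x) - sqn (v x)|%:E).
  apply/measurable_EFinP; apply: measurableT_comp => //.
  by apply: measurable_funB; exact: cmeas_sqn.
apply: (@le_trans _ _ (dl%:E * esq v + (1 + dl^-1)%:E * esq (fun x => (u n x - v x)%R))%E).
  rewrite /esq -!ge0_integralZl//; first last.
  - by rewrite lee_fin ltW.
  - by move=> x _; rewrite lee_fin sqn_ge0.
  - exact/measurable_EFinP/cmeas_sqn.
  - by rewrite lee_fin ltW.
  - by move=> x _; rewrite lee_fin sqn_ge0.
  - exact/measurable_EFinP/cmeas_sqn.
  rewrite -ge0_integralD//; first last.
  - by apply: emeasurable_funM => //; exact/measurable_EFinP/cmeas_sqn.
  - by move=> x _; rewrite -EFinM lee_fin mulr_ge0 ?sqn_ge0 ?ltW.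
  - by apply: emeasurable_funM => //; exact/measurable_EFinP/cmeas_sqn.
  - by move=> x _; rewrite -EFinM lee_fin mulr_ge0 ?sqn_ge0 ?ltW.
  apply: ge0_le_integral => //.
  - apply: emeasurable_funD.
      by apply: emeasurable_funM => //; exact/measurable_EFinP/cmeas_sqn.
    by apply: emeasurable_funM => //; exact/measurable_EFinP/cmeas_sqn.
  - by move=> x _; rewrite -!EFinM -EFinD lee_fin; exact: sqn_dist.
rewrite -(fineK Ef) -/E.
apply: le_trans (leeD2l _ (lee_wpmul2l _ hn)) _; first by rewrite lee_fin ltW.
rewrite -!EFinM -EFinD lee_fin.
have tt (t : R) : 0 < t -> t * (e / (2 * t)) = e / 2 by move=> t0; field; rewrite gt_eqF.
rewrite tt//.
rewrite [leRHS]splitr lerD2r /dl mulrAC ler_pdivrMr; last by rewrite mulr_gt0// ltr_wpDl.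
nra.
Qed.

Lemma capped_energy_lt K f : 0 <= K -> sqint f -> (capped_energy K f < +oo)%E.
Proof.
move=> K0 [mf fo].
apply: (@le_lt_trans _ _ ((K ^+ 2)%:E * esq f)%E); last by apply: lte_mul_pinfty => //; rewrite lee_fin exprn_ge0.
rewrite /esq -ge0_integralZl//; first last.
- by rewrite lee_fin exprn_ge0.
- by move=> x _; rewrite lee_fin sqn_ge0.
- exact/measurable_EFinP/cmeas_sqn.
apply: ge0_le_integral => //.
- by move=> x _; rewrite lee_fin capped_cube_ge0.
- exact: measurable_capped_cube.
- by apply: emeasurable_funM => //; exact/measurable_EFinP/cmeas_sqn.
- move=> x _; rewrite -EFinM lee_fin /capped_cube exprSr.
  have m0 : 0 <= Num.min (sqn (f x)) K by rewrite le_min sqn_ge0.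
  apply: ler_pM => //; first exact: sqr_ge0.
    by rewrite lerXn2r ?nnegrE// ge_min lexx orbT.
  by rewrite ge_min lexx.
Qed.

Lemma capped_energy_le K f g : 0 <= K -> cmeas f -> cmeas g ->
  (capped_energy K f <= capped_energy K g +
   (3 * K ^+ 2)%:E * \int[mu]_x `|sqn (f x) - sqn (g x)|%:E)%E.
Proof.
move=> K0 mf mg.
have md : measurable_fun setT (fun x => `|sqn (f x) - sqn (g x)|%:E).
  apply/measurable_EFinP; apply: measurableT_comp => //.
  by apply: measurable_funB; exact: cmeas_sqn.
have c0 : 0 <= 3 * K ^+ 2 by rewrite mulr_ge0// sqr_ge0.
rewrite -ge0_integralZl// -ge0_integralD//; first last.
- by apply: emeasurable_funM.
- by move=> x _; rewrite -EFinM lee_fin mulr_ge0.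
- exact: measurable_capped_cube.
- by move=> x _; rewrite lee_fin capped_cube_ge0.
apply: ge0_le_integral => //.
- by move=> x _; rewrite lee_fin capped_cube_ge0.
- exact: measurable_capped_cube.
- by apply: emeasurable_funD; [exact: measurable_capped_cube|exact: emeasurable_funM].
- by move=> x _; rewrite -EFinM -EFinD lee_fin; exact: capped_cube_lip.
Qed.

Lemma cvge_dist (a b : nat -> \bar R) (l : \bar R) : l \is a fin_num ->
  (forall n, 0 <= a n)%E -> (forall n, a n <= l + b n)%E -> (forall n, l <= a n + b n)%E ->
  (forall n, 0 <= b n)%E -> b n @[n --> \oo] --> 0%E -> a n @[n --> \oo] --> l.
Proof.
move=> lf a0 al la b0 /(cvge0P b0) bh.
have af n (e : R) : (b n <= e%:E)%E -> a n \is a fin_num.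
  move=> be; rewrite ge0_fin_numE//; apply: (le_lt_trans (al n)).
  apply: lte_add_pinfty; last exact: le_lt_trans be (ltry _).
  by move: lf; rewrite fin_numElt => /andP[].
rewrite -(fineK lf); apply/fine_cvgP; split.
  by apply: filterS (bh 1 ltr01) => n; exact: af.
apply/cvgrPdist_le => e e0; apply: filterS (bh e e0) => n bn /=.
have fa := af _ _ bn; have := al n; have := la n.
have fb : b n \is a fin_num by rewrite ge0_fin_numE// (le_lt_trans bn)// ltry.
rewrite -(fineK lf) -(fineK fa) -(fineK fb) -!EFinD !lee_fin /=.
move: bn; rewrite -(fineK fb) lee_fin => h1 h2 h3.
by rewrite ler_norml; lra.
Qed.

Lemma capped_energy_cvg K u v : 0 <= K -> (forall n, cmeas (u n)) -> sqint v ->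
  esq (fun x => u n x - v x) @[n --> \oo] --> 0%E ->
  capped_energy K (u n) @[n --> \oo] --> capped_energy K v.
Proof.
move=> K0 um vi uv; have [mv _] := vi.
have D0 := sqn_dist_cvg0 um vi uv.
pose D n := (\int[mu]_x `|sqn (u n x) - sqn (v x)|%:E)%E.
have fv : capped_energy K v \is a fin_num.
  rewrite ge0_fin_numE ?capped_energy_lt//.
  by apply: integral_ge0 => x _; rewrite lee_fin capped_cube_ge0.
apply: (@cvge_dist _ (fun n => (3 * K ^+ 2)%:E * D n)%E) => //.
- by move=> n; apply: integral_ge0 => x _; rewrite lee_fin capped_cube_ge0.
- by move=> n; exact: capped_energy_le.
- move=> n; rewrite /D (_ : (\int[mu]_x _ = \int[mu]_x `|sqn (v x) - sqn (u n x)|%:E)%E).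
    exact: capped_energy_le.
  by apply: eq_integral => x _; rewrite distrC.
- move=> n; rewrite mule_ge0//; first by rewrite lee_fin mulr_ge0// sqr_ge0.
  by apply: integral_ge0 => x _; rewrite lee_fin.
- by rewrite -[X in _ --> X](mule0 (3 * K ^+ 2)%:E); apply: cvgeZl.
Qed.

Variable f : R -> R[i].
Hypothesis fi : sqint f.
Let g := l2fourier 1 f.
Let T r := free_schrodinger r f.
Let u r n := fourier_trunc (- 1) (fun y => cexpi (- (r * y ^+ 2)) * g y) n.

Let gi : sqint g. Proof. by apply: sqint_l2fourier => //; rewrite expr1n. Qed.

Let mphase r : measurable_fun setT (fun y : R => - (r * y ^+ 2)).
Proof. by apply: measurableT_comp => //; apply: measurable_funM. Qed.

Let gri r : sqint (fun y => cexpi (- (r * y ^+ 2)) * g y).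
Proof. exact: sqint_cexpi. Qed.

Lemma sqint_free_schrodinger r : sqint (T r).
Proof. by apply: (@sqint_l2fourier _ (- 1)) => //; rewrite sqrrN expr1n. Qed.

Lemma free_schrodinger_cvg r : esq (fun x => u r n x - T r x) @[n --> \oo] --> 0%E.
Proof. by apply: (@l2fourier_cvg _ (- 1)) => //; rewrite sqrrN expr1n. Qed.

(** The truncation in the inverse transform acts on frequencies, hence commutes with the Schrodinger
    phase. The approximants are thus extensions of an integrable function: measurable in (r, x)
    jointly, and within reach of the Strichartz estimate. *)
Lemma schrodinger_trunc_extension r n x :
  u r n x = fourier_const R * extension (trunc n g) r x.
Proof.
rewrite /u fourier_truncE; congr (_ * _); apply: eq_cint => y.
rewrite /trunc mulrCA [X in _ * X]mulrA -cexpiD [RHS]mulrCA.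
by congr (_ * (cexpi _ * _)); ring.
Qed.

Let mu2u n : cmeas (fun z : R * R => u z.1 n z.2).
Proof.
rewrite (_ : (fun z => _) = (fun z => fourier_const R * extension (trunc n g) z.1 z.2)).
  apply: cmeasM; first exact: cmeas_cst.
  by apply: cmeas_extension; exact: cintegrable_trunc.
by apply/funext => z; rewrite schrodinger_trunc_extension.
Qed.

Let mur r n : cmeas (u r n).
Proof. exact: cmeas_fourier_trunc. Qed.

(** For each r, continuity on L^2 makes the energy of [T r] the limit of those of the approximants
    [u r n], which are measurable in r by Tonelli. *)
Lemma measurable_capped_energy_schrodinger K : 0 <= K ->
  measurable_fun setT (fun r => capped_energy K (T r)).
Proof.
move=> K0; apply: (@emeasurable_fun_cvg _ _ _ _ (fun n r => capped_energy K (u r n))).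
  move=> n; apply: (@measurable_tonelli1 _ _ _ Rm Rm mu (fun r x => (capped_cube K (u r n x))%:E)).
    exact: (measurable_capped_cube _ (mu2u n)).
  by move=> r x; rewrite lee_fin capped_cube_ge0.
move=> r _; exact: (@capped_energy_cvg K (u r) (T r) K0 (mur r) (sqint_free_schrodinger r) (free_schrodinger_cvg r)).
Qed.

Definition sextic_energy h : \bar R := (\int[mu]_x (sqn (h x) ^+ 3)%:E)%E.

Lemma sextic_energy_cvg h : cmeas h ->
  capped_energy n%:R h @[n --> \oo] --> sextic_energy h.
Proof.
move=> mh.
have lim x : (capped_cube n%:R (h x))%:E @[n --> \oo] --> (sqn (h x) ^+ 3)%:E.
  apply: cvg_near_cst; exists (Num.bound (sqn (h x))) => // n /= hn.
  rewrite /capped_cube min_l//; have /ltW xn := archi_boundP (sqn_ge0 (h x)).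
  by apply: (le_trans xn); rewrite ler_nat.
rewrite (_ : sextic_energy h = \int[mu]_x limn (fun n => (capped_cube n%:R (h x))%:E))%E.
  apply: (@cvg_monotone_convergence _ _ _ mu setT measurableT
    (fun n x => (capped_cube n%:R (h x))%:E)) => //.
  - by move=> n; exact: measurable_capped_cube.
  - by move=> n x _; rewrite lee_fin capped_cube_ge0.
  - move=> x _ m n mn; rewrite lee_fin /capped_cube lerXn2r ?nnegrE ?le_min ?sqn_ge0//=.
    by rewrite ge_min lexx/= ge_min ler_nat mn orbT.
by apply: eq_integral => x _; apply/esym/cvg_lim.
Qed.

Lemma measurable_sextic_energy_schrodinger :
  measurable_fun setT (fun r => sextic_energy (T r)).
Proof.
apply: (@emeasurable_fun_cvg _ _ _ _ (fun n r => capped_energy n%:R (T r))).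
  by move=> n; exact: measurable_capped_energy_schrodinger.
by move=> r _; apply: sextic_energy_cvg; have [] := sqint_free_schrodinger r.
Qed.

Lemma sextic_energy_ge0 h : (0 <= sextic_energy h)%E.
Proof. by apply: integral_ge0 => x _; rewrite lee_fin exprn_ge0// sqn_ge0. Qed.

(** The approximants obey the Strichartz bound uniformly in n. Fatou's lemma is used twice: in n for
    a fixed cap k, where the capped energies converge, and then in k, where they increase to the
    sextic energy. *)
Lemma integral_sextic_energy_schrodinger_lty :
  (\int[mu]_(r in `[0%R, 1%R]) sextic_energy (T r) < +oo)%E.
Proof.
have [mg go] := gi.
pose I := fine (esq g).
have I0 : 0 <= I by rewrite fine_ge0// esq_ge0.
have IE : esq g = I%:E by rewrite fineK// ge0_fin_numE// esq_ge0.
pose C := (2 * pi)^-1 ^+ 3 * (expR 1 * (strichartz_const R * I ^+ 3)).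
have s0 : 0 <= strichartz_const R by rewrite /strichartz_const !mulr_ge0 ?pi_ge0.
have c0 : 0 <= (2 * pi)^-1 ^+ 3 :> R by rewrite exprn_ge0// invr_ge0 mulr_ge0// pi_ge0.
have bound n : (\int[mu]_(r in `[0%R, 1%R]) sextic_energy (u r n) <= C%:E)%E.
  have [mt to] := sqint_trunc n gi.
  pose J := fine (esq (trunc n g)).
  have J0 : 0 <= J by rewrite fine_ge0// esq_ge0.
  have JE : esq (trunc n g) = J%:E by rewrite fineK// ge0_fin_numE// esq_ge0.
  have JI : J <= I.
    rewrite -lee_fin -JE -IE; apply: ge0_le_integral => //.
    - by move=> x _; rewrite lee_fin sqn_ge0.
    - exact/measurable_EFinP/cmeas_sqn.
    - exact/measurable_EFinP/cmeas_sqn.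
    - move=> x _; rewrite lee_fin sqn_trunc indicE; case: (_ \in _) => /=.
        by rewrite mul1r.
      by rewrite mul0r sqn_ge0.
  have ti := cintegrable_trunc n gi.
  have mE := cmeas_sqn (cmeas_extension ti).
  have mE3 : measurable_fun setT (fun z : R * R => (sqn (extension (trunc n g) z.1 z.2) ^+ 3)%:E).
    by apply/measurable_EFinP; exact: measurable_funX.
  have mI : measurable_fun setT (fun r => \int[mu]_x (sqn (extension (trunc n g) r x) ^+ 3)%:E)%E.
    apply: (@measurable_tonelli1 _ _ _ Rm Rm mu (fun r x => (sqn (extension (trunc n g) r x) ^+ 3)%:E)) => // r x.
    by rewrite lee_fin exprn_ge0// sqn_ge0.
  have e r : sextic_energy (u r n) = (((2 * pi)^-1 ^+ 3)%:E * \int[mu]_x (sqn (extension (trunc n g) r x) ^+ 3)%:E)%E.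
    rewrite -ge0_integralZl//.
    - apply: eq_integral => x _; rewrite schrodinger_trunc_extension sqnM sqn_fourier_const.
      by rewrite exprMn EFinM.
    - exact: (measurableT_comp mE3 (measurable_pair1 r)).
    - by move=> x _; rewrite lee_fin exprn_ge0// sqn_ge0.
  under eq_integral do rewrite e.
  rewrite ge0_integralZl//; first last.
  - by move=> r _; apply: integral_ge0 => x _; rewrite lee_fin exprn_ge0// sqn_ge0.
  - exact: measurable_funTS.
  rewrite /C [X in (_ <= X)%E]EFinM; apply: lee_wpmul2l => //.
  apply: (le_trans (local_strichartz ti JE)).
  by rewrite lee_fin !ler_wpM2l ?expR_ge0// lerXn2r.
apply: (@le_lt_trans _ _ C%:E); last exact: ltry.
apply: (@fatou_le _ _ _ mu `[0%R, 1%R]%classic (fun k r => capped_energy k%:R (T r))).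
- exact: measurable_itv.
- by move=> k; apply: measurable_funTS; exact: measurable_capped_energy_schrodinger.
- by move=> k r; apply: integral_ge0 => x _; rewrite lee_fin capped_cube_ge0.
- by apply: measurable_funTS; exact: measurable_sextic_energy_schrodinger.
- by move=> r; exact: sextic_energy_ge0.
- apply: aeW => r _; apply: sextic_energy_cvg; by have [] := sqint_free_schrodinger r.
move=> k.
have mk n : measurable_fun setT (fun r => capped_energy k%:R (u r n)).
  apply: (@measurable_tonelli1 _ _ _ Rm Rm mu (fun r x => (capped_cube k%:R (u r n x))%:E)).
    exact: (measurable_capped_cube _ (mu2u n)).
  by move=> r x; rewrite lee_fin capped_cube_ge0.
apply: (@fatou_le _ _ _ mu `[0%R, 1%R]%classic (fun n r => capped_energy k%:R (u r n))).
- exact: measurable_itv.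
- by move=> n; exact: (measurable_funTS (mk n)).
- by move=> n r; apply: integral_ge0 => x _; rewrite lee_fin capped_cube_ge0.
- by apply: measurable_funTS; exact: measurable_capped_energy_schrodinger.
- by move=> r; apply: integral_ge0 => x _; rewrite lee_fin capped_cube_ge0.
- apply: aeW => r _.
  exact: (@capped_energy_cvg k%:R (u r) (T r) (ler0n _ _) (mur r) (sqint_free_schrodinger r) (free_schrodinger_cvg r)).
move=> n; apply: le_trans (bound n); apply: ge0_le_integral => //.
- by move=> r _; apply: integral_ge0 => x _; rewrite lee_fin capped_cube_ge0.
- exact: (measurable_funTS (mk n)).
- apply: measurable_funTS.
  apply: (@measurable_tonelli1 _ _ _ Rm Rm mu (fun r x => (sqn (u r n x) ^+ 3)%:E)).
    by apply/measurable_EFinP; apply: measurable_funX; exact: (cmeas_sqn (mu2u n)).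
  by move=> r x; rewrite lee_fin exprn_ge0// sqn_ge0.
- move=> r _; apply: ge0_le_integral => //.
  + by move=> x _; rewrite lee_fin capped_cube_ge0.
  + exact: (measurable_capped_cube _ (mur r n)).
  + by apply/measurable_EFinP; apply: measurable_funX; exact: (cmeas_sqn (mur r n)).
  + by move=> x _; rewrite lee_fin capped_cube_le.
Qed.

End SpaceTime.

(** * Injectivity of the Fourier transform *)

Section IntervalIntegrals.
Variable R : realType.
Local Notation mu := (@lebesgue_measure R).
Local Notation Rm := (measurableTypeR R).
Implicit Type p : R -> R.

Lemma Rint_dominated_cvg d (T : measurableType d) (m : {measure set T -> \bar R})
    (f : nat -> T -> R) (g G : T -> R) :
  (forall n, measurable_fun setT (f n)) -> measurable_fun setT g ->
  {ae m, forall x, f ^~ x @ \oo --> g x} -> m.-integrable setT (EFin \o G) ->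
  (forall n x, `|f n x| <= G x) ->
  \int[m]_x f n x @[n --> \oo] --> \int[m]_x g x.
Proof.
move=> mf mg fg iG fG.
have := @dominated_convergence _ _ _ m setT measurableT
  (fun n => EFin \o f n) (EFin \o g) (EFin \o G).
case.
- by move=> n; exact/measurable_EFinP.
- exact/measurable_EFinP.
- have [N [mN N0 hN]] := fg; exists N; split => //.
  apply: subset_trans hN => x /= h c; apply: h => _.
  by apply: cvg_EFin; [exact: nearW|exact: c].
- exact: iG.
- by apply: aeW => x n _ /=; rewrite lee_fin.
move=> i _ h; apply: fine_cvg; rewrite /Rintegral fineK; first exact: h.
exact: (integrable_fin_num measurableT i).
Qed.

Lemma ae_imply2 (P Q S : R -> Prop) :
  {ae mu, forall x, P x} -> {ae mu, forall x, Q x} -> (forall x, P x -> Q x -> S x) ->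
  {ae mu, forall x, S x}.
Proof.
move=> [M [mM M0 hM]] [N [mN N0 hN]] PQS; exists (M `|` N); split.
- exact: measurableU.
- by rewrite measureU0.
move=> x /= nS; have [Px|nP] := pselect (P x); last by left; exact: hM.
by right; apply: hN => Qx; apply: nS; exact: PQS.
Qed.

Definition rsqint p := measurable_fun setT p /\ mu.-integrable setT (EFin \o (fun x => p x ^+ 2)).

Lemma rsqint_indic p (a b : R) : rsqint p ->
  mu.-integrable setT (EFin \o (fun x => \1_`[a, b]%classic x * p x)).
Proof.
move=> [mp ip].
have := integrableD measurableT (integrable_indic_itv a b true false) ip; apply: le_integrable => //.
  by apply/measurable_EFinP; apply: measurable_funM => //; exact: measurable_indic.
move=> x _ /=; rewrite lee_fin indicE; case: (_ \in _) => /=.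
  rewrite mul1r [leRHS]ger0_norm ?addr_ge0 ?sqr_ge0// -(real_normK (num_real (p x))).
  by move: (normr_ge0 (p x)); move: (`|p x|) => y y0; have := sqr_ge0 (y - 1); nra.
by rewrite mul0r normr0.
Qed.

(* Lebesgue differentiation of the vanishing primitive. *)
Lemma interval_integral_eq0 p : rsqint p ->
  (forall a b, a < b -> \int[mu]_x (\1_`[a, b]%classic x * p x) = 0) ->
  {ae mu, forall x, p x = 0}.
Proof.
move=> pi p0; have [mp _] := pi.
pose P (N : nat) x := \1_`[- N%:R, N%:R]%classic x * p x.
have iP N : mu.-integrable setT (EFin \o P N) by exact: rsqint_indic.
have H N : {ae mu, forall x, - N%:R < x < N%:R -> p x = 0}.
  have := @FTC1Ny R (P N).
  have h1 y : mu.-integrable `]-oo, y]%classic (EFin \o P N).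
    by apply: integrableS (iP N).
  have h2 := open_integrable_locally openT (iP N).
  move=> /(_ h1 h2) [Z [mZ Z0 hZ]]; exists Z; split => //.
  apply: subset_trans hZ => x /= h hx; apply: h => /andP[x1 x2].
  set F := (fun y => _) in hx.
  have F0 y : - N%:R < y < N%:R -> F y = 0.
    move=> /andP[y1 y2]; rewrite /F Rintegral_mkcond -[RHS](p0 (- N%:R) y y1).
    apply: eq_Rintegral => z _; rewrite patchE /P !indicE.
    have -> : (z \in `[- N%:R, y]%classic) = (z \in `]-oo, y]%classic) && (z \in `[- N%:R, N%:R]%classic).
      apply/idP/andP => [/set_mem/=|[/set_mem/= + /set_mem/=]]; rewrite ?in_itv/=.
        by move=> /andP[zy1 zy2]; split; apply/mem_set; rewrite /= in_itv/= ?zy1 ?zy2//= (le_trans zy2)// ltW.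
      by move=> zy /andP[zN _]; apply/mem_set; rewrite /= in_itv/= zN.
    by case: (_ \in _) => //=; rewrite mul0r.
  have PE : P N x = p x by rewrite /P indicE mem_set ?mul1r//= in_itv/= !ltW.
  rewrite -PE; have [_ <-] := hx.
  rewrite derive1E -[RHS](derive_cst (0 : R) x 1); apply: near_eq_derive.
  have xi : x \in `]- N%:R, N%:R[ by rewrite in_itv/= x1.
  by apply: filterS (near_in_itvoo xi) => y; rewrite in_itv/= => /F0.
have := ae_foralln H.
case => Z [mZ Z0 hZ]; exists Z; split => //; apply: subset_trans hZ => x /= px h; apply: px.
apply: (h (Num.bound x)); rewrite -ltr_norml.
by have := archi_boundP (normr_ge0 x); rewrite /Num.bound normr_id.
Qed.


Lemma rsqint_shift p (k t : R) : k != 0 -> rsqint p -> rsqint (fun x => p (k * x + t)).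
Proof.
move=> k0 [mp ip]; split; last exact: (integrable_affine t k0 ip).
by apply: measurableT_comp mp _; exact: measurable_affine.
Qed.

Lemma rsqint_gauss p (h : R -> R) : measurable_fun setT h -> (forall x, 0 <= h x <= 1) ->
  mu.-integrable setT (EFin \o h) -> rsqint p -> mu.-integrable setT (EFin \o (fun x => h x * p x)).
Proof.
move=> mh h01 ih [mp ip]; have := integrableD measurableT ih ip; apply: le_integrable => //.
  by apply/measurable_EFinP; apply: measurable_funM.
move=> x _ /=; have /andP[h0 h1] := h01 x.
rewrite lee_fin normrM [leRHS]ger0_norm ?addr_ge0 ?sqr_ge0// (ger0_norm h0).
rewrite -(real_normK (num_real (p x))).
by move: (normr_ge0 (p x)); move: (`|p x|) => y y0; nra.
Qed.

Lemma gauss01 (c x : R) : 0 <= c -> 0 <= gauss c x <= 1.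
Proof. by move=> c0; rewrite gauss_ge0 gauss_le1. Qed.

Section GaussAverages.
Variables (p : R -> R) (a b : R).
Hypotheses (pi2 : rsqint p) (ab : a < b).
Hypothesis p0 : forall (n : nat) t, \int[mu]_x (gauss (n.+1%:R ^+ 2) (x - t) * p x) = 0.

Let I : R -> R := \1_`[a, b]%classic.
(** The integral over [a, b] of [p] shifted by u / (n+1). Its Gaussian average in u vanishes by
    hypothesis ([avg0]), while for n large it approaches the plain integral over [a, b] ([qcvg]). *)
Let q n u := \int[mu]_t (I t * p (n.+1%:R^-1 * u + t)).
Let K := \int[mu]_x I x + \int[mu]_x (p x ^+ 2).

Let I01 x : 0 <= I x <= 1.
Proof. by rewrite /I indicE; case: (_ \in _) => /=; rewrite ?lexx ?ler01. Qed.

Let mI : measurable_fun setT I. Proof. exact: measurable_indic. Qed.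
Let iI : mu.-integrable setT (EFin \o I). Proof. exact: (integrable_indic_itv a b true false). Qed.

Let ps u : rsqint (fun t => p (u + t)).
Proof. by have := rsqint_shift u (oner_neq0 R) pi2; under eq_fun do rewrite mul1r addrC. Qed.

Let ints u : \int[mu]_t (p (u + t) ^+ 2) = \int[mu]_x (p x ^+ 2).
Proof.
have [_ ip] := pi2; have := Rintegral_affine u (oner_neq0 R) ip.
rewrite normr1 invr1 mul1r => <-.
by apply: eq_Rintegral => t _; rewrite mul1r addrC.
Qed.

Let iIp u : mu.-integrable setT (EFin \o (fun t => I t * p (u + t))).
Proof. exact: rsqint_gauss. Qed.

Let normq u : \int[mu]_t `|I t * p (u + t)| <= K.
Proof.
have [_ ip] := ps u; rewrite /K -(ints u) -RintegralD//.
apply: le_Rintegral => //.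
- by have := integrable_norm (iIp u).
- by have := integrableD measurableT iI ip.
move=> t _; have /andP[h0 h1] := I01 t.
rewrite normrM (ger0_norm h0) -(real_normK (num_real (p _))).
by move: (normr_ge0 (p (u + t))); move: (`|p _|) => y y0; nra.
Qed.

Let q_le n u : `|q n u| <= K.
Proof. by apply: le_trans (normq _); exact: le_normr_Rintegral. Qed.

Let F n (z : R * R) := gauss 1 z.1 * (I z.2 * p (n.+1%:R^-1 * z.1 + z.2)).

Let mF n : measurable_fun setT (F n).
Proof.
apply: measurable_funM; first exact: measurableT_comp (@measurable_gauss R 1) measurable_fst.
apply: measurable_funM; first exact: measurableT_comp mI measurable_snd.
have [mp _] := pi2; apply: measurableT_comp mp _.
by apply: measurable_funD => //; apply: measurable_funM.
Qed.

Let iF n : (mu \x mu)%E.-integrable setT (EFin \o F n).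
Proof.
have mg : measurable_fun setT (fun u : R => K * gauss 1 u).
  by apply: measurable_funM => //; exact: measurable_gauss.
have mEF : measurable_fun setT (EFin \o F n) by exact/measurable_EFinP.
have mabs : measurable_fun setT (fun z => `|(EFin \o F n) z|%E) by exact: measurableT_comp.
apply/(@integrable12ltyP _ _ Rm Rm R mu mu _ mEF).
apply: (@le_lt_trans _ _ (\int[mu]_u (K * gauss 1 u)%:E)%E); last first.
  have := integrableZl measurableT K (@integrable_gauss R 1 ltr01).
  by move=> /(integrable_fin_num measurableT); rewrite fin_numElt => /andP[].
apply: ge0_le_integral => //.
- by move=> u _; apply: integral_ge0.
- apply: (@measurable_tonelli1 _ _ _ Rm Rm mu (fun u t => `|(F n (u, t))%:E|%E)) => //.
- apply/measurable_EFinP; exact: mg.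
move=> u _; have h := normq (n.+1%:R^-1 * u).
have e : (\int[mu]_t `|(F n (u, t))%:E| = (gauss 1 u)%:E * \int[mu]_t `|I t * p (n.+1%:R^-1 * u + t)|%:E)%E.
  rewrite -ge0_integralZl//.
  - by apply: eq_integral => t _; rewrite /F/= normrM ger0_norm ?gauss_ge0.
  - apply/measurable_EFinP; apply: measurableT_comp => //.
    by apply: measurable_funM => //; have [] := ps (n.+1%:R^-1 * u).
  - by rewrite lee_fin gauss_ge0.
rewrite e (mulrC K) EFinM; apply: lee_wpmul2l; first by rewrite lee_fin gauss_ge0.
rewrite -(fineK (integrable_fin_num measurableT (integrable_norm (iIp (n.+1%:R^-1 * u))))).
by rewrite lee_fin.
Qed.

(** The substitution x = u / (n+1) + t turns this into the hypothesis [p0]. *)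
Let inner n t : \int[mu]_u (gauss 1 u * p (n.+1%:R^-1 * u + t)) = 0.
Proof.
have k0 : n.+1%:R^-1 != 0 :> R by rewrite invr_eq0 pnatr_eq0.
have n2 : 0 <= n.+1%:R ^+ 2 :> R by rewrite sqr_ge0.
have i : mu.-integrable setT (EFin \o (fun x => gauss (n.+1%:R ^+ 2) (x - t) * p x)).
  apply: rsqint_gauss => //.
  - by apply: measurableT_comp (@measurable_gauss R _) _; exact: measurable_funB.
  - by move=> x; exact: gauss01.
  - have := @integrable_affine R 1 (- t) (EFin \o gauss (n.+1%:R ^+ 2)) (oner_neq0 R).
    under eq_fun do rewrite mul1r; apply; apply: integrable_gauss.
    by rewrite exprn_gt0.
have h := Rintegral_affine t k0 i; rewrite (p0 n t) mulr0 in h; rewrite -[RHS]h.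
apply: eq_Rintegral => u _; rewrite addrK; congr (_ * _); rewrite /gauss; congr expR.
have m0 : n.+1%:R != 0 :> R by rewrite pnatr_eq0.
by move: (n.+1%:R) m0 => m m0; field.
Qed.

Let avg0 n : \int[mu]_u (gauss 1 u * q n u) = 0.
Proof.
have ipn u : mu.-integrable setT (EFin \o (fun t => F n (u, t))).
  exact: (integrableZl measurableT (gauss 1 u) (iIp (n.+1%:R^-1 * u))).
have k0 : n.+1%:R^-1 != 0 :> R by rewrite invr_eq0 pnatr_eq0.
have iq t : mu.-integrable setT (EFin \o (fun u => gauss 1 u * p (n.+1%:R^-1 * u + t))).
  apply: rsqint_gauss => //; first exact: measurable_gauss.
  - by move=> x; exact: gauss01.
  - exact: integrable_gauss.
  - exact: rsqint_shift.
have inp t : mu.-integrable setT (EFin \o (fun u => F n (u, t))).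
  have := integrableZl measurableT (I t) (iq t); apply: eq_integrable => // u _.
  by rewrite /F /= -EFinM mulrCA.
have [h1 h2] := @Rint_fubini _ _ _ Rm Rm mu mu _ (iF n) ipn inp.
transitivity (\int[mu]_u \int[mu]_t F n (u, t)).
  by apply: eq_Rintegral => u _; rewrite /q -RintegralZl.
have z0 : \int[mu]_t (0 : R) = 0 by rewrite /Rintegral integral0.
rewrite h1 -h2 -[RHS]z0.
apply: eq_Rintegral => t _.
transitivity (I t * \int[mu]_u (gauss 1 u * p (n.+1%:R^-1 * u + t))); last by rewrite inner mulr0.
by rewrite -RintegralZl//; apply: eq_Rintegral => u _; rewrite /F/= mulrCA.
Qed.

Let Icvg x (u : R) : x != a -> x != b -> I (x - n.+1%:R^-1 * u) @[n --> \oo] --> I x.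
Proof.
move=> xa xb.
have xc : x - n.+1%:R^-1 * u @[n --> \oo] --> x.
  rewrite -[X in _ --> X]subr0 -[X in _ - X](mul0r u).
  apply: cvgB; first exact: cvg_cst.
  by apply: cvgM; [exact: cvg_harmonic|exact: cvg_cst].
apply: cvg_near_cst; apply: (xc [set y | I y = I x]).
have [xla|xga|] := ltgtP x a; last by move/eqP: xa.
  have xi : x \in `]-oo, a[ by rewrite in_itv.
  apply: filterS (near_in_itvNyo xi) => y; rewrite in_itv/= => ya.
  by rewrite /I !indicE !memNset//= in_itv/= leNgt ?xla ?ya.
have [xlb|xgb|] := ltgtP x b; last by move/eqP: xb.
  have xi : x \in `]a, b[ by rewrite in_itv/= xga.
  apply: filterS (near_in_itvoo xi) => y; rewrite in_itv/= => /andP[ya yb].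
  by rewrite /I !indicE !mem_set//= in_itv/= !ltW.
have xi : x \in `]b, +oo[ by rewrite in_itv/= xgb.
apply: filterS (near_in_itvoy xi) => y; rewrite in_itv/= andbT => ya.
by rewrite /I !indicE !memNset//= in_itv/= => /andP[_]; rewrite leNgt ?xgb ?ya.
Qed.

(** A translation moves the shift from [p] to the indicator, which converges off its two endpoints;
    so [p] may be merely square integrable. An indicator of the interval enlarged by |u|
    dominates. *)
Let qcvg u : q n u @[n --> \oo] --> \int[mu]_x (I x * p x).
Proof.
have [mp _] := pi2.
have qE n : q n u = \int[mu]_x (I (x - n.+1%:R^-1 * u) * p x).
  have mIs : measurable_fun setT (fun x : R => I (x - n.+1%:R^-1 * u)).
    by apply: measurableT_comp mI _; exact: measurable_funB.
  have iIs : mu.-integrable setT (EFin \o (fun x : R => I (x - n.+1%:R^-1 * u))).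
    have := @integrable_affine R 1 (- (n.+1%:R^-1 * u)) (EFin \o I) (oner_neq0 R) iI.
    by under eq_fun do rewrite mul1r.
  have := @Rintegral_affine R 1 (n.+1%:R^-1 * u) _ (oner_neq0 R) (rsqint_gauss mIs (fun x => I01 _) iIs pi2).
  rewrite normr1 invr1 mul1r => <-.
  by apply: eq_Rintegral => t _; rewrite mul1r addrK [_ + t]addrC.
under eq_fun do rewrite qE.
apply: (@Rint_dominated_cvg _ _ mu _ _ (fun x => `|\1_`[a - `|u|, b + `|u|]%classic x * p x|)).
- move=> n; apply: measurable_funM => //.
  by apply: measurableT_comp mI _; exact: measurable_funB.
- exact: measurable_funM.
- exists [set a; b]; split; first exact: measurableU.
    by apply: countable_lebesgue_measure0; apply: finite_set_countable; exact: finite_set2.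
  move=> x /= h; apply: contrapT => /not_orP[/eqP xa /eqP xb]; apply: h.
  by apply: cvgM; [exact: Icvg|exact: cvg_cst].
- exact: (integrable_norm (rsqint_indic _ _ pi2)).
move=> n x; rewrite !normrM ler_wpM2r//.
have /andP[i0 i1] := I01 (x - n.+1%:R^-1 * u); rewrite ger0_norm// ger0_norm.
  rewrite /I !indicE; case: (boolP (_ \in `[a, b]%classic)) => [/set_mem|_]; last by case: (_ \in _).
  rewrite /= in_itv/= => /andP[h1 h2]; rewrite mem_set//= in_itv/=.
  have v1 : `|n.+1%:R^-1 * u| <= `|u|.
    by rewrite normrM ler_piMl// ger0_norm// invf_le1// ler1n.
  have H (s t y : R) : a <= y - s -> y - s <= b -> `|s| <= t -> a - t <= y <= b + t.
    by move=> h3 h4; rewrite ler_norml => /andP[h5 h6]; apply/andP; split; lra.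
  exact: (H (n.+1%:R^-1 * u)).
by rewrite indicE; case: (_ \in _).
Qed.

Lemma gauss_averages_interval : \int[mu]_x (I x * p x) = 0.
Proof.
set Q := \int[mu]_x _.
have : \int[mu]_u (gauss 1 u * q n u) @[n --> \oo] --> \int[mu]_u (gauss 1 u * Q).
  apply: (@Rint_dominated_cvg _ _ mu _ _ (fun u => K * gauss 1 u)).
  - move=> n; have := measurable_Rintegral_param (iF n).
    apply: eq_measurable_fun => u _; rewrite /q -RintegralZl//.
  - by apply: measurable_funM => //; exact: measurable_gauss.
  - by apply: aeW => u; apply: cvgM; [exact: cvg_cst|exact: qcvg].
  - exact: (integrableZl measurableT K (@integrable_gauss R 1 ltr01)).
  - by move=> n u; rewrite normrM ger0_norm ?gauss_ge0// mulrC ler_wpM2r ?gauss_ge0.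
under eq_fun do rewrite avg0.
move=> /(cvg_unique _ (cvg_cst _)) h.
have {h} : Q * Num.sqrt (pi / 1) = 0.
  rewrite -Rintegral_gauss// -RintegralZl//; last exact: integrable_gauss.
  by apply/esym; rewrite [LHS]h//; apply: eq_Rintegral => u _; rewrite mulrC.
move=> /eqP; rewrite mulf_eq0 => /orP[/eqP//|].
by rewrite sqrtr_eq0 divr1 leNgt pi_gt0.
Qed.

End GaussAverages.

Lemma gauss_averages_eq0 p : rsqint p ->
  (forall (n : nat) t, \int[mu]_x (gauss (n.+1%:R ^+ 2) (x - t) * p x) = 0) ->
  {ae mu, forall x, p x = 0}.
Proof.
by move=> pi2 p0; apply: interval_integral_eq0 => // a b ab; exact: gauss_averages_interval.
Qed.

End IntervalIntegrals.

Section Injectivity.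
Variable R : realType.
Local Notation mu := (@lebesgue_measure R).
Local Notation re := (@complex.Re R).
Local Notation im := (@complex.Im R).
Local Notation Rm := (measurableTypeR R).
Local Notation normc := (@ComplexField.Normc.normc R).
Implicit Types (f g h v : R -> R[i]) (p : R[i] -> R).

Lemma normcM_le (z w : R[i]) (e : R) : 0 < e -> normc (z * w) <= e * sqn z + e^-1 * sqn w.
Proof.
move=> e0; rewrite normcE2 sqnM sqrtrM ?sqn_ge0// -!normcE2 -!normc_sqr.
move: (normc_ge0 z) (normc_ge0 w); move: (normc z) (normc w) => a b a0 b0.
have -> : e * a ^+ 2 + e^-1 * b ^+ 2 = e^-1 * ((e * a) ^+ 2 + b ^+ 2) by field; rewrite gt_eqF.
have -> : a * b = e^-1 * (e * a * b) by field; rewrite gt_eqF.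
rewrite ler_pM2l ?invr_gt0//; have : 0 <= e * a by rewrite mulr_ge0// ltW.
by move: (e * a) => c c0; have := sqr_ge0 (c - b); nra.
Qed.

Lemma cintegrableM_sqint f v : sqint f -> sqint v -> cintegrable mu (fun x => f x * v x).
Proof.
move=> fi vi; have [mf _] := fi; have [mv _] := vi.
apply: (@cintegrable_le _ _ _ mu (fun x => f x * v x) (fun x : R => sqn (f x) + sqn (v x))).
- exact: cmeasM.
- exact: (integrableD measurableT (integrable_sqn fi) (integrable_sqn vi)).
by move=> x; have := normcM_le (f x) (v x) ltr01; rewrite invr1 !mul1r.
Qed.

Lemma normr_cint_le (q : R[i] -> R) f v (e : R) : (forall z, `|q z| <= normc z) ->
  mu.-integrable setT (EFin \o (fun x => q (f x * v x))) ->
  sqint f -> sqint v -> 0 < e ->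
  `|\int[mu]_x q (f x * v x)| <= e * fine (esq f) + e^-1 * fine (esq v).
Proof.
move=> qn iq fi vi e0.
have i1 := integrable_sqn fi; have i2 := integrable_sqn vi.
apply: (le_trans (le_normr_Rintegral measurableT iq)).
have -> : e * fine (esq f) + e^-1 * fine (esq v) =
    \int[mu]_x (e * sqn (f x) + e^-1 * sqn (v x)).
  rewrite RintegralD//; [|exact: (integrableZl measurableT e i1)|exact: (integrableZl measurableT e^-1 i2)].
  by rewrite !RintegralZl.
apply: le_Rintegral => //.
- by have := integrable_norm iq.
- have := integrableD measurableT (integrableZl measurableT e i1) (integrableZl measurableT e^-1 i2).
  by apply: eq_integrable => // x _.
by move=> x _; apply: le_trans (qn _) _; exact: normcM_le.
Qed.

(** Young's inequality with a small weight [d] on the fixed factor; the null sequence then absorbs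
    the large weight 1/d. *)
Lemma pairing_cvg0 (q : R[i] -> R) f (v : nat -> R -> R[i]) : (forall z, `|q z| <= normc z) ->
  (forall n, mu.-integrable setT (EFin \o (fun x => q (f x * v n x)))) ->
  sqint f -> (forall n, sqint (v n)) -> esq (v n) @[n --> \oo] --> 0%E ->
  \int[mu]_x q (f x * v n x) @[n --> \oo] --> 0.
Proof.
move=> qn iq fi vi v0; apply/cvgr0Pnorm_le => e e0.
pose E := fine (esq f); have E0 : 0 <= E by rewrite fine_ge0 ?esq_ge0.
pose d := e / (2 * (E + 1)).
have d0 : 0 < d by rewrite divr_gt0// mulr_gt0// ltr_wpDl.
have h0 : 0 < d * (e / 2) by rewrite mulr_gt0// divr_gt0.
have := (cvge0P (fun n => esq_ge0 _)).1 v0 _ h0; apply: filterS => n hn.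
apply: (le_trans (normr_cint_le qn (iq n) fi (vi n) d0)); rewrite -/E.
have vf : esq (v n) \is a fin_num by rewrite ge0_fin_numE ?esq_ge0//; have [] := vi n.
have {}hn : fine (esq (v n)) <= d * (e / 2) by rewrite -lee_fin fineK.
have : d^-1 * fine (esq (v n)) <= e / 2 by rewrite mulrC ler_pdivrMr// mulrC.
have : d * E <= e / 2.
  by rewrite /d mulrAC ler_pdivrMr; [nra|rewrite mulr_gt0// ltr_wpDl].
lra.
Qed.

Lemma cint_pairing_cvg0 f (v : nat -> R -> R[i]) : sqint f -> (forall n, sqint (v n)) ->
  esq (v n) @[n --> \oo] --> 0%E ->
  re (cint mu (fun x => f x * v n x)) @[n --> \oo] --> 0 /\
  im (cint mu (fun x => f x * v n x)) @[n --> \oo] --> 0.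
Proof.
move=> fi vi v0; have i n := cintegrableM_sqint fi (vi n).
split.
  exact: (pairing_cvg0 (@normr_re_le R) (fun n => (i n).1) fi vi v0).
exact: (pairing_cvg0 (@normr_im_le R) (fun n => (i n).2) fi vi v0).
Qed.

Lemma sqint_gauss (a : R) (h : R -> R) : 0 < a -> measurable_fun setT h ->
  sqint (fun x => (gauss a x)%:C * cexpi (h x)).
Proof.
move=> a0 mh; split.
  by apply: cmeasM; [apply: cmeas_real; exact: measurable_gauss|exact: cmeas_cexpi].
have e x : sqn ((gauss a x)%:C * cexpi (h x)) = gauss (a + a) x.
  by rewrite sqnM sqn_cexpi mulr1 sqn_real expr2 gaussD /gauss; congr expR; ring.
rewrite /esq; under eq_integral do rewrite e.
by rewrite integral_gauss ?ltry// addr_gt0.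
Qed.

Lemma sqint_gauss_shift (a t : R) : 0 < a -> sqint (fun x => (gauss a (x - t))%:C).
Proof.
move=> a0; have mg := @measurable_gauss R.
have m : measurable_fun setT (fun x : R => x - t) by exact: measurable_funB.
split; first by apply: cmeas_real; exact: measurableT_comp (mg a) m.
have e x : sqn (gauss a (x - t))%:C = gauss (a + a) (1 * x - t).
  by rewrite sqn_real expr2 gaussD mul1r /gauss; congr expR; ring.
rewrite /esq; under eq_integral do rewrite e.
have := @ge0_integral_affine R 1 (- t) (EFin \o gauss (a + a)) (oner_neq0 R).
rewrite /comp => ->.
- by rewrite integral_gauss ?addr_gt0// normr1 invr1 mul1e ltry.
- by apply/measurable_EFinP; exact: mg.
- by move=> x; rewrite lee_fin gauss_ge0.
Qed.

Section Vanishing.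
Variables (s : R) (h : R -> R[i]).
Hypotheses (s2 : s ^+ 2 = 1) (hi : sqint h).
Hypothesis h0 : {ae mu, forall x, l2fourier s h x = 0}.

Let w n := fourier_trunc s h n.

Let w0 : esq (w n) @[n --> \oo] --> 0%E.
Proof.
rewrite (_ : (fun n => esq (w n)) = (fun n => esq (fun x => w n x - l2fourier s h x))).
  exact: l2fourier_cvg.
apply/funext => n; apply: ae_eq_esq.
- exact: cmeas_fourier_trunc.
- by apply: cmeasB; [exact: cmeas_fourier_trunc|have [] := sqint_l2fourier s2 hi].
have [N [mN N0 hN]] := h0; exists N; split => //.
by apply: subset_trans hN => x /= c d; apply: c; rewrite d subr0.
Qed.

(** Fubini moves the transform from [h] to a modulated Gaussian. Its transform is a Gaussian centred
    at [t], and the parameter (4 k)^(-1) is the one for which this is exactly [gauss k]. *)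
Lemma gauss_pairing_trunc (k t : R) n : 0 < k ->
  cint mu (fun y => (gauss (4 * k)^-1 y)%:C * cexpi (s * t * y) * w n y) =
  fourier_const R * (Num.sqrt (pi / (4 * k)^-1))%:C *
  cint mu (fun x => (gauss k (x - t))%:C * trunc n h x).
Proof.
move=> k0; have e0 : 0 < (4 * k)^-1 by rewrite invr_gt0 mulr_gt0.
set e := (4 * k)^-1 in e0 *.
have ti := cintegrable_trunc n hi.
pose G y : R[i] := (gauss e y)%:C.
have mlin (c : R) : measurable_fun setT (fun y : R => c * y) by exact: measurable_funM.
have Gi : cintegrable mu G.
  have := cintegrable_gauss e0 (@measurable_cst _ _ R R setT 0).
  by under eq_fun do rewrite cexpi0 mulr1.
pose th (z : R * R) := s * t * z.1 - s * z.2 * z.1.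
have mth : measurable_fun setT th.
  by apply: measurable_funB; apply: measurable_funM => //; apply: measurable_funM.
pose F (z : R * R) := cexpi (th z) * (G z.1 * trunc n h z.2).
have Fi : cintegrable (mu \x mu)%E F.
  have i := @cintegrable_tensor _ _ _ Rm Rm mu mu _ _ Gi ti.
  exact: (@cintegrableM_cexpi R _ (Rm * Rm)%type (mu \x mu)%E th (fun z => G z.1 * trunc n h z.2) mth i).
have F1 y : cintegrable mu (fun x => F (y, x)).
  apply: (@cintegrableM_cexpi R _ Rm mu (fun x : R => th (y, x)) (fun x => G y * trunc n h x)).
    exact: (measurableT_comp mth (measurable_pair1 y)).
  exact: cintegrableZ.
have F2 x : cintegrable mu (fun y => F (y, x)).
  apply: (@cintegrableM_cexpi R _ Rm mu (fun y : R => th (y, x)) (fun y => G y * trunc n h x)).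
    exact: (measurableT_comp mth (measurable_pair2 x)).
  by under eq_fun do rewrite mulrC; exact: cintegrableZ.
have [E1 E2] := @cint_fubini _ _ _ Rm Rm mu mu F Fi F1 F2.
transitivity (fourier_const R * cint mu (fun y => cint mu (fun x => F (y, x)))).
  have io y : cintegrable mu (fun x => cexpi (- s * x * y) * trunc n h x).
    apply: (@cintegrableM_cexpi R _ Rm mu (fun x : R => - s * x * y) _ _ ti).
    by apply: measurable_funM => //; exact: measurable_funM.
  have e1 y : cint mu (fun x => F (y, x)) = G y * cexpi (s * t * y) * osc (- s) (trunc n h) y.
    rewrite /osc -cintZ//; apply: eq_cint => x; rewrite /F /th/=.
    rewrite (_ : s * t * y - s * x * y = s * t * y + - s * x * y); last by ring.
    by rewrite cexpiD; ring.
  rewrite -cintZ; last first.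
    under eq_fun do rewrite e1.
    apply: (@cintegrableM_sqint (fun y => G y * cexpi (s * t * y)) (osc (- s) (trunc n h))).
      exact: sqint_gauss.
    split; first exact: cmeas_osc.
    have s2' : (- s) ^+ 2 = 1 by rewrite sqrrN.
    apply: le_lt_trans (osc_L2_le s2' ti) _; apply: lte_mul_pinfty => //.
      by rewrite lee_fin mulr_ge0 ?pi_ge0.
    by have [] := sqint_trunc n hi.
  apply: eq_cint => y; rewrite e1 /w fourier_truncE /G; ring.
rewrite E1 -E2 -mulrA; congr (_ * _).
rewrite -cintZ; last first.
  by apply: cintegrableM_sqint; [exact: sqint_gauss_shift|exact: sqint_trunc].
apply: eq_cint => x.
transitivity (cint mu (fun y => trunc n h x * ((gauss e y)%:C * cexpi (y * (s * (t - x)))))).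
  apply: eq_cint => y; rewrite /F /th /G/=.
  by rewrite (_ : s * t * y - s * x * y = y * (s * (t - x))); ring.
rewrite cintZ; last by apply: cintegrable_gauss => //; exact: measurable_funM.
rewrite cint_gauss// (_ : gauss (4 * e)^-1 (s * (t - x)) = gauss k (x - t)); last first.
  have -> : (4 * e)^-1 = k by rewrite /e invfM invrK mulKf.
  by rewrite /gauss exprMn s2 mul1r -(sqrrN (t - x)) opprB.
by rewrite realcM; ring.
Qed.

(** In the identity for truncations, the left side tends to 0 because the transforms do, and the
    right side tends to a nonzero multiple of the pairing with [h]. *)
Lemma gauss_pairing_eq0 (k t : R) : 0 < k ->
  cint mu (fun x => (gauss k (x - t))%:C * h x) = 0.
Proof.
move=> k0; have e0 : 0 < (4 * k)^-1 by rewrite invr_gt0 mulr_gt0.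
have gi := sqint_gauss_shift t k0.
pose C := fourier_const R * (Num.sqrt (pi / (4 * k)^-1))%:C.
pose D n := cint mu (fun x => (gauss k (x - t))%:C * (h x - trunc n h x)).
pose W n := cint mu (fun y => (gauss (4 * k)^-1 y)%:C * cexpi (s * t * y) * w n y).
set Z := cint mu _.
have dec n : C * Z = C * D n + W n.
  have it := sqint_trunc n hi.
  rewrite /W gauss_pairing_trunc// -/C -mulrDr; congr (_ * _).
  rewrite -cintD; [|exact: cintegrableM_sqint gi (sqintB hi it)|exact: cintegrableM_sqint].
  by apply: eq_cint => x; rewrite -mulrDr subrK.
have [D1 D2] : re (D n) @[n --> \oo] --> 0 /\ im (D n) @[n --> \oo] --> 0.
  apply: cint_pairing_cvg0 => //; first by move=> n; apply: sqintB => //; exact: sqint_trunc.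
  have := trunc_cvg hi; under eq_fun do rewrite -esqN.
  rewrite (_ : (fun n => esq (fun x => - (trunc n h x - h x))) = (fun n => esq (fun x => h x - trunc n h x)))//.
  by apply/funext => n; congr esq; apply/funext => x; rewrite opprB.
have [W1 W2] : re (W n) @[n --> \oo] --> 0 /\ im (W n) @[n --> \oo] --> 0.
  apply: (@cint_pairing_cvg0 (fun y => (gauss (4 * k)^-1 y)%:C * cexpi (s * t * y)) w) => //.
    by apply: sqint_gauss => //; exact: measurable_funM.
  by move=> n; exact: sqint_fourier_trunc.
have CZ : C * Z = 0.
  have L1 : re C * re (D n) - im C * im (D n) + re (W n) @[n --> \oo] --> re C * 0 - im C * 0 + 0.
    exact: (cvgD (cvgB (cvgM (cvg_cst _) D1) (cvgM (cvg_cst _) D2)) W1).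
  have L2 : re C * im (D n) + im C * re (D n) + im (W n) @[n --> \oo] --> re C * 0 + im C * 0 + 0.
    exact: (cvgD (cvgD (cvgM (cvg_cst _) D2) (cvgM (cvg_cst _) D1)) W2).
  have u1 : re (C * Z) = re C * 0 - im C * 0 + 0.
    rewrite -(cvg_lim (@Rhausdorff R) L1); apply/esym/cvg_lim => //.
    by rewrite (_ : (fun n => _) = (fun=> re (C * Z))); [exact: cvg_cst|apply/funext => n; rewrite (dec n) reD reM].
  have u2 : im (C * Z) = re C * 0 + im C * 0 + 0.
    rewrite -(cvg_lim (@Rhausdorff R) L2); apply/esym/cvg_lim => //.
    by rewrite (_ : (fun n => _) = (fun=> im (C * Z))); [exact: cvg_cst|apply/funext => n; rewrite (dec n) imD imM].
  by apply: eq_c; [rewrite u1|rewrite u2]; rewrite !mulr0 ?subr0 !addr0.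
have : sqn C * sqn Z = 0 by rewrite -sqnM CZ sqn0.
move=> /eqP; rewrite mulf_eq0 => /orP[|/eqP/sqn_eq0//].
rewrite /C sqnM sqn_fourier_const sqn_real mulf_eq0 invr_eq0 mulf_eq0 pnatr_eq0/= gt_eqF ?pi_gt0//=.
by rewrite expf_eq0/= sqrtr_eq0 leNgt divr_gt0 ?pi_gt0.
Qed.

(** The real and imaginary parts of [h] are treated separately, as the Gaussians are real; each has
    vanishing Gaussian averages at all centres and at a sequence of scales tending to 0. *)
Lemma l2fourier_eq0 : {ae mu, forall x, h x = 0}.
Proof.
have [[m1 m2] ho] := hi; have ih := integrable_sqn hi.
have H (q : R[i] -> R) : (forall z, q z ^+ 2 <= sqn z) -> measurable_fun setT (q \o h) ->
    (forall (a : R) z, q (a%:C * z) = a * q z) ->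
    (forall (k t : R), 0 < k -> \int[mu]_x q ((gauss k (x - t))%:C * h x) = 0) ->
    {ae mu, forall x, q (h x) = 0}.
  move=> qs mq qZ q0; apply: (@gauss_averages_eq0 R (fun x => q (h x))).
    split => //; apply: le_integrable ih => //.
      by apply/measurable_EFinP; exact: measurable_funX.
    move=> x _; rewrite /= lee_fin [leRHS]ger0_norm ?sqn_ge0//.
    by rewrite ger0_norm ?sqr_ge0.
  move=> n t; rewrite -[RHS](q0 (n.+1%:R ^+ 2) t) ?exprn_gt0//.
  by apply: eq_Rintegral => x _; rewrite qZ.
have a1 : {ae mu, forall x, re (h x) = 0}.
  apply: H => //.
  - by move=> z; rewrite lerDl sqr_ge0.
  - by move=> a z; rewrite reM/= mul0r subr0.
  - by move=> k t k0; have := congr1 re (gauss_pairing_eq0 t k0).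
have a2 : {ae mu, forall x, im (h x) = 0}.
  apply: H => //.
  - by move=> z; rewrite lerDr sqr_ge0.
  - by move=> a z; rewrite imM/= mul0r addr0.
  - by move=> k t k0; have := congr1 im (gauss_pairing_eq0 t k0).
exact: (@ae_imply2 R (fun x => re (h x) = 0) (fun x => im (h x) = 0) (fun x => h x = 0) a1 a2 (fun x => @eq_c R (h x) 0)).
Qed.

End Vanishing.

(** Injectivity is used for the inverse and then for the direct transform; in between, the phase is
    removed since it has modulus 1. *)
Lemma free_schrodinger_eq0 (r : R) f : sqint f ->
  {ae mu, forall x, free_schrodinger r f x = 0} -> {ae mu, forall x, f x = 0}.
Proof.
move=> fi T0; have s1 : (1 : R) ^+ 2 = 1 by rewrite expr1n.
have s2 : (- 1 : R) ^+ 2 = 1 by rewrite sqrrN expr1n.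
have gi := sqint_l2fourier s1 fi.
have mph : measurable_fun setT (fun y : R => - (r * y ^+ 2)).
  by apply: measurableT_comp => //; apply: measurable_funM.
have := l2fourier_eq0 s2 (sqint_cexpi mph gi) T0.
move=> [N [mN N0 hN]]; apply: (l2fourier_eq0 s1 fi).
exists N; split => //; apply: subset_trans hN => y /= c d; apply: c.
have := congr1 (@sqn R) d; rewrite sqnM sqn_cexpi mul1r sqn0.
exact: sqn_eq0.
Qed.

End Injectivity.

(** * Dilations *)

Section Dilation.
Variable R : realType.
Local Notation mu := (@lebesgue_measure R).
Local Notation Rm := (measurableTypeR R).
Local Notation normc := (@ComplexField.Normc.normc R).
Implicit Types f g h : R -> R[i].

(** The factor sqrt k makes the dilation an isometry of L^2, so that it preserves the mass
    sphere. *)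
Definition dil (k : R) f (x : R) : R[i] := (Num.sqrt k)%:C * f (k * x).

Lemma cmeas_dil k f : cmeas f -> cmeas (dil k f).
Proof.
move=> mf; apply: cmeasM; first exact: cmeas_cst.
have m : measurable_fun setT (fun x : R => k * x) by exact: measurable_funM.
by have [m1 m2] := cmeas_comp m mf; split.
Qed.

Lemma esq_dil k f : 0 < k -> cmeas f -> esq (dil k f) = esq f.
Proof.
move=> k0 mf; have ms := cmeas_sqn mf.
have := @ge0_integral_affine R k 0 (fun x => (sqn (f x))%:E).
rewrite gt_eqF// => /(_ isT) H.
have {}H := H ltac:(by apply/measurable_EFinP) (fun x => ltac:(by rewrite lee_fin sqn_ge0)).
transitivity (k%:E * \int[mu]_x (sqn (f (k * x + 0)))%:E)%E.
  rewrite -ge0_integralZl//.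
  - apply: eq_integral => x _; rewrite /dil sqnM sqn_real sqr_sqrtr ?ltW// addr0.
    by rewrite EFinM.
  - by apply/measurable_EFinP; apply: measurableT_comp ms _; exact: measurable_affine.
  - by move=> x _; rewrite lee_fin sqn_ge0.
  - by rewrite lee_fin ltW.
by rewrite H gtr0_norm// muleA -EFinM divff ?gt_eqF// mul1e.
Qed.

Lemma sqint_dil k f : 0 < k -> sqint f -> sqint (dil k f).
Proof. by move=> k0 [mf fo]; split; [exact: cmeas_dil|rewrite esq_dil]. Qed.

Lemma dilB k f g : (fun x => dil k f x - dil k g x) = dil k (fun x => f x - g x).
Proof. by apply/funext => x; rewrite /dil mulrBr. Qed.

Lemma dilK k f : 0 < k -> dil k (dil k^-1 f) = f.
Proof.
move=> k0; apply/funext => x; rewrite /dil mulrA -realcM -sqrtrM ?ltW//.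
by rewrite divff ?gt_eqF// sqrtr1 mul1r mulrA mulVf ?gt_eqF// mul1r.
Qed.

Lemma ae_esqB0 f g : cmeas f -> cmeas g ->
  {ae mu, forall x, f x = g x} <-> esq (fun x => f x - g x) = 0%E.
Proof.
move=> mf mg; split=> [fg|].
  rewrite (_ : 0%E = esq (fun=> 0 : R[i])); last first.
    by rewrite /esq; under eq_integral do rewrite sqn0; rewrite integral0.
  apply: ae_eq_esq; [exact: cmeasB|exact: cmeas_cst|].
  have [N [mN N0 hN]] := fg; exists N; split => //.
  by apply: subset_trans hN => x /= c d; apply: c; rewrite d subrr.
move=> /(esq_eq0 (cmeasB mf mg)) [N [mN N0 hN]]; exists N; split => //.
by apply: subset_trans hN => x /= c d; apply: c; apply/eqP; rewrite -subr_eq0 d.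
Qed.

Lemma ae_dil k f g : 0 < k -> cmeas f -> cmeas g -> {ae mu, forall x, f x = g x} ->
  {ae mu, forall x, dil k f x = dil k g x}.
Proof.
move=> k0 mf mg /(ae_esqB0 mf mg) fg.
apply/ae_esqB0; [exact: cmeas_dil|exact: cmeas_dil|].
by rewrite dilB esq_dil//; exact: cmeasB.
Qed.

Lemma ae_trans f g h : {ae mu, forall x, f x = g x} -> {ae mu, forall x, g x = h x} ->
  {ae mu, forall x, f x = h x}.
Proof.
move=> a1 a2.
exact: (@ae_imply2 R (fun x => f x = g x) (fun x => g x = h x) (fun x => f x = h x) a1 a2
  (fun x => @etrans _ _ _ _)).
Qed.

Lemma ae_sym f g : {ae mu, forall x, f x = g x} -> {ae mu, forall x, g x = f x}.
Proof.
move=> [N [mN N0 hN]]; exists N; split => //.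
by apply: subset_trans hN => x /= c d; apply: c; rewrite d.
Qed.

(** Dilation by 2 turns the cutoff at n into the cutoff at 2 n, again a member of the defining
    sequence; this is why the factor is an integer. *)
Lemma fourier_trunc_dil s f n y : sqint f ->
  fourier_trunc s (dil 2 f) n y = dil 2^-1 (fourier_trunc s f (2 * n)) y.
Proof.
move=> fi; have ti := cintegrable_trunc (2 * n) fi.
rewrite /dil !fourier_truncE [RHS]mulrCA; congr (_ * _).
pose F x : R[i] := cexpi (- s * x * (2^-1 * y)) * trunc (2 * n) f x.
have Fi : cintegrable mu F.
  apply: (@cintegrableM_cexpi R _ Rm mu (fun x : R => - s * x * (2^-1 * y)) _ _ ti).
  by apply: measurable_funM => //; exact: measurable_funM.
have n2 : (2 : R) != 0 by rewrite pnatr_eq0.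
have h := cint_affine 0 n2 Fi.
rewrite ger0_norm// in h.
have -> : osc (- s) (trunc (2 * n) f) (2^-1 * y) = cint mu F by [].
have -> : cint mu F = 2%:C * cint mu (fun x => F (2 * x + 0)).
  by rewrite h mulrA -realcM divff// mul1r.
have Fi2 : cintegrable mu (fun x => F (2 * x + 0)).
  by have [f1 f2] := Fi; split; [exact: (integrable_affine 0 n2 f1)|exact: (integrable_affine 0 n2 f2)].
rewrite mulrA -realcM -cintZ//.
have -> : Num.sqrt 2^-1 * 2 = Num.sqrt 2 :> R.
  rewrite sqrtrV// -[X in _ * X = _](sqr_sqrtr (ler0n R 2)) expr2 mulKf//.
apply: eq_cint => x; rewrite /F /trunc addr0.
have -> : (\1_`[- (2 * n)%:R, (2 * n)%:R]%classic (2 * x)) = \1_`[- n%:R, n%:R]%classic x :> R.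
  rewrite !indicE; congr (_%:R); congr nat_of_bool.
  apply/idP/idP => /set_mem h1; apply/mem_set; move: h1; rewrite /= !in_itv/= natrM => /andP[h1 h2];
    apply/andP; split; lra.
rewrite (_ : - s * (2 * x) * (2^-1 * y) = - s * x * y); last by field.
by ring.
Qed.

Lemma l2fourier_dil2 s f : s ^+ 2 = 1 -> sqint f ->
  {ae mu, forall y, l2fourier s (dil 2 f) y = dil 2^-1 (l2fourier s f) y}.
Proof.
move=> s2 fi; have gi := sqint_l2fourier s2 fi; have [mg _] := gi.
apply: l2fourier_unique => //; [exact: sqint_dil|exact: cmeas_dil|].
apply/cvge0P => [n|e e0]; first exact: esq_ge0.
have [N _ HN] := (cvge0P (fun n => esq_ge0 _)).1 (l2fourier_cvg s2 fi) e e0.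
exists N => // n Nn.
have -> : (fun x => fourier_trunc s (dil 2 f) n x - dil 2^-1 (l2fourier s f) x) =
  dil 2^-1 (fun x => fourier_trunc s f (2 * n) x - l2fourier s f x).
  by rewrite -dilB; apply/funext => x; rewrite fourier_trunc_dil.
rewrite esq_dil//.
  by apply: HN => /=; rewrite (leq_trans Nn)// leq_pmull.
by apply: cmeasB => //; exact: cmeas_fourier_trunc.
Qed.

(** Apply the rule for the factor 2 to the function dilated by 1/2, then dilate back. *)
Lemma l2fourier_dilV s f : s ^+ 2 = 1 -> sqint f ->
  {ae mu, forall y, l2fourier s (dil 2^-1 f) y = dil 2 (l2fourier s f) y}.
Proof.
move=> s2 fi; have hi := sqint_dil (k := 2^-1) ltac:(by rewrite invr_gt0) fi.
have z2 : 0 < (2 : R) by [].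
have a1 := l2fourier_dil2 s2 hi; rewrite (dilK f z2) in a1.
have [m1 _] := sqint_l2fourier s2 fi; have [m2 _] := sqint_l2fourier s2 hi.
have a2 := ae_dil z2 m1 (cmeas_dil 2^-1 m2) a1.
by rewrite (dilK (l2fourier s (dil 2^-1 f)) z2) in a2; exact: ae_sym a2.
Qed.

(** On the Fourier side, r y^2 = (4 r) (y / 2)^2: space scales by 2 and time by 4. *)
Lemma free_schrodinger_dil r f : sqint f ->
  {ae mu, forall x, free_schrodinger r (dil 2 f) x = dil 2 (free_schrodinger (4 * r) f) x}.
Proof.
move=> fi.
have s1 : (1 : R) ^+ 2 = 1 by rewrite expr1n.
have s2 : (- 1 : R) ^+ 2 = 1 by rewrite sqrrN expr1n.
have mph (t : R) : measurable_fun setT (fun y : R => - (t * y ^+ 2)).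
  by apply: measurableT_comp => //; apply: measurable_funM.
have f2i := sqint_dil (ltr0n R 2) fi.
have gi := sqint_l2fourier s1 fi; have g2i := sqint_l2fourier s1 f2i.
pose G y := cexpi (- (4 * r * y ^+ 2)) * l2fourier 1 f y.
have Gi : sqint G by exact: sqint_cexpi.
have Gd := sqint_dil (k := 2^-1) ltac:(by rewrite invr_gt0) Gi.
apply: (ae_trans (g := l2fourier (- 1) (dil 2^-1 G))); last exact: (l2fourier_dilV s2 Gi).
apply: (@ae_l2fourier R (- 1) (fun y => cexpi (- (r * y ^+ 2)) * l2fourier 1 (dil 2 f) y) (dil 2^-1 G) s2 (sqint_cexpi (mph r) g2i) Gd).
have [N [mN N0 hN]] := l2fourier_dil2 s1 fi; exists N; split => //.
apply: subset_trans hN => y /= c d; apply: c.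
rewrite d /dil /G [RHS]mulrCA; congr (cexpi _ * _); by field.
Qed.

End Dilation.

(** * Nonexistence of minimizers at the critical power 6 *)

Section NoMinimizer.
Variable R : realType.
Local Notation mu := (@lebesgue_measure R).
Local Notation normc := (@ComplexField.Normc.normc R).
Implicit Types f g h : R -> R[i].

(** The amplitude contributes (sqrt 2)^6 = 8 and the change of variable 1/2. *)
Lemma sextic_energy_dil h : cmeas h -> sextic_energy (dil 2 h) = (4%:E * sextic_energy h)%E.
Proof.
move=> mh; have ms := cmeas_sqn mh.
have n2 : (2 : R) != 0 by rewrite pnatr_eq0.
have ms3 : measurable_fun setT (fun x => (sqn (h x) ^+ 3)%:E).
  by apply/measurable_EFinP; exact: measurable_funX.
have := @ge0_integral_affine R 2 0 (fun x => (sqn (h x) ^+ 3)%:E) n2 ms3.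
move=> /(_ (fun x => ltac:(by rewrite lee_fin exprn_ge0// sqn_ge0))) H.
transitivity ((8%:R)%:E * \int[mu]_x (sqn (h (2 * x + 0)) ^+ 3)%:E)%E.
  rewrite -ge0_integralZl//.
  - apply: eq_integral => x _; rewrite /dil sqnM sqn_real sqr_sqrtr// addr0.
    by rewrite exprMn EFinM -natrX.
  - by apply: (measurableT_comp ms3); exact: measurable_affine.
  - by move=> x _; rewrite lee_fin exprn_ge0// sqn_ge0.
rewrite H muleA -EFinM ger0_norm//; congr (_%:E * _)%E; by field.
Qed.

Lemma ae_sextic_energy f g : cmeas f -> cmeas g -> {ae mu, forall x, f x = g x} ->
  sextic_energy f = sextic_energy g.
Proof.
move=> mf mg fg; apply: ge0_ae_eq_integral => //.
- by apply/measurable_EFinP; apply: measurable_funX; exact: cmeas_sqn.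
- by apply/measurable_EFinP; apply: measurable_funX; exact: cmeas_sqn.
- by move=> x _; rewrite lee_fin exprn_ge0// sqn_ge0.
- by move=> x _; rewrite lee_fin exprn_ge0// sqn_ge0.
have [N [mN N0 hN]] := fg; exists N; split => //.
by apply: subset_trans hN => x /= c d; apply: c => _; rewrite d.
Qed.

Lemma nonlocal_energy_sextic (c : R) f : 0 < c -> sqint f ->
  nonlocal_energy (power_nonlinearity c 6) \1_`[0, 1]%classic f =
  (c%:E * \int[mu]_(r in `[0%R, 1%R]) sextic_energy (free_schrodinger r f))%E.
Proof.
move=> c0 fi; have mS := measurable_sextic_energy_schrodinger fi.
rewrite -ge0_integralZl//; first last.
- by rewrite lee_fin ltW.
- by move=> r _; exact: sextic_energy_ge0.
- exact: measurable_funTS.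
rewrite [RHS]integral_mkcond; apply: eq_integral => r _.
rewrite patchE indicE; case: ifP => _; last by rewrite mule0.
rewrite mule1 /sextic_energy -ge0_integralZl//.
- apply: eq_integral => x _; rewrite /power_nonlinearity EFinM.
  by rewrite powR_mulrn ?normc_ge0// (exprM _ 2 3) normc_sqr.
- apply/measurable_EFinP; apply: measurable_funX; apply: cmeas_sqn.
  by have [] := sqint_free_schrodinger fi r.
- by move=> x _; rewrite lee_fin exprn_ge0// sqn_ge0.
- by rewrite lee_fin ltW.
Qed.

(** The factor 4 gained in space is cancelled by the Jacobian of r -> 4 r; this exact balance is the
    mass-critical scaling. *)
Lemma integral_sextic_energy_dil f : sqint f ->
  (\int[mu]_(r in `[0%R, 1%R]) sextic_energy (free_schrodinger r (dil 2 f)) =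
   \int[mu]_(r in `[0%R, 4%R]) sextic_energy (free_schrodinger r f))%E.
Proof.
move=> fi; have mS := measurable_sextic_energy_schrodinger fi.
have f2i := sqint_dil (ltr0n R 2) fi.
have n4 : (4 : R) != 0 by rewrite pnatr_eq0.
pose S r := sextic_energy (free_schrodinger r f).
have S0 r : (0 <= S r)%E by exact: sextic_energy_ge0.
have e r : sextic_energy (free_schrodinger r (dil 2 f)) = (4%:E * S (4 * r)%R)%E.
  have [m1 _] := sqint_free_schrodinger f2i r; have [m2 _] := sqint_free_schrodinger fi (4 * r).
  by rewrite (ae_sextic_energy m1 (cmeas_dil 2 m2) (free_schrodinger_dil r fi)) sextic_energy_dil.
under eq_integral do rewrite e.
have mS4 : measurable_fun setT (fun r : R => S (4 * r)).
  by apply: (measurableT_comp mS); exact: measurable_funM.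
have hZ : (\int[mu]_(r in `[0%R, 1%R]) (4%:E * S (4 * r)%R) =
    4%:E * \int[mu]_(r in `[0%R, 1%R]) S (4 * r)%R)%E.
  apply: ge0_integralZl; [exact: measurable_itv|exact: (measurable_funTS mS4)| |by rewrite lee_fin].
  by move=> r _; exact: S0.
pose P : R -> \bar R := S \_ `[0, 4]%classic.
have mP : measurable_fun setT P.
  by apply/(measurable_restrictT _ (measurable_itv _)); exact: (measurable_funTS mS).
have P0 x : (0 <= P x)%E by rewrite /P patchE; case: ifP.
have h := @ge0_integral_affine R 4 0 P n4 mP P0.
have a4 : `|4| = 4 :> R by rewrite ger0_norm.
rewrite a4 in h.
have hP : (\int[mu]_(r in `[0%R, 4%R]) S r = \int[mu]_x P x)%E by exact: integral_mkcond.
have hQ : (\int[mu]_(r in `[0%R, 1%R]) S (4 * r)%R = \int[mu]_x P (4 * x + 0)%R)%E.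
  rewrite integral_mkcond; apply: eq_integral => r _; rewrite /P !patchE addr0.
  have -> : (4 * r \in `[0, 4]%classic) = (r \in `[0, 1]%classic).
    apply/idP/idP => /set_mem h1; apply/mem_set; move: h1; rewrite /= !in_itv/= => /andP[h1 h2];
      apply/andP; split; lra.
  by [].
rewrite hZ hQ h muleA -EFinM (divff n4) mul1e; exact: (esym hP).
Qed.

Lemma no_minimizer (c lambda : R) : 0 < c -> 0 < lambda ->
  ~ exists f : R -> R[i],
      minimizer (hamiltonian 0 (power_nonlinearity c 6) \1_`[0, 1]%classic)
        (mass_sphere (@L2 R) lambda) f.
Proof.
move=> c0 l0 [f [[/L2P fi fl] fmin]]; rewrite L2norm_sqr in fl.
have [mf _] := fi.
have f2i := sqint_dil (ltr0n R 2) fi.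
have := fmin (dil 2 f).
have sph : mass_sphere (@L2 R) lambda (dil 2 f).
  by split; [exact/L2P|rewrite L2norm_sqr esq_dil].
have N1 := nonlocal_energy_sextic c0 fi.
have N2 := nonlocal_energy_sextic c0 f2i.
rewrite (integral_sextic_energy_dil fi) in N2.
move=> /(_ sph); rewrite /hamiltonian eqxx leeN2 N1 N2 {N1 N2}.
have mS := measurable_sextic_energy_schrodinger fi.
have fin1 := integral_sextic_energy_schrodinger_lty fi.
pose S r := sextic_energy (free_schrodinger r f).
rewrite -/S in mS fin1 *.
have S0 r : (0 <= S r)%E by exact: sextic_energy_ge0.
rewrite lee_pmul2l ?lte_fin// => H04.
have {}H04 : (\int[mu]_(r in `[0%R, 4%R]) S r <= \int[mu]_(r in `[0%R, 1%R]) S r)%E by [].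
move: H04.
have U : `[0, 4]%classic = `[0, 1]%classic `|` `]1, 4]%classic :> set R.
  apply/seteqP; split=> x /=; rewrite !in_itv/=.
    by move=> /andP[x0 x4]; have [x1|x1] := leP x 1; [left; rewrite x0|right; rewrite x4].
  by move=> [/andP[x0 x1]|/andP[x1 x4]]; apply/andP; split; lra.
have e04 : (\int[mu]_(r in `[0%R, 4%R]) S r =
    \int[mu]_(r in `[0%R, 1%R]) S r + \int[mu]_(r in `]1%R, 4%R]) S r)%E.
  rewrite U; apply: ge0_integral_setU.
  - exact: measurable_itv.
  - exact: measurable_itv.
  - exact: (measurable_funTS mS).
  - by move=> x _; exact: S0.
  apply/disj_setPS => x /= []; rewrite !in_itv/= => /andP[_ x1] /andP[x2 _].
  by move: x2; rewrite ltNge x1.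
rewrite e04.
have A0 : (0 <= \int[mu]_(r in `[0%R, 1%R]) S r)%E by apply: integral_ge0.
have Af : (\int[mu]_(r in `[0%R, 1%R]) S r \is a fin_num)%E by rewrite ge0_fin_numE.
(* Cancelling the integral over [0, 1] requires it to be finite: here the Strichartz estimate
   enters. *)
rewrite -[X in (_ <= X)%E]adde0 leeD2lE// => B0.
have B1 : (\int[mu]_(r in `]1%R, 4%R]) S r = 0)%E.
  by apply/eqP; rewrite eq_le B0; apply: integral_ge0.
have : ae_eq mu `]1, 4]%classic S (cst 0%E).
  apply/ae_eq_integral_abs; [exact: measurable_itv|exact: (measurable_funTS mS)|].
  by rewrite -[RHS]B1; apply: eq_integral => r _; rewrite gee0_abs.
move=> [N [mN N0 hN]].
(* The interval has length 3, so it is not contained in the exceptional null set; one good time is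
   enough. *)
have [r [r14 Sr]] : exists r, r \in `]1, 4] /\ S r = 0%E.
  apply: contrapT => /forallNP H.
  have sub : `]1, 4]%classic `<=` N.
    move=> r /= r14; apply: hN => /= /(_ r14) Sr; exact: (H r).
  have : (mu `]1%R, 4%R]%classic <= mu N)%E by apply: le_measure; rewrite ?inE.
  rewrite N0 lebesgue_measure_itv/= lte_fin ifT; last by lra.
  by rewrite -EFinB lee_fin; lra.
have [mT _] := sqint_free_schrodinger fi r.
have m3 : measurable_fun setT (fun x => (sqn (free_schrodinger r f x) ^+ 3)%:E).
  by apply/measurable_EFinP; apply: measurable_funX; exact: cmeas_sqn.
have T0 : {ae mu, forall x, free_schrodinger r f x = 0}.
  have : ae_eq mu setT (fun x => (sqn (free_schrodinger r f x) ^+ 3)%:E) (cst 0%E).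
    apply/(ae_eq_integral_abs mu measurableT m3).
    by rewrite -[RHS]Sr; apply: eq_integral => x _; rewrite gee0_abs// lee_fin exprn_ge0// sqn_ge0.
  move=> [M [mM M0 hM]]; exists M; split => //.
  apply: subset_trans hM => x /= k d; apply: k.
  have [] := d I => /eqP; rewrite expf_eq0/= => /eqP; exact: sqn_eq0.
have f0 := free_schrodinger_eq0 fi T0.
have : esq f = 0%E.
  rewrite (_ : esq f = esq (fun=> 0 : R[i])).
    by rewrite /esq; under eq_integral do rewrite sqn0; rewrite integral0.
  by apply: ae_eq_esq => //; exact: cmeas_cst.
by rewrite fl => -[] l00; rewrite l00 ltxx in l0.
Qed.

End NoMinimizer.

(** * Gaussian beams *)

Section GaussianBeam.
Variable R : realType.
Local Notation mu := (@lebesgue_measure R).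
Local Notation normc := (@ComplexField.Normc.normc R).

Lemma sqn_cgauss (a b x : R) : sqn (cgauss a b x) = gauss (2 * a) x.
Proof.
by rewrite sqnM sqn_cexpi mulr1 sqn_real expr2 gaussD /gauss; congr expR; ring.
Qed.

Lemma cgaussN (a b x : R) : cgauss a b (- x) = cgauss a b x.
Proof. by rewrite /cgauss /gauss sqrrN. Qed.

Variables (K a b : R).
Hypothesis a0 : 0 < a.

(** The squared modulus of a + i t. At time distance t from the focus, the squared width of the beam
    is proportional to [width2 t / a]. *)
Definition width2 (t : R) : R := a ^+ 2 + t ^+ 2.

Lemma width2_gt0 t : 0 < width2 t.
Proof. by rewrite /width2 ltr_wpDr ?sqr_ge0// exprn_gt0. Qed.

(** A + i B = 1 / (4 (a + i b)), the parameter of the Gaussian whose Fourier transform has parameter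
    a + i b. *)
Let A := a / (4 * width2 b).
Let B := - b / (4 * width2 b).

Let A0 : 0 < A. Proof. by rewrite divr_gt0// mulr_gt0// width2_gt0. Qed.

(* Its Fourier transform is a multiple of [exp (- (a + i b) y^2)], so that the
   beam is focused at the time [r = - b]. *)
Definition beam (x : R) : R[i] := K%:C * cgauss A B x.

Let AB : A ^+ 2 + B ^+ 2 = (16 * width2 b)^-1.
Proof.
have w := width2_gt0 b; rewrite /A /B /width2 in w *; field; by rewrite gt_eqF.
Qed.

Lemma cmeas_beam : cmeas beam.
Proof. by apply: cmeasM; [exact: cmeas_cst|exact: cmeas_cgauss]. Qed.

Lemma sqn_beam x : sqn (beam x) = K ^+ 2 * gauss (2 * A) x.
Proof. by rewrite sqnM sqn_real sqn_cgauss. Qed.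

Lemma esq_beam : esq beam = (K ^+ 2 * Num.sqrt (pi / (2 * A)))%:E.
Proof.
rewrite /esq; under eq_integral do rewrite sqn_beam EFinM.
rewrite ge0_integralZl//.
- by rewrite [RHS]EFinM; congr (_ * _)%E; apply: integral_gauss; rewrite mulr_gt0.
- by apply/measurable_EFinP; exact: measurable_gauss.
- by move=> x _; rewrite lee_fin gauss_ge0.
- by rewrite lee_fin sqr_ge0.
Qed.

Lemma sqint_beam : sqint beam.
Proof. by split; [exact: cmeas_beam|rewrite esq_beam ltry]. Qed.

Lemma cintegrable_beam : cintegrable mu beam.
Proof. by apply: cintegrableZ; exact: cintegrable_cgauss. Qed.

Let C : R[i] := fourier_const R * (K%:C * cgaussint A B 0).

Let sqnC : sqn C = 2 * (K ^+ 2 * Num.sqrt (width2 b)).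
Proof.
have w := width2_gt0 b; have p0 := @pi_gt0 R.
rewrite /C !sqnM sqn_fourier_const sqn_real sqn_cgaussint0// AB.
rewrite sqrtrV ?mulr_ge0 ?ltW// invrK sqrtrM// (_ : 16 = 4 ^+ 2); last by ring.
have pn : (pi : R) != 0 by rewrite gt_eqF.
rewrite sqrtr_sqr ger0_norm//.
by move: (@pi R) pn => q qn; field.
Qed.

Lemma fourier_beam : {ae mu, forall y, l2fourier 1 beam y = C * cgauss a b y}.
Proof.
have s1 : (1 : R) ^+ 2 = 1 by rewrite expr1n.
have [N [mN N0 hN]] := l2fourier_osc s1 sqint_beam cintegrable_beam.
exists N; split => //; apply: subset_trans hN => y /= c d; apply: c; rewrite d.
rewrite /C -[RHS]mulrA; congr (_ * _).
transitivity (K%:C * cgaussint A B (- y)).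
  rewrite /osc /cgaussint -cintZ; last exact: cintegrable_cgaussint.
  apply: eq_cint => x; rewrite /beam mulrCA; congr (_ * (cexpi _ * _)); ring.
rewrite -[RHS]mulrA cgaussintE// cgaussN AB.
have w := width2_gt0 b.
have e1 : A / (4 * (16 * width2 b)^-1) = a by rewrite /A; field; rewrite gt_eqF.
have e2 : - B / (4 * (16 * width2 b)^-1) = b by rewrite /B; field; rewrite gt_eqF.
by rewrite e1 e2.
Qed.

(** The flow replaces a + i b by a + i (b + r) on the Fourier side, and the inverse transform is
    again an explicit Gaussian. Only its modulus is recorded, since the nonlinearity depends on
    nothing else. *)
Lemma free_schrodinger_beam r :
  {ae mu, forall x, sqn (free_schrodinger r beam x) =
    K ^+ 2 * Num.sqrt (width2 b) / Num.sqrt (width2 (b + r)) *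
    gauss (a / (2 * width2 (b + r))) x}.
Proof.
have s1 : (1 : R) ^+ 2 = 1 by rewrite expr1n.
have s2 : (- 1 : R) ^+ 2 = 1 by rewrite sqrrN expr1n.
have mph : measurable_fun setT (fun y : R => - (r * y ^+ 2)).
  by apply: measurableT_comp => //; apply: measurable_funM.
pose h y := C * cgauss a (b + r) y.
have hi : cintegrable mu h by apply: cintegrableZ; exact: cintegrable_cgauss.
have h2 : sqint h.
  split; first by apply: cmeasM; [exact: cmeas_cst|exact: cmeas_cgauss].
  rewrite esqM_cst; last exact: cmeas_cgauss.
  rewrite /esq; under eq_integral do rewrite sqn_cgauss.
  by rewrite integral_gauss ?mulr_gt0// -EFinM ltry.
have gi := sqint_cexpi mph (sqint_l2fourier s1 sqint_beam).
have a1 : {ae mu, forall x, free_schrodinger r beam x = l2fourier (- 1) h x}.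
  apply: (@ae_l2fourier R (- 1) (fun y => cexpi (- (r * y ^+ 2)) * l2fourier 1 beam y) h s2 gi h2).
  have [N [mN N0 hN]] := fourier_beam; exists N; split => //.
  apply: subset_trans hN => y /= c d; apply: c; rewrite d /h mulrCA; congr (_ * _).
  by rewrite /cgauss mulrCA -cexpiD; congr (_ * cexpi _); ring.
have [N [mN N0 hN]] := ae_trans a1 (l2fourier_osc s2 h2 hi).
exists N; split => //; apply: subset_trans hN => x /= c d; apply: c; rewrite d.
have -> : osc (- - 1) h x = C * cgaussint a (b + r) x.
  rewrite /osc /cgaussint -cintZ; last exact: cintegrable_cgaussint.
  by apply: eq_cint => y; rewrite /h mulrCA; congr (_ * (cexpi _ * _)); ring.
rewrite cgaussintE// (sqnM (fourier_const R)) (sqnM C) (sqnM (cgaussint _ _ _)) sqn_fourier_const sqnC sqn_cgaussint0// sqn_cgauss.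
rewrite -/(width2 (b + r)).
have w := width2_gt0 (b + r); have p0 := @pi_gt0 R.
have sw : Num.sqrt (width2 (b + r)) != 0 by rewrite gt_eqF// sqrtr_gt0.
have -> : 2 * (a / (4 * width2 (b + r))) = a / (2 * width2 (b + r)) by field; rewrite gt_eqF.
rewrite !mulrA; congr (_ * _).
have pn : (pi : R) != 0 by rewrite gt_eqF.
move: (@pi R) (Num.sqrt (width2 (b + r))) pn sw => q s qn sn.
by field; rewrite qn sn.
Qed.

(** The power gamma / 2 of the squared modulus is again a Gaussian, with parameter [k]. *)
Lemma integral_nonlinearity_beam (c gamma r : R) : 0 < c -> 0 < gamma ->
  (\int[mu]_x (power_nonlinearity c gamma (normc (free_schrodinger r beam x)))%:E =
   (c * ((K ^+ 2 * Num.sqrt (width2 b) / Num.sqrt (width2 (b + r))) `^ (gamma / 2) *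
     (Num.sqrt (width2 (b + r)) * Num.sqrt (4 * pi / (gamma * a)))))%:E)%E.
Proof.
move=> c0 g0; set m := K ^+ 2 * _ / _.
have m0 : 0 <= m by rewrite divr_ge0 ?sqrtr_ge0// mulr_ge0 ?sqr_ge0// sqrtr_ge0.
have w := width2_gt0 (b + r).
pose k := a / (2 * width2 (b + r)) * (gamma / 2).
have k0 : 0 < k by rewrite mulr_gt0 ?divr_gt0// mulr_gt0.
have [mT _] := sqint_free_schrodinger sqint_beam r.
transitivity (\int[mu]_x ((c * m `^ (gamma / 2))%:E * (gauss k x)%:E))%E.
  apply: ge0_ae_eq_integral => //.
  - apply/measurable_EFinP; apply: measurable_funM => //.
    exact: (measurableT_comp (measurable_powR gamma) (cmeas_normc mT)).
  - by apply: emeasurable_funM => //; apply/measurable_EFinP; exact: measurable_gauss.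
  - by move=> x _; rewrite lee_fin mulr_ge0 ?powR_ge0// ltW.
  - by move=> x _; rewrite -EFinM lee_fin !mulr_ge0 ?powR_ge0 ?gauss_ge0// ltW.
  have [N [mN N0 hN]] := free_schrodinger_beam r; exists N; split => //.
  apply: subset_trans hN => x /= n d; apply: n => _.
  rewrite /power_nonlinearity normcE2 -powR12_sqrt ?sqn_ge0// -powRrM d -/m.
  rewrite (mulrC 2^-1) powRM// ?gauss_ge0// -EFinM -mulrA; congr (_ * (_ * _))%:E.
  by rewrite /gauss -expRM /k; congr expR; ring.
rewrite ge0_integralZl//.
- rewrite [in RHS]mulrA [RHS]EFinM; congr (_ * _)%E; rewrite -[RHS]/(_%:E).
  transitivity (Num.sqrt (pi / k))%:E; first exact: integral_gauss.
  congr EFin.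
  rewrite -sqrtrM; last exact: ltW.
  by congr Num.sqrt; rewrite /k; field; rewrite !gt_eqF.
- by apply/measurable_EFinP; exact: measurable_gauss.
- by move=> x _; rewrite lee_fin gauss_ge0.
- by rewrite lee_fin mulr_ge0 ?powR_ge0// ltW.
Qed.

End GaussianBeam.

(** * Weak derivatives *)

Section Bumps.
Variable R : realType.
Implicit Types (f g : R -> R) (m i j : nat).

(* These functions span a space closed under differentiation. *)
Definition flat m (x : R) : R := if 0 < x then x^-1 ^+ m * expR (- x^-1) else 0.

Lemma flat_ge0 m x : 0 <= flat m x.
Proof.
rewrite /flat; case: ifPn => // x0.
by rewrite mulr_ge0 ?expR_ge0// exprn_ge0// invr_ge0 ltW.
Qed.

Lemma flat0_le1 x : flat 0 x <= 1.
Proof.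
rewrite /flat; case: ifPn => // x0; rewrite expr0 mul1r -[leRHS](@expR0 R) ler_expR.
by rewrite oppr_le0 invr_ge0 ltW.
Qed.

(** With y = 1/x and N = m + 1, the bound e^y >= (y / N)^N gives y^m e^(-y) <= N^N / y. This linear
    decay at 0 is what differentiability there needs. *)
Lemma flat_le m x : flat m x <= m.+1%:R ^+ m.+1 * `|x|.
Proof.
rewrite /flat; case: ifPn => [x0|_]; last by rewrite mulr_ge0// exprn_ge0.
rewrite gtr0_norm//; set y := x^-1; have y0 : 0 < y by rewrite invr_gt0.
have -> : x = y^-1 by rewrite invrK.
rewrite expRN ler_pdivrMr ?expR_gt0// -mulrA.
have m0 : 0 < m.+1%:R :> R by [].
have h : (y / m.+1%:R) ^+ m.+1 <= expR y.
  rewrite (_ : expR y = expR (y / m.+1%:R) ^+ m.+1); last first.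
    by rewrite -expRM_natr divfK// gt_eqF.
  rewrite lerXn2r ?nnegrE ?expR_ge0// ?divr_ge0// ?ltW//.
  by apply: lt_le_trans (expR_ge1Dx _); rewrite ltrDr.
rewrite mulrCA [leRHS]mulrC ler_pdivlMr// -exprSr.
move: h; rewrite expr_div_n ler_pdivrMr ?exprn_gt0// mulrC; exact.
Qed.

Lemma is_derive_pow m (x : R) : is_derive x 1 (fun y : R => y ^+ m) (m%:R * x ^+ m.-1).
Proof.
elim: m => [|m IH]; first by under eq_fun do rewrite expr0; apply: is_derive_eq; rewrite mul0r.
rewrite (_ : (fun y : R => y ^+ m.+1) = (fun y => y) * (fun y => y ^+ m)); last first.
  by apply/funext => y; rewrite exprS.
apply: (is_derive_eq (is_deriveM (is_derive_id x 1) IH)).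
rewrite /GRing.scale/= mulr1; case: m {IH} => [|m] /=; first by rewrite expr0; ring.
by rewrite exprS -[m.+2]addn1 natrD; ring.
Qed.

Lemma is_derive_flat m (x : R) : is_derive x 1 (flat m) (- m%:R * flat m.+1 x + flat m.+2 x).
Proof.
have [x0|x0|x0] := ltgtP x 0.
- have e : \near x, 0 = flat m x.
    have xi : x \in `]-oo, 0[ by rewrite in_itv.
    apply: filterS (near_in_itvNyo xi) => y; rewrite in_itv/= => y0.
    by rewrite /flat ltNge (ltW y0).
  apply: (near_eq_is_derive (f := fun=> 0) e).
  by apply: is_derive_eq; rewrite /flat ltNge (ltW x0)/= mulr0 addr0.
- have e : \near x, x^-1 ^+ m * expR (- x^-1) = flat m x.
    have xi : x \in `]0, +oo[ by rewrite in_itv/= x0.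
    apply: filterS (near_in_itvoy xi) => y; rewrite in_itv/= andbT => y0.
    by rewrite /flat y0.
  pose F (y : R) := y^-1 ^+ m * expR (- y^-1).
  apply: (@near_eq_is_derive R R^o R^o F (flat m) x 1 _ e).
  have dv : is_derive x 1 (fun y : R => y^-1) (- x ^- 2).
    have := @is_deriveV R id x 1 1 (lt0r_neq0 x0) (is_derive_id x 1).
    by rewrite /GRing.scale/= mulr1.
  pose G (y : R) := y ^+ m * expR (- y).
  have dG : is_derive (x^-1) 1 G (m%:R * x^-1 ^+ m.-1 * expR (- x^-1) - x^-1 ^+ m * expR (- x^-1)).
    have d2 : is_derive (x^-1) 1 (fun y : R => expR (- y)) (- expR (- x^-1)).
      by apply: is_derive_eq; rewrite /GRing.scale/=; ring.
    have H : is_derive (x^-1) 1 G _ := is_deriveM (is_derive_pow m (x^-1)) d2.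
    by apply: (is_derive_eq H); rewrite /GRing.scale/=; ring.
  have H : is_derive x 1 F _ := @is_derive1_comp R G (fun y : R => y^-1) x _ _ dG dv.
  apply: (is_derive_eq H).
  rewrite /flat x0 -exprVn; case: m {e F G H dG} => [|m] /=; first by ring.
  by rewrite !exprS; ring.
rewrite x0; have -> : - m%:R * flat m.+1 0 + flat m.+2 0 = 0 :> R by rewrite /flat ltxx mulr0 addr0.
have f0 : flat m 0 = 0 by rewrite /flat ltxx.
(* At 0 the difference quotient of [flat m] is [flat m.+1], up to sign conventions on the negative
   side where both vanish; it tends to 0 by [flat_le]. *)
have h : (fun h : R => h^-1 *: ((flat m \o shift 0) (h *: 1) - flat m 0)) @ 0^' --> (0 : R).
  apply: cvg_within_filter.
  apply: (@norm_cvg0 _ R^o).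
  apply: (@squeeze_cvgr _ _ _ _ (fun=> 0) (fun h => m.+2%:R ^+ m.+2 * `|h|)).
  - apply: nearW => t; rewrite normr_ge0/= f0 subr0 addr0 /GRing.scale/= mulr1 normrM.
    apply: le_trans (flat_le m.+1 t); rewrite /flat; case: ifPn => t0; last by rewrite normr0 mulr0.
    rewrite gtr0_norm ?invr_gt0// ger0_norm; last by rewrite mulr_ge0 ?expR_ge0// exprn_ge0// invr_ge0 ltW.
    by rewrite mulrA -exprS.
  - exact: cvg_cst.
  - rewrite -[X in _ --> X](mulr0 (m.+2%:R ^+ m.+2)); apply: cvgM; first exact: cvg_cst.
    rewrite -[X in _ --> X](@normr0 _ R^o).
    exact: (@norm_continuous _ R^o).
apply: DeriveDef; first by apply/cvg_ex; exists 0.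
exact: (cvg_lim (@Rhausdorff R) h).
Qed.

Variables (a b k : R).

Definition bumpterm i j (x : R) : R := flat i (k * (x - a)) * flat j (k * (b - x)).

(** The linear span of the products [bumpterm i j]. It is stable under differentiation, so
    membership yields derivatives of all orders by induction, with no formula for them. *)
Inductive bumpspan : (R -> R) -> Prop :=
| Bumpterm i j : bumpspan (bumpterm i j)
| Bumplin c f g of bumpspan f & bumpspan g : bumpspan (fun x => c * f x + g x).

Lemma bumpspan_derive f : bumpspan f ->
  exists2 g, bumpspan g & forall x : R, is_derive x 1 f (g x).
Proof.
elim=> {f} [i j|c f g _ [f' sf df] _ [g' sg dg]]; last first.
  exists (fun x => c * f' x + g' x); first exact: Bumplin.
  by move=> x; have := df x; have := dg x => ? ?; apply: is_derive_eq; rewrite /GRing.scale/=; ring.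
(* The last summand is zero: the nested combinations must end in a member of the span, and zero is
   produced as - f + f. *)
exists (fun x => (- k * i%:R) * bumpterm i.+1 j x + (k * bumpterm i.+2 j x +
  ((k * j%:R) * bumpterm i j.+1 x + (- k * bumpterm i j.+2 x + (0 * bumpterm i j x + bumpterm i j x - bumpterm i j x))))).
  do 4 (apply: Bumplin; first exact: Bumpterm).
  rewrite (_ : (fun x => _) = (fun x => (-1) * bumpterm i j x + bumpterm i j x)).
    by apply: Bumplin; exact: Bumpterm.
  by apply/funext => x; ring.
move=> x.
have d1 : is_derive x 1 (fun x : R => k * (x - a)) k.
  by apply: is_derive_eq; rewrite /GRing.scale/=; ring.
have d2 : is_derive x 1 (fun x : R => k * (b - x)) (- k).
  by apply: is_derive_eq; rewrite /GRing.scale/=; ring.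
have e1 := @is_derive1_comp R (flat i) _ x _ _ (is_derive_flat i (k * (x - a))) d1.
have e2 := @is_derive1_comp R (flat j) _ x _ _ (is_derive_flat j (k * (b - x))) d2.
have H : is_derive x 1 (bumpterm i j) _ := is_deriveM e1 e2.
apply: (is_derive_eq H).
by rewrite /bumpterm /GRing.scale/=; ring.
Qed.

Lemma bumpspan_smooth f n x : bumpspan f -> derivable (derive1n n f) x 1.
Proof.
move=> sf; have : bumpspan (derive1n n f).
  elim: n => [//|n]; rewrite derive1nS => /bumpspan_derive[g sg dg].
  rewrite (_ : (derive1n n f)^`()%classic = g)//; apply/funext => y.
  by rewrite derive1E; have [_ ->] := dg y.
by move=> /bumpspan_derive[g _ dg]; have [] := dg x.
Qed.

(** On ]a, b[ this is exp (- 1/(k (x - a)) - 1/(k (b - x))), and 0 elsewhere when k > 0; as k grows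
    it tends to the indicator of ]a, b[. *)
Definition bump := bumpterm 0 0.

Lemma bump_supp x : 0 < k -> bump x != 0 -> a <= x <= b.
Proof.
move=> k0; rewrite /bump /bumpterm /flat mulf_eq0 negb_or => /andP[].
case: ifPn => [|_]; last by rewrite eqxx.
rewrite pmulr_rgt0// subr_gt0 => xa _.
case: ifPn => [|_]; last by rewrite eqxx.
by rewrite pmulr_rgt0// subr_gt0 => xb _; rewrite !ltW.
Qed.

Lemma test_function_bump : 0 < k -> test_function bump.
Proof.
move=> k0; split; first by move=> n x; apply: bumpspan_smooth; exact: Bumpterm.
apply: (@subclosed_compact _ _ `[a, b]%classic).
- exact: closed_closure.
- exact: segment_compact.
rewrite [X in _ `<=` X](closure_id _).1; last exact: itv_closed.
by apply: closureS => x /= /(bump_supp k0); rewrite in_itv.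
Qed.

Lemma bump01 x : 0 <= bump x <= 1.
Proof.
rewrite /bump /bumpterm mulr_ge0 ?flat_ge0//= -[leRHS]mulr1.
by apply: ler_pM; rewrite ?flat_ge0 ?flat0_le1.
Qed.

End Bumps.

Section WeakDerivatives.
Variable R : realType.
Local Notation mu := (@lebesgue_measure R).
Local Notation re := (@complex.Re R).
Local Notation im := (@complex.Im R).
Local Notation Rm := (measurableTypeR R).
Implicit Types (f g d : R -> R[i]) (phi p : R -> R).

Lemma test_function_continuous phi : test_function phi -> continuous phi.
Proof.
move=> [dphi _] x; apply: differentiable_continuous; apply/derivable1_diffP.
exact: (dphi 0%N x).
Qed.

Lemma test_functionD1_continuous phi : test_function phi -> continuous (derive1 phi).
Proof.
move=> [dphi _] x; apply: differentiable_continuous; apply/derivable1_diffP.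
exact: (dphi 1%N x).
Qed.

(** The derivative vanishes outside as well, because the complement of the closed support is open
    and [phi] is zero on it. *)
Lemma test_function_supp phi : test_function phi ->
  exists N : nat, forall x, ~~ (- N%:R <= x <= N%:R) -> phi x = 0 /\ derive1 phi x = 0.
Proof.
move=> [_ cK]; have /compact_bounded [M [Mr HM]] := cK.
have M1 : M < `|M| + 1 by rewrite (le_lt_trans (ler_norm M))// ltrDl.
pose N := Num.bound (`|M| + 1); exists N => x xN.
have xK : ~ closure [set x | phi x != 0] x.
  move=> /(HM _ M1) /= xM; move/negP : xN; apply; rewrite -ler_norml (le_trans xM)//.
  exact: ltW (archi_boundP (addr_ge0 (normr_ge0 M) ler01)).
split.
  by apply/eqP; apply: contrapT => /negP h; apply: xK; exact: subset_closure.
have n0 : \near x, cst 0 x = phi x.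
  apply: (@filterS _ _ _ (~` closure [set x | phi x != 0])).
    move=> y yK; apply/esym/eqP; apply: contrapT => /negP h; apply: yK; exact: subset_closure.
  by apply: open_nbhs_nbhs; split => //; rewrite openC; exact: closed_closure.
by rewrite derive1E -(near_eq_derive _ n0) derive_cst.
Qed.

Lemma integrable_continuous_csupp (h : R -> R) (N : nat) : continuous h ->
  (forall x, ~~ (- N%:R <= x <= N%:R) -> h x = 0) -> mu.-integrable setT (EFin \o h).
Proof.
move=> ch h0.
have : mu.-integrable `[- N%:R, N%:R]%classic (EFin \o h).
  apply: continuous_compact_integrable; first exact: segment_compact.
  exact: continuous_subspaceT.
move=> i; have := (@integrable_mkcond _ Rm R mu _ (EFin \o h) (measurable_itv `[- N%:R, N%:R])).1 i.
apply: eq_integrable => // x _; rewrite patchE; case: ifPn => // /negP xN.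
rewrite /= h0//; apply/negP => h1; apply: xN; apply/mem_set; by rewrite /= in_itv.
Qed.

Lemma integral_by_parts_test phi p dp : test_function phi ->
  (forall x : R, is_derive x 1 p (dp x)) -> continuous dp ->
  \int[mu]_x (derive1 phi x * p x) = - \int[mu]_x (phi x * dp x).
Proof.
move=> tp dpp cdp; have cp := continuous_derive dpp.
have c0 := test_function_continuous tp; have c1 := test_functionD1_continuous tp.
have [N HN] := test_function_supp tp.
have i1 : mu.-integrable setT (EFin \o (fun x => derive1 phi x * p x)).
  apply: (@integrable_continuous_csupp _ N); first by move=> x; exact: (cvgM (c1 x) (cp x)).
  by move=> x /HN[_ ->]; rewrite mul0r.
have i0 : mu.-integrable setT (EFin \o (fun x => phi x * dp x)).
  apply: (@integrable_continuous_csupp _ N); first by move=> x; exact: (cvgM (c0 x) (cdp x)).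
  by move=> x /HN[-> _]; rewrite mul0r.
apply/eqP; rewrite -subr_eq0 opprK -RintegralD//; apply/eqP.
apply: (@Rintegral_derive R _ (phi * p)).
- move=> x; have dphi : is_derive x 1 phi (derive1 phi x).
    by rewrite derive1E; apply: DeriveDef => //; exact: (tp.1 0%N x).
  by apply: (is_derive_eq (is_deriveM dphi (dpp x))); rewrite /GRing.scale/=; ring.
- by move=> x; exact: (cvgD (cvgM (c1 x) (cp x)) (cvgM (c0 x) (cdp x))).
- by have := integrableD measurableT i1 i0; apply: eq_integrable.
- apply: cvg_near_cst; exists N.+1 => // n /= Nn.
  have [z _] : phi n%:R = 0 /\ derive1 phi n%:R = 0.
    by apply: HN; rewrite negb_and -!ltNge ltr_nat Nn orbT.
  by rewrite /GRing.mul/= z mul0r.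
- apply: cvg_near_cst; exists N.+1 => // n /= Nn.
  have [z _] : phi (- n%:R) = 0 /\ derive1 phi (- n%:R) = 0.
    by apply: HN; rewrite negb_and -!ltNge ltrN2 ltr_nat Nn.
  by rewrite /GRing.mul/= z mul0r.
Qed.

Lemma weak_derivative_C1 (f df : R -> R[i]) :
  (forall x : R, is_derive x 1 (re \o f) (re (df x))) -> continuous (re \o df) ->
  (forall x : R, is_derive x 1 (im \o f) (im (df x))) -> continuous (im \o df) ->
  weak_derivative f df.
Proof.
move=> d1 c1 d2 c2 phi tp.
have h1 := integral_by_parts_test tp d1 c1; have h2 := integral_by_parts_test tp d2 c2.
apply: eq_c; rewrite ?reN ?imN /=.
  rewrite (_ : \int[mu]_x _ = \int[mu]_x (derive1 phi x * re (f x))); last first.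
    by apply: eq_Rintegral => x _; rewrite reM/= mul0r subr0.
  rewrite [LHS]h1; congr (- _); apply: eq_Rintegral => x _; by rewrite reM/= mul0r subr0.
rewrite (_ : \int[mu]_x _ = \int[mu]_x (derive1 phi x * im (f x))); last first.
  by apply: eq_Rintegral => x _; rewrite imM/= mul0r addr0.
rewrite [LHS]h2; congr (- _); apply: eq_Rintegral => x _; by rewrite imM/= mul0r addr0.
Qed.

(** Bumps with k = n + 1 converge to the indicator of [a, b] off the endpoints and are dominated by
    it; so the integrals of [p] over intervals vanish. *)
Lemma test_pairing_eq0 p : rsqint p ->
  (forall phi, test_function phi -> \int[mu]_x (phi x * p x) = 0) -> {ae mu, forall x, p x = 0}.
Proof.
move=> pi2 p0; apply: interval_integral_eq0 => // a b ab.
have [mp _] := pi2.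
pose phi (n : nat) := bump a b n.+1%:R.
have mb n : measurable_fun setT (phi n).
  apply: continuous_measurable_fun; apply: test_function_continuous.
  by apply: test_function_bump.
have lim x : x != a -> x != b -> phi n x @[n --> \oo] --> (\1_`[a, b]%classic x : R).
  move=> xa xb; rewrite indicE; case: (boolP (x \in `[a, b]%classic)) => [/set_mem|/negP xn].
    rewrite /= in_itv/= => /andP[ax bx].
    have ax' : 0 < x - a by rewrite subr_gt0 lt_neqAle eq_sym xa.
    have bx' : 0 < b - x by rewrite subr_gt0 lt_neqAle xb.
    have F (y : R) : 0 < y -> flat 0 (n.+1%:R * y) @[n --> \oo] --> (1 : R).
      move=> y0; have -> : (fun n => flat 0 (n.+1%:R * y)) = (fun n => expR (- (n.+1%:R^-1 * y^-1))).
        by apply/funext => n; rewrite /flat pmulr_rgt0// y0 expr0 mul1r invfM.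
      rewrite -[X in _ --> X](@expR0 R); apply: continuous_cvg; first exact: continuous_expR.
      rewrite -oppr0; apply: cvgN; rewrite -[X in _ --> X](mul0r y^-1).
      by apply: cvgM; [exact: cvg_harmonic|exact: cvg_cst].
    by rewrite /= -[X in _ --> X]mulr1; apply: cvgM; exact: F.
  apply: cvg_near_cst; apply: nearW => n; apply/eqP; apply: contrapT => /negP h.
  by apply: xn; apply/mem_set; rewrite /= in_itv/= (bump_supp _ h).
have : \int[mu]_x (phi n x * p x) @[n --> \oo] --> \int[mu]_x (\1_`[a, b]%classic x * p x).
  apply: (@Rint_dominated_cvg R _ _ mu _ _ (fun x => `|\1_`[a, b]%classic x * p x|)).
  - by move=> n; exact: (measurable_funM (mb n) mp).
  - by have /integrableP[/measurable_EFinP] := rsqint_indic a b pi2.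
  - exists [set a; b]; split; first exact: measurableU.
      by apply: countable_lebesgue_measure0; apply: finite_set_countable; exact: finite_set2.
    move=> x /= h; apply: contrapT => /not_orP[/eqP xa /eqP xb]; apply: h.
    by apply: cvgM; [exact: lim|exact: cvg_cst].
  - exact: (integrable_norm (rsqint_indic _ _ pi2)).
  move=> n x; have /andP[b0 b1] := bump01 a b n.+1%:R x.
  rewrite (normrM (phi n x)) (normrM (\1_`[a, b]%classic x)); apply: ler_wpM2r => //.
  rewrite (ger0_norm b0) indicE; case: (boolP (x \in `[a, b]%classic)) => [_|/negP xn]; first by rewrite normr1.
  suff -> : bump a b n.+1%:R x = 0 by rewrite normr0.
  apply/eqP; apply: contrapT => /negP h.
  by apply: xn; apply/mem_set; rewrite /= in_itv/= (bump_supp _ h).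
rewrite (_ : (fun n => \int[mu]_x (phi n x * p x)) = (fun=> 0)); last first.
  by apply/funext => n; apply: p0; exact: test_function_bump.
by move=> /(cvg_lim (@Rhausdorff R)) <-; apply/cvg_lim => //; exact: cvg_cst.
Qed.

Lemma rsqint_re d : sqint d -> rsqint (fun x => re (d x)).
Proof.
move=> di; have [[m1 m2] _] := di; split => //; apply: le_integrable (integrable_sqn di) => //.
  by apply/measurable_EFinP; exact: measurable_funX.
by move=> x _; rewrite /= lee_fin ger0_norm ?sqr_ge0// ger0_norm ?sqn_ge0// lerDl sqr_ge0.
Qed.

Lemma rsqint_im d : sqint d -> rsqint (fun x => im (d x)).
Proof.
move=> di; have [[m1 m2] _] := di; split => //; apply: le_integrable (integrable_sqn di) => //.
  by apply/measurable_EFinP; exact: measurable_funX.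
by move=> x _; rewrite /= lee_fin ger0_norm ?sqr_ge0// ger0_norm ?sqn_ge0// lerDr sqr_ge0.
Qed.

Lemma integrable_test_rsqint phi p : test_function phi -> rsqint p ->
  mu.-integrable setT (EFin \o (fun x => phi x * p x)).
Proof.
move=> tp [mp ip]; have c0 := test_function_continuous tp.
have [N HN] := test_function_supp tp.
have ip2 : mu.-integrable setT (EFin \o (fun x => phi x ^+ 2)).
  apply: (@integrable_continuous_csupp _ N); first by move=> x; exact: (cvgM (c0 x) (c0 x)).
  by move=> x /HN[-> _]; rewrite expr0n.
have := integrableD measurableT ip2 ip; apply: le_integrable => //.
  by apply/measurable_EFinP; apply: measurable_funM => //; exact: continuous_measurable_fun.
move=> x _; rewrite /= lee_fin [leRHS]ger0_norm ?addr_ge0 ?sqr_ge0//.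
rewrite normrM -(real_normK (num_real (phi x))) -(real_normK (num_real (p x))).
move: (normr_ge0 (phi x)) (normr_ge0 (p x)); move: `|phi x| `|p x| => y z y0 z0.
have := sqr_ge0 (y - z); nra.
Qed.

(** Since [wderiv] picks some weak derivative, this is what allows its norm to be computed from an
    explicit one. *)
Lemma weak_derivative_unique f g h : sqint g -> sqint h ->
  weak_derivative f g -> weak_derivative f h -> {ae mu, forall x, g x = h x}.
Proof.
move=> gi hi wg wh; have di := sqintB gi hi.
have E phi : test_function phi -> cint mu (fun x => (phi x)%:C * g x) = cint mu (fun x => (phi x)%:C * h x).
  by move=> tp; apply: oppr_inj; rewrite -[LHS](wg phi tp) -[RHS](wh phi tp).
have a1 : {ae mu, forall x, re (g x - h x) = 0}.
  apply: test_pairing_eq0; first exact: rsqint_re.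
  move=> phi tp; have := congr1 re (E phi tp) => /=.
  have ig := integrable_test_rsqint tp (rsqint_re gi); have ih := integrable_test_rsqint tp (rsqint_re hi).
  rewrite (_ : \int[mu]_x _ = \int[mu]_x (phi x * re (g x))); last first.
    by apply: eq_Rintegral => x _; rewrite reM/= mul0r subr0.
  rewrite [X in _ = X](_ : _ = \int[mu]_x (phi x * re (h x))); last first.
    by apply: eq_Rintegral => x _; rewrite reM/= mul0r subr0.
  move=> e; rewrite (_ : \int[mu]_x _ = \int[mu]_x (phi x * re (g x) - phi x * re (h x))).
    by rewrite RintegralB// e subrr.
  by apply: eq_Rintegral => x _; rewrite reD reN mulrBr.
have a2 : {ae mu, forall x, im (g x - h x) = 0}.
  apply: test_pairing_eq0; first exact: rsqint_im.
  move=> phi tp; have := congr1 im (E phi tp) => /=.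
  have ig := integrable_test_rsqint tp (rsqint_im gi); have ih := integrable_test_rsqint tp (rsqint_im hi).
  rewrite (_ : \int[mu]_x _ = \int[mu]_x (phi x * im (g x))); last first.
    by apply: eq_Rintegral => x _; rewrite imM/= mul0r addr0.
  rewrite [X in _ = X](_ : _ = \int[mu]_x (phi x * im (h x))); last first.
    by apply: eq_Rintegral => x _; rewrite imM/= mul0r addr0.
  move=> e; rewrite (_ : \int[mu]_x _ = \int[mu]_x (phi x * im (g x) - phi x * im (h x))).
    by rewrite RintegralB// e subrr.
  by apply: eq_Rintegral => x _; rewrite imD imN mulrBr.
apply: (@ae_imply2 R (fun x => re (g x - h x) = 0) (fun x => im (g x - h x) = 0)
  (fun x => g x = h x) a1 a2) => x e1 e2.
by apply/eqP; rewrite -subr_eq0; apply/eqP; apply: eq_c.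
Qed.

End WeakDerivatives.

(** * The kinetic energy of a beam *)

Section BeamDerivative.
Variable R : realType.
Local Notation mu := (@lebesgue_measure R).
Local Notation re := (@complex.Re R).
Local Notation im := (@complex.Im R).
Variables (K a b : R).
Hypothesis a0 : 0 < a.
Let A := a / (4 * width2 a b).
Let B := - b / (4 * width2 a b).

Let w0 : 0 < width2 a b. Proof. exact: width2_gt0. Qed.
Let A0 : 0 < A. Proof. by rewrite divr_gt0// mulr_gt0. Qed.

Definition dbeam (x : R) : R[i] :=
  (K * (- (2 * x)))%:C * ((A +i* B) * cgauss A B x).

Lemma sqn_dbeam x : sqn (dbeam x) = K ^+ 2 / (4 * width2 a b) * (x ^+ 2 * gauss (2 * A) x).
Proof.
rewrite /dbeam sqnM sqn_real sqnM sqn_cgauss.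
have -> : sqn (A +i* B) = (16 * width2 a b)^-1.
  by have w := w0; rewrite /sqn/= /A /B /width2 in w *; field; rewrite gt_eqF.
by have w := w0; field; rewrite gt_eqF.
Qed.

Lemma cmeas_dbeam : cmeas dbeam.
Proof.
apply: cmeasM.
  by apply: cmeas_real; apply: measurable_funM => //; apply: measurableT_comp.
by apply: cmeasM; [exact: cmeas_cst|exact: cmeas_cgauss].
Qed.

(** The bound does not involve [b], because |A + i B|^2 / A = 1 / (4 a): kinetic energy is conserved
    by the flow, so the choice of the focusing time is free of charge. The factor 2 absorbs the sqrt
    2 lost when half of the Gaussian dominates x^2. *)
Lemma esq_dbeam_le : (esq dbeam <= (2 / a)%:E * esq (beam K a b))%E.
Proof.
have c0 : 0 <= K ^+ 2 / (4 * width2 a b) by rewrite divr_ge0 ?sqr_ge0// mulr_ge0// ltW.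
apply: (@le_trans _ _ (\int[mu]_x ((K ^+ 2 / a)%:E * (gauss A x)%:E))%E).
  apply: ge0_le_integral => //.
  - by move=> x _; rewrite lee_fin sqn_ge0.
  - by apply/measurable_EFinP; apply: cmeas_sqn; exact: cmeas_dbeam.
  - by apply: emeasurable_funM => //; apply/measurable_EFinP; exact: measurable_gauss.
  move=> x _; rewrite sqn_dbeam -EFinM lee_fin.
  have A2 : 0 < 2 * A by rewrite mulr_gt0.
  apply: (le_trans (ler_wpM2l c0 (sqr_gauss_le x A2))).
  rewrite (_ : 2 * A / 2 = A); last by field.
  rewrite mulrA le_eqVlt; apply/orP; left; apply/eqP; congr (_ * _).
  by have w := w0; rewrite /A; field; rewrite !gt_eqF.
rewrite ge0_integralZl//; first last.
- by rewrite lee_fin divr_ge0 ?sqr_ge0// ltW.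
- by move=> x _; rewrite lee_fin gauss_ge0.
- by apply/measurable_EFinP; exact: measurable_gauss.
rewrite esq_beam// -/A -EFinM.
have -> : (\int[mu]_x (gauss A x)%:E = (Num.sqrt (pi / A))%:E)%E by exact: integral_gauss.
rewrite -EFinM lee_fin.
have -> : 2 / a * (K ^+ 2 * Num.sqrt (pi / (2 * A))) = K ^+ 2 / a * (2 * Num.sqrt (pi / (2 * A))).
  by field; rewrite gt_eqF.
apply: ler_wpM2l; first by rewrite divr_ge0 ?sqr_ge0// ltW.
have -> : 2 * Num.sqrt (pi / (2 * A)) = Num.sqrt (4 * (pi / (2 * A))).
  have s4 : Num.sqrt 4 = 2 :> R by rewrite (_ : 4 = 2 ^+ 2) ?sqrtr_sqr ?ger0_norm//; ring.
  by rewrite [RHS]sqrtrM// s4.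
have p0 := @pi_gt0 R; have A' := A0.
rewrite ler_wsqrtr// (_ : 4 * (pi / (2 * A)) = 2 * (pi / A)); last first.
  by move: (@pi R) => q; field; rewrite gt_eqF.
have : 0 <= pi / A by rewrite divr_ge0 ?ltW.
lra.
Qed.

Lemma sqint_dbeam : sqint dbeam.
Proof.
split; first exact: cmeas_dbeam.
by apply: le_lt_trans esq_dbeam_le _; rewrite esq_beam// -EFinM ltry.
Qed.

Lemma weak_derivative_beam : weak_derivative (beam K a b) dbeam.
Proof.
have dt (x : R) : is_derive x 1 (fun x : R => - (B * x ^+ 2)) (- (2 * B * x)).
  have H := is_derive_pow 2 x.
  by apply: is_derive_eq; rewrite /GRing.scale/=; ring.
have dc (x : R) : is_derive x 1 (fun x : R => cos (- (B * x ^+ 2))) (sin (- (B * x ^+ 2)) * (2 * B * x)).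
  have H : is_derive x 1 (fun x : R => cos (- (B * x ^+ 2))) _ :=
    @is_derive1_comp R cos _ x _ _ (is_derive_cos (- (B * x ^+ 2))) (dt x).
  by apply: (is_derive_eq H); ring.
have ds (x : R) : is_derive x 1 (fun x : R => sin (- (B * x ^+ 2))) (- cos (- (B * x ^+ 2)) * (2 * B * x)).
  have H : is_derive x 1 (fun x : R => sin (- (B * x ^+ 2))) _ :=
    @is_derive1_comp R sin _ x _ _ (is_derive_sin (- (B * x ^+ 2))) (dt x).
  by apply: (is_derive_eq H); ring.
have cx : continuous (fun x : R => x) by move=> x; exact: cvg_id.
have cg := @continuous_gauss R A.
have cc := continuous_derive dc; have cs := continuous_derive ds.
have c1 : continuous (fun x : R => K * (- (2 * x))).
  by move=> x; apply: cvgM; [exact: cvg_cst|apply: cvgN; apply: cvgM; [exact: cvg_cst|exact: cx]].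
apply: weak_derivative_C1.
- move=> x; have dg := is_derive_gauss A x; have dcx := dc x.
  have H : is_derive x 1 (fun x : R => K * (gauss A x * cos (- (B * x ^+ 2)))) (re (dbeam x)).
    by apply: is_derive_eq; rewrite /dbeam /GRing.scale/=; ring.
  rewrite (_ : re \o beam K a b = (fun x : R => K * (gauss A x * cos (- (B * x ^+ 2)))))//.
  by apply/funext => y; rewrite /beam /=; ring.
- rewrite (_ : re \o dbeam = (fun x : R => K * (- (2 * x)) *
     (gauss A x * (A * cos (- (B * x ^+ 2)) - B * sin (- (B * x ^+ 2)))))); last first.
    by apply/funext => y; rewrite /dbeam /=; ring.
  move=> x; apply: cvgM; first exact: c1.
  by apply: cvgM; [exact: cg|apply: cvgB; apply: cvgM; [exact: cvg_cst|exact: cc|exact: cvg_cst|exact: cs]].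
- move=> x; have dg := is_derive_gauss A x; have dsx := ds x.
  have H : is_derive x 1 (fun x : R => K * (gauss A x * sin (- (B * x ^+ 2)))) (im (dbeam x)).
    by apply: is_derive_eq; rewrite /dbeam /GRing.scale/=; ring.
  rewrite (_ : im \o beam K a b = (fun x : R => K * (gauss A x * sin (- (B * x ^+ 2)))))//.
  by apply/funext => y; rewrite /beam /=; ring.
- rewrite (_ : im \o dbeam = (fun x : R => K * (- (2 * x)) *
     (gauss A x * (A * sin (- (B * x ^+ 2)) + B * cos (- (B * x ^+ 2)))))); last first.
    by apply/funext => y; rewrite /dbeam /=; ring.
  move=> x; apply: cvgM; first exact: c1.
  by apply: cvgM; [exact: cg|apply: cvgD; apply: cvgM; [exact: cvg_cst|exact: cs|exact: cvg_cst|exact: cc]].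
Qed.

Lemma H1_beam : H1 (beam K a b).
Proof.
split; first by apply/L2P; exact: sqint_beam.
by exists dbeam; [apply/L2P; exact: sqint_dbeam|exact: weak_derivative_beam].
Qed.

Lemma esq_wderiv_beam_le : (esq (wderiv (beam K a b)) <= (2 / a)%:E * esq (beam K a b))%E.
Proof.
apply: le_trans esq_dbeam_le; rewrite /wderiv; case: xgetP => [g gE [/L2P gi wg]|].
  rewrite (_ : esq g = esq dbeam)//.
  apply: ae_eq_esq; [by have [] := gi|exact: cmeas_dbeam|].
  exact: (weak_derivative_unique gi sqint_dbeam wg weak_derivative_beam).
move=> /(_ dbeam); case; split; [apply/L2P; exact: sqint_dbeam|exact: weak_derivative_beam].
Qed.

End BeamDerivative.

(** * Concentration *)

Section Concentration.
Variable R : realType.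
Local Notation mu := (@lebesgue_measure R).
Variable psi : R -> R.
Hypothesis dpsi : probability_density psi.

Let mpsi : measurable_fun setT (EFin \o psi).
Proof. by have [h _ _] := dpsi; exact/measurable_EFinP. Qed.

Let psi0 r : (0 <= (psi r)%:E)%E.
Proof. by have [_ h _] := dpsi; rewrite lee_fin. Qed.

Lemma density_support_itv : compactly_supported psi ->
  exists2 M : R, 0 < M & (\int[mu]_(r in `[(- M)%R, M[%classic) (psi r)%:E = 1)%E.
Proof.
move=> cs; have [N [_ hN]] := compact_bounded cs.
(* One unit gives the strict inequality that boundedness asks for, the other keeps the support away
   from the excluded right endpoint. *)
pose M := `|N| + 1 + 1; exists M; first by rewrite /M; have := normr_ge0 N; lra.
have [_ _ <-] := dpsi; rewrite integral_mkcond; apply: eq_integral => r _.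
rewrite patchE; case: ifPn => // /negP rM; congr EFin; apply/esym/eqP.
apply: contrapT => /negP rn; apply: rM; apply/mem_set.
have : `|r| <= `|N| + 1.
  apply: hN; first by rewrite (le_lt_trans (ler_norm N))// ltrDl.
  exact: subset_closure.
rewrite /= in_itv/= ler_norml /M => /andP[]; lra.
Qed.

Lemma density_subdivision (x d e : R) (n : nat) : 0 <= d ->
  (forall i : nat, (i < n)%N ->
    (\int[mu]_(r in `[(x + i%:R * d)%R, (x + i.+1%:R * d)%R[%classic) (psi r)%:E <= e%:E)%E) ->
  (\int[mu]_(r in `[x, (x + n%:R * d)%R[%classic) (psi r)%:E <= (n%:R * e)%:E)%E.
Proof.
move=> d0; elim: n => [_|n ih he].
  by rewrite mul0r addr0 set_itvco0 integral_set0 mul0r.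
have -> : `[x, (x + n.+1%:R * d)%R[%classic =
    `[x, (x + n%:R * d)%R[%classic `|` `[(x + n%:R * d)%R, (x + n.+1%:R * d)%R[%classic.
  apply/seteqP; split=> [r|r [|]] /=; rewrite !in_itv/=.
  - move=> /andP[h1 h2]; case: (ltP r (x + n%:R * d)) => h; [left|right]; first by rewrite h1.
    by rewrite h2.
  - by move=> /andP[-> /lt_le_trans ->]//; rewrite lerD2l ler_wpM2r// ler_nat.
  - by move=> /andP[h ->]; rewrite andbT (le_trans _ h)// lerDl mulr_ge0.
rewrite ge0_integral_setU//.
- rewrite (_ : n.+1%:R * e = n%:R * e + e); last by rewrite -natr1; ring.
  rewrite EFinD; apply: leeD; last exact: he.
  by apply: ih => i ni; apply: he; rewrite ltnS ltnW.
- exact: (measurable_funTS mpsi).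
- apply/disj_set2P/seteqP; split=> // r [] /=; rewrite !in_itv/= => /andP[_ h1] /andP[h2 _].
  by move: (lt_le_trans h1 h2); rewrite ltxx.
Qed.

(** Pigeonhole over n + 1 pieces of length 2 M / (n+1). The piece is described by its centre - b,
    the focusing time of the beam with parameter [b], and by its half-length, which will be the
    parameter [a]. *)
Lemma density_concentrated (M : R) (n : nat) : 0 < M ->
  (\int[mu]_(r in `[(- M)%R, M[%classic) (psi r)%:E = 1)%E ->
  exists b : R, ((n.+1%:R^-1)%:E <=
    \int[mu]_(r in `[(- b - M / n.+1%:R)%R, (- b + M / n.+1%:R)%R[%classic) (psi r)%:E)%E.
Proof.
move=> M0 h1; apply: contrapT => /forallNP hb.
have n0 : (n.+1%:R : R) != 0 by rewrite pnatr_eq0.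
pose d := 2 * M / n.+1%:R.
have d0 : 0 <= d by rewrite !mulr_ge0 ?invr_ge0// ltW.
pose I i := (\int[mu]_(r in `[(- M + i%:R * d)%R, (- M + i.+1%:R * d)%R[%classic) (psi r)%:E)%E.
have I0 i : (0 <= I i)%E by apply: integral_ge0.
have hI i : (I i < (n.+1%:R^-1)%:E)%E.
  (* The witness is minus the midpoint of the i-th piece. *)
  rewrite ltNge; apply/negP => hi; apply: (hb (M - i%:R * d - M / n.+1%:R)).
  apply: le_trans hi _; rewrite /I.
  rewrite (_ : - (M - i%:R * d - M / n.+1%:R) - M / n.+1%:R = - M + i%:R * d); last by ring.
  rewrite (_ : - (M - i%:R * d - M / n.+1%:R) + M / n.+1%:R = - M + i.+1%:R * d)//.
  by rewrite -[i.+1]addn1 natrD /d; ring.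
(* Finitely many strict inequalities leave a common margin below 1/(n+1), so that summing the pieces
   gives a total strictly below 1. *)
have [e en eI] : exists2 e : R, e < n.+1%:R^-1 & forall i : nat, (i < n.+1)%N -> (I i <= e%:E)%E.
  elim: {2}n.+1 => [|k [e e1 e2]]; first by exists (n.+1%:R^-1 - 1) => //; rewrite gtrBl.
  have fI : I k = (fine (I k))%:E.
    by rewrite fineK// ge0_fin_numE// (lt_trans (hI k)) ?ltry.
  exists (Num.max e (fine (I k))).
    by rewrite gt_max e1/= -lte_fin -fI.
  move=> i; rewrite ltnS leq_eqVlt => /orP[/eqP->|ik].
    by rewrite fI lee_fin le_max lexx orbT.
  by apply: le_trans (e2 _ ik) _; rewrite lee_fin le_max lexx.
have := density_subdivision d0 eI.
rewrite (_ : - M + n.+1%:R * d = M); last by rewrite /d; field.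
rewrite h1 lee_fin => h2.
have : n.+1%:R * e < n.+1%:R * n.+1%:R^-1 by rewrite ltr_pM2l.
by rewrite mulfV// => /(le_lt_trans h2); rewrite ltxx.
Qed.

End Concentration.

(** * Nonlocal energy of concentrating beams *)

Section BeamEnergy.
Variable R : realType.
Local Notation mu := (@lebesgue_measure R).

(** [K] normalizes the mass. The second product governs the height of the evolved beam; its value
    depends on [a] and [lambda] only, so the focused profile is the same for every focusing time. *)
Lemma beam_amplitude (a b lambda : R) : 0 < a -> 0 < lambda -> exists K : R,
  K ^+ 2 * Num.sqrt (pi / (2 * (a / (4 * width2 a b)))) = lambda /\
  K ^+ 2 * Num.sqrt (width2 a b) = lambda * Num.sqrt (a / (2 * pi)).
Proof.
move=> a0 l0; have w := width2_gt0 a0 b; have p0 := @pi_gt0 R.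
set s := Num.sqrt (pi / _).
have s0 : 0 < s by rewrite sqrtr_gt0 divr_gt0// mulr_gt0// divr_gt0// mulr_gt0.
exists (Num.sqrt (lambda / s)); rewrite sqr_sqrtr ?divr_ge0 ?ltW//.
split; first by rewrite divfK// gt_eqF.
suff -> : Num.sqrt (width2 a b) = s * Num.sqrt (a / (2 * pi)).
  by rewrite mulrA divfK// gt_eqF.
rewrite /s -sqrtrM; last by rewrite ltW// divr_gt0// mulr_gt0// divr_gt0// mulr_gt0.
congr Num.sqrt; have pn : (pi : R) != 0 by rewrite gt_eqF.
by move: (@pi R) pn => q qn; field; rewrite qn !gt_eqF.
Qed.

Lemma powR_divrM (m rho p : R) : 0 <= m -> 0 < rho -> 0 < p ->
  (m / rho) `^ p * rho = m * (m / rho) `^ (p - 1).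
Proof.
move=> m0 r0 p0; rewrite -(mulr_powRB1 _ p0) ?divr_ge0// ?ltW//.
by field; rewrite gt_eqF.
Qed.

(** The root of [width2] is at least a at all times, and at most sqrt 2 a during the time a around
    the focus; the energy density in time decreases with it. The upper bound serves to show that the
    functional is finite on beams, as unboundedness concerns real values. *)
Lemma nonlocal_energy_beam_le (psi : R -> R) (K a b c gamma : R) :
  probability_density psi -> 0 < a -> 0 < c -> 2 <= gamma ->
  let m := K ^+ 2 * Num.sqrt (width2 a b) in
  (nonlocal_energy (power_nonlinearity c gamma) psi (beam K a b) <=
   (c * (m * (m / a) `^ (gamma / 2 - 1) * Num.sqrt (4 * pi / (gamma * a))))%:E)%E /\
  forall q : R, 0 <= q ->
   (q%:E <= \int[mu]_(r in `[(- b - a)%R, (- b + a)%R[%classic) (psi r)%:E)%E ->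
   ((c * (m * (m / (Num.sqrt 2 * a)) `^ (gamma / 2 - 1) * Num.sqrt (4 * pi / (gamma * a))) * q)%:E <=
     nonlocal_energy (power_nonlinearity c gamma) psi (beam K a b))%E.
Proof.
move=> [mpsi psi0 psi1] a0 c0 g2 m.
have g0 : 0 < gamma by lra.
have p1 : 0 <= gamma / 2 - 1 by lra.
have p0 : 0 < gamma / 2 by lra.
set S := Num.sqrt (4 * pi / _).
have S0 : 0 <= S by exact: sqrtr_ge0.
have m0 : 0 <= m by rewrite mulr_ge0 ?sqr_ge0 ?sqrtr_ge0.
pose rho r := Num.sqrt (width2 a (b + r)).
have rho0 r : 0 < rho r by rewrite sqrtr_gt0 width2_gt0.
pose G r := c * (m * (m / rho r) `^ (gamma / 2 - 1) * S).
have F0 v : 0 <= c * (m * v `^ (gamma / 2 - 1) * S).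
  by apply: (mulr_ge0 (ltW c0)); apply: (mulr_ge0 _ S0); apply: (mulr_ge0 m0); exact: powR_ge0.
have G0 r : 0 <= G r by exact: F0.
have GE : nonlocal_energy (power_nonlinearity c gamma) psi (beam K a b) =
    (\int[mu]_r (G r * psi r)%:E)%E.
  apply: eq_integral => r _.
  rewrite (integral_nonlinearity_beam K b a0 r c0 g0) -EFinM; congr (_ * _)%:E.
  by rewrite /G -powR_divrM// !mulrA.
have mono u v : 0 < u -> u <= v -> c * (m * (m / v) `^ (gamma / 2 - 1) * S) <= c * (m * (m / u) `^ (gamma / 2 - 1) * S).
  move=> u0 uv; have v0 := lt_le_trans u0 uv.
  rewrite ler_pM2l// ler_wpM2r// ler_wpM2l// ge0_ler_powR//.
  - by rewrite nnegrE divr_ge0// ltW.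
  - by rewrite nnegrE divr_ge0// ltW.
  - by rewrite ler_wpM2l// lef_pV2.
have mG : measurable_fun setT G.
  have mr : measurable_fun setT (fun r => m / rho r).
    apply: continuous_measurable_fun => r; apply: cvgM; first exact: cvg_cst.
    apply: cvgV; first by rewrite gt_eqF.
    have cw : {for r, continuous (fun r => width2 a (b + r))}.
      apply: cvgD; first exact: cvg_cst.
      by apply: cvgM; (apply: cvgD; [exact: cvg_cst|exact: cvg_id]).
    exact: (continuous_comp cw (@sqrt_continuous R _)).
  apply: measurable_funM => //; apply: measurable_funM => //; apply: measurable_funM => //.
  exact: (measurableT_comp (measurable_powR _) mr).
have mGp : measurable_fun setT (fun r => (G r * psi r)%:E).
  by apply/measurable_EFinP; apply: measurable_funM.
have mp : measurable_fun setT (EFin \o psi) by apply/measurable_EFinP.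
rewrite GE; split.
  set k := c * _; have k0 : (0 <= k%:E)%E by rewrite lee_fin; exact: F0.
  have e : (\int[mu]_r (k%:E * (psi r)%:E) = k%:E)%E.
    transitivity (k%:E * \int[mu]_r (psi r)%:E)%E; last by rewrite psi1 mule1.
    by apply: ge0_integralZl => // r _; rewrite lee_fin.
  rewrite -{}e; apply: ge0_le_integral => //.
  - by move=> r _; rewrite lee_fin mulr_ge0.
  - by apply: emeasurable_funM.
  move=> r _; rewrite -EFinM lee_fin ler_wpM2r//; apply: mono => //.
  rewrite -[leLHS](ger0_norm (ltW a0)) -sqrtr_sqr ler_sqrt ?(ltW (width2_gt0 a0 _))//.
  by rewrite lerDl sqr_ge0.
move=> q q0 hq.
apply: le_trans (_ : (\int[mu]_(r in `[(- b - a)%R, (- b + a)%R[%classic) (G r * psi r)%:E <= _)%E); last first.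
  by apply: ge0_subset_integral => // r _; rewrite lee_fin mulr_ge0.
rewrite EFinM.
set k := c * _.
have k0 : 0 <= k by exact: F0.
apply: le_trans (lee_wpmul2l _ hq) _; first by rewrite lee_fin.
have e : (\int[mu]_(r in `[(- b - a)%R, (- b + a)%R[%classic) (k%:E * (psi r)%:E) =
    k%:E * \int[mu]_(r in `[(- b - a)%R, (- b + a)%R[%classic) (psi r)%:E)%E.
  apply: ge0_integralZl => //; last by move=> r _; rewrite lee_fin.
  exact: (measurable_funTS mp).
rewrite -{}e; apply: ge0_le_integral => //.
- by move=> r _; rewrite mule_ge0 ?lee_fin.
- by apply: emeasurable_funM => //; exact: (measurable_funTS mp).
- exact: (measurable_funTS mGp).
move=> r /=; rewrite in_itv/= => /andP[r1 r2].
rewrite -EFinM lee_fin ler_wpM2r//; apply: mono => //.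
rewrite -[X in _ * X](ger0_norm (ltW a0)) -sqrtr_sqr -sqrtrM// ler_sqrt; last first.
  by rewrite mulr_ge0 ?sqr_ge0.
rewrite /width2; nra.
Qed.

(** The scale is t = a^(-1/2). The constant [C] is fixed before [c], so that largeness of [c] can be
    measured against it. *)
Lemma concentrating_beams (psi : R -> R) (gamma lambda : R) :
  probability_density psi -> compactly_supported psi -> 2 <= gamma -> 0 < lambda ->
  exists2 C : R, 0 < C & forall c X : R, 0 < c ->
  exists t f, [/\ X <= t, H1 f, (L2norm f ^+ 2 = lambda%:E)%E,
    (L2norm (wderiv f) ^+ 2 <= (2 * lambda * t ^+ 2)%:E)%E &
    ((c * (C * t `^ (gamma / 2 - 3)))%:E <=
      nonlocal_energy (power_nonlinearity c gamma) psi f < +oo)%E].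
Proof.
move=> dp cs g2 l0; have [M M0 hM] := density_support_itv dp cs.
have p0 := @pi_gt0 R; have g0 : 0 < gamma by lra.
pose k := lambda / (2 * Num.sqrt pi).
have k0 : 0 < k by rewrite divr_gt0// mulr_gt0// sqrtr_gt0.
(* [k * t] will be the least height of the squared modulus near the focus; sqrt (2 / gamma) is what
   remains of the normalization and of the Gaussian integral; 1/M comes from the mass a / M of the
   chosen piece. *)
pose C := lambda * Num.sqrt (2 / gamma) * k `^ (gamma / 2 - 1) / M.
have C0 : 0 < C.
  by rewrite divr_gt0// mulr_gt0 ?powR_gt0// mulr_gt0// sqrtr_gt0 divr_gt0.
exists C => // c X c0.
(* Large enough that 1/a = (n+1) / M exceeds X^2, that is, t >= X. *)
pose n := Num.bound (M * X ^+ 2).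
pose a := M / n.+1%:R.
have n0 : 0 < n.+1%:R :> R by rewrite ltr0n.
have a0 : 0 < a by rewrite divr_gt0.
have [b hb] := density_concentrated dp n M0 hM.
have [K [K1 K2]] := beam_amplitude b a0 l0.
pose t := (Num.sqrt a)^-1.
have sa : 0 < Num.sqrt a by rewrite sqrtr_gt0.
have t0 : 0 < t by rewrite invr_gt0.
have t2 : t ^+ 2 = a^-1 by rewrite /t exprVn sqr_sqrtr// ltW.
have [hu hl] := nonlocal_energy_beam_le K b dp a0 c0 g2.
exists t, (beam K a b); split.
- apply: le_trans (ler_norm X) _.
  rewrite -(@ler_pXn2r _ 2)// ?nnegrE ?ltW// t2 real_normK ?num_real// invf_div.
  rewrite ltr_pdivlMr// mulrC (lt_trans (archi_boundP _))// ?ltr_nat//.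
  by rewrite mulr_ge0 ?sqr_ge0// ltW.
- exact: H1_beam.
- by rewrite L2norm_sqr esq_beam// K1.
- rewrite L2norm_sqr; apply: le_trans (esq_wderiv_beam_le K b a0) _.
  by rewrite esq_beam// K1 -EFinM lee_fin t2 mulrAC.
apply/andP; split; last by apply: le_lt_trans hu _; rewrite ltry.
have q0 : 0 <= n.+1%:R^-1 :> R by rewrite invr_ge0 ltW.
apply: le_trans (hl _ q0 hb); rewrite lee_fin K2 -mulrA ler_pM2l//.
have -> : lambda * Num.sqrt (a / (2 * pi)) / (Num.sqrt 2 * a) = k * t.
  rewrite /k /t (@sqrtrM _ a _ (ltW a0)) (@sqrtrV _ (2 * pi)) ?mulr_ge0 ?ltW// (@sqrtrM _ 2 pi (ler0n _ _)).
  rewrite -[X in _ / (_ * X)](sqr_sqrtr (ltW a0)).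
  have s2 : Num.sqrt 2 * Num.sqrt 2 = 2 :> R by rewrite -expr2 sqr_sqrtr.
  have s2n : Num.sqrt 2 != 0 :> R by rewrite gt_eqF// sqrtr_gt0.
  have spn : Num.sqrt pi != 0 :> R by rewrite gt_eqF// sqrtr_gt0.
  have san : Num.sqrt a != 0 by rewrite gt_eqF.
  rewrite -[in RHS]s2; move: (Num.sqrt 2) (Num.sqrt pi) (Num.sqrt a) s2n spn san => u v w un vn wn.
  by field; rewrite un vn wn.
rewrite powRM ?(ltW k0) ?(ltW t0)//.
have -> : lambda * Num.sqrt (a / (2 * pi)) * (k `^ (gamma / 2 - 1) * t `^ (gamma / 2 - 1)) *
    Num.sqrt (4 * pi / (gamma * a)) =
    lambda * Num.sqrt (2 / gamma) * k `^ (gamma / 2 - 1) * t `^ (gamma / 2 - 1).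
  have -> : Num.sqrt (2 / gamma) = Num.sqrt (a / (2 * pi)) * Num.sqrt (4 * pi / (gamma * a)).
    rewrite -sqrtrM; last by rewrite ltW// divr_gt0// mulr_gt0.
    congr Num.sqrt; have pn : (pi : R) != 0 by rewrite gt_eqF.
    by move: (@pi R) pn => q qn; field; rewrite qn !gt_eqF.
  by ring.
(* The mass 1/(n+1) = a / M of [psi] near the focus costs a factor t^2, which lowers the exponent
   gamma/2 - 1 to gamma/2 - 3. *)
have -> : t `^ (gamma / 2 - 1) = t `^ (gamma / 2 - 3) * t ^+ 2.
  rewrite -powR_mulrn ?ltW// -powRD; first by congr powR; ring.
  by apply/implyP => _; rewrite gt_eqF.
rewrite t2 /C /a le_eqVlt; apply/orP; left; apply/eqP.
by field; rewrite !gt_eqF.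
Qed.

End BeamEnergy.

(** * Unboundedness from below *)

Section Unboundedness.
Variable R : realType.

Lemma powR_unbounded (q B : R) : 0 < q -> exists2 X : R, 1 <= X & forall t, X <= t -> B <= t `^ q.
Proof.
move=> q0; exists (1 + `|B| `^ q^-1); first by rewrite lerDl powR_ge0.
move=> t Xt; apply: le_trans (ler_norm B) _.
have Bt : `|B| `^ q^-1 <= t by apply: le_trans Xt; rewrite lerDr.
rewrite -[leLHS]powRr1// -(mulVf (lt0r_neq0 q0)) powRrM.
apply: (ge0_ler_powR (ltW q0) _ _ Bt); rewrite nnegrE ?powR_ge0//.
by apply: le_trans Bt; exact: powR_ge0.
Qed.

(** After division by t^2 the kinetic term is at most dav lambda and the nonlocal one at least c C
    t^(gamma/2 - 5). The stated condition leaves a surplus of 1, hence H <= - t^2; it covers both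
    gamma > 10, with t large, and gamma = 10, with c large. *)
Lemma unbounded_below_H1 (dav : R) (psi : R -> R) (gamma lambda : R) :
  0 < dav -> probability_density psi -> compactly_supported psi ->
  10 <= gamma -> 0 < lambda ->
  exists2 C : R, 0 < C & forall c : R, 0 < c ->
    (exists2 X : R, 1 <= X & forall t, X <= t -> dav * lambda + 1 <= c * C * t `^ (gamma / 2 - 5)) ->
    unbounded_below (hamiltonian dav (power_nonlinearity c gamma) psi) (mass_sphere (@H1 R) lambda).
Proof.
move=> d0 dp cs g10 l0; have g2 : 2 <= gamma by lra.
have [C C0 hC] := concentrating_beams dp cs g2 l0.
exists C => // c c0 [X X1 hX] Mb.
(* Besides t >= X this forces t > |Mb|, so that - t^2 <= - t < Mb. *)
have [t [f [tX Hf nf kf /andP[nl nu]]]] := hC c (X + `|Mb| + 1) c0.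
have Mb0 := normr_ge0 Mb; have tX' : X <= t by lra.
exists f; first by split.
rewrite /hamiltonian gt_eqF//.
have nfin : nonlocal_energy (power_nonlinearity c gamma) psi f \is a fin_num.
  by rewrite fin_numE gt_eqF ?lt_eqF// (lt_le_trans _ nl)// ltNyr.
have kge : (0 <= L2norm (wderiv f) ^+ 2)%E by rewrite L2norm_sqr esq_ge0.
have kfin : (L2norm (wderiv f) ^+ 2)%E \is a fin_num.
  by rewrite ge0_fin_numE// (le_lt_trans kf)// ltry.
move: nl kf; rewrite -(fineK nfin) -(fineK kfin) !lee_fin -EFinM -EFinB ltNyr lte_fin /=.
set N := fine (nonlocal_energy _ _ _); set k := fine (_ * _) => nl kf.
have t1 : 1 <= t by lra.
have e : t `^ (gamma / 2 - 3) = t `^ (gamma / 2 - 5) * t ^+ 2.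
  rewrite -powR_mulrn; last by lra.
  rewrite -powRD; first by congr powR; ring.
  by apply/implyP => _; rewrite gt_eqF//; lra.
rewrite e in nl.
have h := hX _ tX'.
have h2 : (dav * lambda + 1) * t ^+ 2 <= N.
  by have := ler_wpM2r (sqr_ge0 t) h; move: nl; lra.
have h3 : dav / 2 * k <= dav / 2 * (2 * lambda * t ^+ 2) by rewrite ler_pM2l// divr_gt0.
have h4 : dav / 2 * (2 * lambda * t ^+ 2) = dav * lambda * t ^+ 2 by field.
have h5 : t <= t ^+ 2 by rewrite expr2 ler_peMl//; lra.
have := ler_norm (- Mb); rewrite normrN.
lra.
Qed.

Lemma unbounded_below_L2 (psi : R -> R) (c gamma lambda : R) :
  probability_density psi -> compactly_supported psi ->
  0 < c -> 6 < gamma -> 0 < lambda ->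
  unbounded_below (hamiltonian 0 (power_nonlinearity c gamma) psi) (mass_sphere (@L2 R) lambda).
Proof.
move=> dp cs c0 g6 l0 Mb; have g2 : 2 <= gamma by lra.
have [C C0 hC] := concentrating_beams dp cs g2 l0.
have q0 : 0 < gamma / 2 - 3 by lra.
(* With no kinetic term it is enough that c C t^(gamma/2 - 3) exceeds |Mb| by 1. *)
have [X X1 hX] := powR_unbounded ((`|Mb| + 1) / (c * C)) q0.
have [t [f [tX [Lf _] nf _ /andP[nl nu]]]] := hC c X c0.
exists f; first by split.
rewrite /hamiltonian eqxx.
have nfin : nonlocal_energy (power_nonlinearity c gamma) psi f \is a fin_num.
  by rewrite fin_numE gt_eqF ?lt_eqF// (lt_le_trans _ nl)// ltNyr.
move: nl; rewrite -(fineK nfin) lee_fin -EFinN ltNyr lte_fin /=; set N := fine _ => nl.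
have h := hX _ tX; rewrite ler_pdivrMr ?mulr_gt0// in h.
have := ler_norm (- Mb); rewrite normrN.
move: nl h; rewrite -[t `^ _ * _]mulrC -mulrA => nl h; have := le_trans h nl; lra.
Qed.

End Unboundedness.

Local Close Scope complex_scope.

Theorem theorem1p6 (R : realType) :
  (forall (dav : R) (psi : R -> R),
     0 < dav -> probability_density psi -> compactly_supported psi ->
     positive_near_zero psi ->
     (forall c gamma lambda : R, 0 < c -> 10 < gamma -> 0 < lambda ->
        unbounded_below (hamiltonian dav (power_nonlinearity c gamma) psi)
          (mass_sphere (@H1 R) lambda)) /\
     (forall lambda : R, 0 < lambda ->
        exists2 c0 : R, 0 < c0 & forall c : R, c0 < c ->
          unbounded_below (hamiltonian dav (power_nonlinearity c 10) psi)
            (mass_sphere (@H1 R) lambda)))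
  /\
  (forall psi : R -> R,
     probability_density psi -> compactly_supported psi ->
     positive_near_zero psi ->
     forall c gamma lambda : R, 0 < c -> 6 < gamma -> 0 < lambda ->
       unbounded_below (hamiltonian 0 (power_nonlinearity c gamma) psi)
         (mass_sphere (@L2 R) lambda))
  /\
  (forall c lambda : R, 0 < c -> 0 < lambda ->
     ~ exists f : R -> R[i]%C,
         minimizer (hamiltonian 0 (power_nonlinearity c 6) \1_`[0, 1])
           (mass_sphere (@L2 R) lambda) f).
Proof.
split; [|split].
- move=> dav psi d0 dp cs _; split=> [c gamma lambda c0 g10 l0|lambda l0].
    have [C C0 h] := unbounded_below_H1 d0 dp cs (ltW g10) l0.
    apply: h => //; have q0 : 0 < gamma / 2 - 5 by lra.
    have [X X1 hX] := powR_unbounded ((dav * lambda + 1) / (c * C)) q0.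
    by exists X => // t /hX; rewrite ler_pdivrMr ?mulr_gt0// [X in _ <= X]mulrC.
  have [C C0 h] := unbounded_below_H1 d0 dp cs (lexx 10) l0.
  have b0 : 0 < dav * lambda + 1 by rewrite addr_gt0// mulr_gt0.
  (* At gamma = 10 the power of t is t^0 = 1, so that the condition reads c C >= dav lambda + 1. The
     threshold depends on [psi] through [C]. *)
  exists ((dav * lambda + 1) / C); first by rewrite divr_gt0.
  move=> c hc; have c0 : 0 < c by apply: lt_trans hc; rewrite divr_gt0.
  apply: h => //; exists 1 => // t t1.
  rewrite (_ : 10 / 2 - 5 = 0); last by field.
  by rewrite powRr0 mulr1 -ler_pdivrMr// ltW.
- by move=> psi dp cs _ c gamma lambda c0 g6 l0; exact: unbounded_below_L2.
- exact: no_minimizer.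
Qed.
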